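(* Let $(p_n)\subset(1,\infty)$ be such that $p_n\to p\in(1,\infty)$ as $n\to\infty$. Let $q>p$, with also $q>p_n$ for every $n$, and for every $n\in\mathbb N$ let $u_{p_n}\in\mathcal C_{p_n}$ be a solution of $(P_m)$ with $m=p_n$. Then there exist a subsequence of $(u_{p_n})$ (not relabeled) and a function $u_p\in\mathcal C_p$ which is a solution of $(P_m)$ with $m=p$, such that $u_{p_n}\to u_p$ in $W^{1,p}(B)$ and in $C^{0,\beta}(\bar B)$ for every $\beta\in(0,1)$.
   Context: $B$ is the open unit ball of $\mathbb R^N$, $N\ge 1$, and $\nu$ is the outer unit normal of $\partial B$. For $1<m<\infty$ and $q>m$ (the exponent $q$ may be Sobolev-supercritical), $(P_m)$ denotes the Neumann problem $$-\Delta_m u+u^{m-1}=u^{q-1}\ \text{ in } B,\qquad u>0 \text{ and } u \text{ radial in } B,\qquad \frac{\partial u}{\partial\nu}=0\ \text{ on }\partial B,$$ where $\Delta_m u=\mathrm{div}(|\nabla u|^{m-2}\nabla u)$. The exponent $q$ is fixed and is the same for all values of $m$ under consideration. For radial $u$ write $u(|x|)=u(x)$. The cone $\mathcal C_m$ is $$\mathcal C_m=\{u\in W^{1,m}_{\mathrm{rad}}(B): u\ge 0,\ u(r_1)\le u(r_2)\text{ for all }0<r_1\le r_2\le 1\},$$ where $W^{1,m}_{\mathrm{rad}}(B)$ is the space of radial functions in $W^{1,m}(B)$. Functions in $\mathcal C_m$ are bounded. A solution $u\in\mathcal C_m$ of $(P_m)$ is understood in the weak sense: $u>0$ in $B$ and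 $\int_B(|\nabla u|^{m-2}\nabla u\cdot\nabla\varphi+u^{m-1}\varphi)\,dx=\int_B u^{q-1}\varphi\,dx$ for all $\varphi\in W^{1,m}(B)$. By standard elliptic regularity such solutions belong to $C^{1,\alpha}(\bar B)$ for some $\alpha\in(0,1)$. *)

(* Defs.v *)
From HB Require Import structures.
From mathcomp Require Import all_boot all_order all_algebra.
From mathcomp Require Import all_classical all_reals all_analysis.

Set Implicit Arguments.
Unset Strict Implicit.
Unset Printing Implicit Defensive.
Import Order.TTheory GRing.Theory Num.Theory.
Import numFieldNormedType.Exports.

Local Open Scope classical_set_scope.
Local Open Scope ring_scope.

(* R^N is 'rV[R]_N with the product sigma-algebra generated by the N
   coordinates, i.e. the Borel sigma-algebra, as for n.-tuple in MathComp-Analysis. *)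

Definition measure_rV_display : measure_display.
Proof. exact: default_measure_display. Qed.

Section measurable_rV.
Context {R : realType}.
Variable n : nat.

Let coords : 'I_n -> 'rV[R]_n -> R := fun i x => x ord0 i.

Let rV_set0 : g_sigma_preimage coords set0.
Proof. exact: sigma_algebra0. Qed.

Let rV_setC A : g_sigma_preimage coords A -> g_sigma_preimage coords (~` A).
Proof. exact: sigma_algebraC. Qed.

Let rV_bigcup (F : _^nat) : (forall i, g_sigma_preimage coords (F i)) ->
  g_sigma_preimage coords (\bigcup_i (F i)).
Proof. exact: sigma_algebra_bigcup. Qed.

HB.instance Definition _ := @isMeasurable.Build measure_rV_display
  'rV[R]_n (g_sigma_preimage coords) rV_set0 rV_setC rV_bigcup.

End measurable_rV.

Lemma measurable_rV_coord (R : realType) n (i : 'I_n) :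
  measurable_fun [set: 'rV[R]_n] (fun x : 'rV[R]_n => x ord0 i).
Proof.
move=> _ Y mY; rewrite setTI; apply: sub_sigma_algebra => /=.
rewrite -bigcup_seq/=; exists i => /=; first by rewrite mem_index_enum.
by exists Y => //; rewrite setTI.
Qed.

Lemma measurable_fun_rVP d (T : measurableType d) (R : realType) n
    (f : T -> 'rV[R]_n) :
  (forall i, measurable_fun [set: T] (fun x => f x ord0 i)) ->
  measurable_fun [set: T] f.
Proof.
move=> mf; have sub : g_sigma_preimage (fun i x => f x ord0 i) `<=`
    (measurable : set (set T)).
  apply: smallest_sub; first exact: sigma_algebra_measurable.
  rewrite -bigcup_seq/=; apply: bigcup_sub => i _ A [B mB <-].
  exact: mf.
move=> _ A mA; apply: sub.
rewrite -[g_sigma_preimage _]/(g_sigma_preimage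
  (fun i : 'I_n => (fun x : 'rV[R]_n => x ord0 i) \o f)) g_sigma_preimage_comp.
by exists A.
Qed.

Section lebesgue_rV.
Context {R : realType}.

Definition rV_cons n (x : R * 'rV[R]_n) : 'rV[R]_n.+1 :=
  row_mx x.1%:M x.2 : 'rV[R]_(1 + n).

Definition rV_uncons n (x : 'rV[R]_n.+1) : R * 'rV[R]_n :=
  (x ord0 ord0, \row_j x ord0 (lift ord0 j)).

Lemma rV_cons0 n (x : R * 'rV[R]_n) : rV_cons x ord0 ord0 = x.1.
Proof.
have := row_mxEl (x.1%:M : 'M[R]_1) x.2 ord0 ord0.
rewrite [in X in _ = X]mxE eqxx mulr1n => <-.
by congr (fun_of_matrix (row_mx _ _) _ _); exact/val_inj.
Qed.

Lemma rV_consS n (x : R * 'rV[R]_n) j :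
  rV_cons x ord0 (lift ord0 j) = x.2 ord0 j.
Proof.
have := row_mxEr (x.1%:M : 'M[R]_1) x.2 ord0 j.
by move=> <-; congr (fun_of_matrix (row_mx _ _) _ _); exact/val_inj.
Qed.

Lemma rV_consK n : cancel (@rV_cons n) (@rV_uncons n).
Proof.
move=> [a y]; rewrite /rV_uncons rV_cons0; congr pair.
by apply/rowP => j; rewrite mxE rV_consS.
Qed.

Lemma measurable_rV_cons n : measurable_fun setT (@rV_cons n).
Proof.
apply: measurable_fun_rVP => i.
case: (unliftP ord0 i) => [j ->|->].
  under eq_fun do rewrite rV_consS.
  exact: (measurableT_comp (@measurable_rV_coord R n j)).
under eq_fun do rewrite rV_cons0.
exact: measurable_fst.
Qed.

Lemma measurable_rV_uncons n : measurable_fun setT (@rV_uncons n).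
Proof.
apply: measurable_fun_pair; first exact: measurable_rV_coord.
apply: measurable_fun_rVP => i; under eq_fun do rewrite mxE.
exact: measurable_rV_coord.
Qed.

Section step.
Variables (n : nat) (mu : {sigma_finite_measure set 'rV[R]_n -> \bar R}).

Definition lebesgue_rV_step : set 'rV[R]_n.+1 -> \bar R :=
  pushforward (lebesgue_measure \x mu)%E (@rV_cons n).

Let step0 : lebesgue_rV_step set0 = 0%E.
Proof. by rewrite /lebesgue_rV_step /pushforward preimage_set0 measure0. Qed.

Let step_ge0 A : (0 <= lebesgue_rV_step A)%E.
Proof. by rewrite /lebesgue_rV_step /pushforward measure_ge0. Qed.

Let step_sigma_additive : semi_sigma_additive lebesgue_rV_step.
Proof.
move=> F mF tF mUF; rewrite /lebesgue_rV_step /pushforward preimage_bigcup.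
have mS A : measurable A -> measurable (@rV_cons n @^-1` A).
  by move=> mA; rewrite -[X in measurable X]setTI; exact: measurable_rV_cons.
apply: measure_semi_sigma_additive.
- by move=> i; exact: mS.
- apply/trivIsetP => /= i j _ _ ij; rewrite -preimage_setI.
  by move/trivIsetP : tF => /(_ _ _ _ _ ij) ->//; rewrite preimage_set0.
- by rewrite -preimage_bigcup; exact: mS.
Qed.

HB.instance Definition _ := isMeasure.Build _ _ _ lebesgue_rV_step
  step0 step_ge0 step_sigma_additive.

Let step_sigma_finite : sigma_finite setT lebesgue_rV_step.
Proof.
have /sigma_finiteP[F [FT ndF Foo]] := sigma_finiteT (@lebesgue_measure R).
have /sigma_finiteP[G [GT ndG Goo]] := sigma_finiteT mu.
exists (fun k => @rV_uncons n @^-1` (F k `*` G k)).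
  apply/esym; rewrite -subTset => x _.
  have [k _ Fk] : (\bigcup_k F k) (rV_uncons x).1 by rewrite -FT.
  have [l _ Gl] : (\bigcup_k G k) (rV_uncons x).2 by rewrite -GT.
  exists (maxn k l) => //; split.
    by apply: (subsetPset _ _ (ndF _ _ (leq_maxl k l))).
  by apply: (subsetPset _ _ (ndG _ _ (leq_maxr k l))).
move=> k; have [mF Fk] := Foo k; have [mG Gk] := Goo k; split.
  rewrite -[X in measurable X]setTI; apply: measurable_rV_uncons => //.
  exact: measurableX.
rewrite /lebesgue_rV_step /pushforward -comp_preimage.
rewrite (_ : _ \o _ = id); last by apply/funext => x; exact: rV_consK.
by rewrite preimage_id product_measure1E// lte_mul_pinfty// ge0_fin_numE.
Qed.

HB.instance Definition _ := Measure_isSigmaFinite.Build _ _ _ lebesgue_rV_step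
  step_sigma_finite.

End step.

(* the N-dimensional Lebesgue measure, as an iterated product *)
Fixpoint lebesgue_rV n : {sigma_finite_measure set 'rV[R]_n -> \bar R} :=
  match n with
  | 0 => \d_(0 : 'rV[R]_0)
  | k.+1 => lebesgue_rV_step (lebesgue_rV k)
  end.

End lebesgue_rV.

Section function_spaces.
Context {R : realType} {N : nat}.
Implicit Types (u f g : 'rV[R]_N -> R) (G : 'rV[R]_N -> 'rV[R]_N) (m q beta : R).

Definition dotv (x y : 'rV[R]_N) : R := \sum_i x ord0 i * y ord0 i.

(* The Euclidean norm: the norm `|x| of 'rV[R]_N is the sup norm. *)
Definition enorm (x : 'rV[R]_N) : R := Num.sqrt (dotv x x).

Definition B : set 'rV[R]_N := [set x | enorm x < 1].
Definition cB : set 'rV[R]_N := [set x | enorm x <= 1].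

Local Notation leb := (@lebesgue_rV R N).

Definition partial (i : 'I_N) f : 'rV[R]_N -> R := 'D_(delta_mx ord0 i) f.

Definition partials (s : seq 'I_N) f := foldr partial f s.

Definition smooth f := forall s : seq 'I_N,
  continuous (partials s f) /\
  forall i x, derivable (partials s f) x (delta_mx ord0 i).

(* C_c^oo(B) *)
Definition test_function f := smooth f /\
  exists K : set 'rV[R]_N,
    [/\ compact K, K `<=` B & forall x, ~ K x -> f x = 0].

Definition locally_integrable_B f := forall K : set 'rV[R]_N,
  compact K -> K `<=` B -> leb.-integrable K (EFin \o f).

Definition weak_gradient u G := [/\ locally_integrable_B u,
  forall i, locally_integrable_B (fun x => G x ord0 i) &
  forall phi, test_function phi -> forall i,
    \int[leb]_(x in B) (u x * partial i phi x) =
    - \int[leb]_(x in B) (G x ord0 i * phi x)].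

(* the weak gradient, which is unique up to a null set, and 0 if there is none *)
Definition wgrad u : 'rV[R]_N -> 'rV[R]_N := xget (cst 0) (weak_gradient u).

(* Functions on B are represented by functions on R^N whose values outside
   of B are irrelevant: f \_ B is the extension of f by 0. *)
Definition LB m f := (f \_ B) \in Lfun leb m%:E.

Definition LB_norm m f : \bar R := 'N[leb]_(m%:E)[EFin \o (f \_ B)]%E.

Definition W1 m u := [/\ LB m u, exists G, weak_gradient u G &
  forall i, LB m (fun x => wgrad u x ord0 i)].

Definition W1_norm m u : \bar R :=
  (LB_norm m u + LB_norm m (fun x => enorm (wgrad u x)))%E.

Definition W1_cvg m (u_ : nat -> 'rV[R]_N -> R) u :=
  [/\ forall n, W1 m (u_ n), W1 m u & W1_norm m (u_ n - u) @[n --> \oo] --> 0%E].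

Definition radial u := forall x y, cB x -> enorm x = enorm y -> u x = u y.

Definition W1rad m u := W1 m u /\ radial u.

Definition cone m u := [/\ W1rad m u,
  forall x, cB x -> 0 <= u x &
  forall x y, 0 < enorm x -> enorm x <= enorm y -> enorm y <= 1 -> u x <= u y].

(* weak solutions in the cone; the boundary condition is encoded in the fact that
   the trace of phi is arbitrary. The integrand |grad u|^(m-2) grad u is 0 where
   grad u = 0, including for m < 2. *)
Definition solution m q u := [/\ cone m u, forall x, B x -> 0 < u x &
  forall phi, W1 m phi ->
    \int[leb]_(x in B) (enorm (wgrad u x) `^ (m - 2) *
                          dotv (wgrad u x) (wgrad phi x) +
                        u x `^ (m - 1) * phi x) =
    \int[leb]_(x in B) (u x `^ (q - 1) * phi x)].

Definition holder_norm beta f : \bar R :=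
  (ereal_sup [set `|f x|%:E | x in cB] +
   ereal_sup [set (`|f x.1 - f x.2| / enorm (x.1 - x.2) `^ beta)%:E | x in
     [set x : 'rV[R]_N * 'rV[R]_N | [/\ cB x.1, cB x.2 & x.1 != x.2]]])%E.

Definition holder beta f := (holder_norm beta f < +oo)%E.

(* Elements of W^{1,m}(B) are classes modulo null sets: convergence in
   C^{0,beta}(cB) is that of their continuous representatives v_ n. The limit u is
   required to be its own continuous representative. *)
Definition holder_cvg beta (u_ : nat -> 'rV[R]_N -> R) u :=
  exists v_ : nat -> 'rV[R]_N -> R,
    [/\ forall n, v_ n = u_ n %[ae leb in B],
        forall n, holder beta (v_ n),
        holder beta u &
        holder_norm beta (v_ n - u) @[n --> \oo] --> 0%E].

End function_spaces.

(* Main.v *)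
Require Import Defs.
From mathcomp Require Import all_boot all_order all_algebra.
From mathcomp Require Import all_classical all_reals all_analysis.
From mathcomp Require Import measurable_realfun.
From mathcomp Require Import ring lra.
Import Order.TTheory GRing.Theory Num.Theory.
Import numFieldNormedType.Exports.
Local Open Scope classical_set_scope.
Local Open Scope ring_scope.
Set Implicit Arguments.
Unset Strict Implicit.
Unset Printing Implicit Defensive.

(** Nondecreasing radial solutions of the problem obey bounds that do not depend on
    the exponent, and they solve an ordinary differential equation that passes to
    the limit.

    Write t = |x|^N, let U be the solution as a function of t, k = U^(m-1) - U^(q-1)
    ([source]) and K the integral of k over [0, t] ([primitive]).  Integrated over the
    ball of radius r, the equation says that the slope h = u' satisfies
    h(r)^(m-1) = K(r^N) / (N r^(N-1)), and the Neumann condition is K(1) = 0.  A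
    [profile] is a solution of this reduced problem, and [slope] solves its equation
    for h.

    The passage from weak solutions to profiles rests on the divergence theorem.  For the
    field K(|x|^N) |x|^(-N) x it holds against every function that has an integrable weak
    gradient, as soon as k is a bounded monotone function minus its mean
    ([gauss_monotone]) or a difference of two of these ([defect_source]): for smooth k of
    mean zero that vanish near 0 and 1 the components of the field are test functions;
    indicators of half-lines minus their means are limits of those, and monotone functions
    are uniform limits of sums of indicators.  Hence the radial function with slope h satisfies the same weak equation as u, with the same
    right-hand side ([radial_equation]).  Testing both equations with both functions and
    subtracting, the strict monotonicity of the field |a|^(m-2) a shows that their
    gradients agree ([solution_gradient_ae]).  Finally, a function whose weak gradient
    vanishes has the same mean over all annuli, so that the monotone function U is the
    radial function with slope h up to a constant ([ray_profileE]).

    Bounds: k changes sign once, from plus to minus, and has mean zero, so K >= 0;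
    moreover K(t) <= t U(t)^(m-1), so h <= u ([slope_le]).  Thus u at most doubles on each
    half of the radius, which gives u(1) <= 4 u(0).  As k has mean zero, 1 lies between
    u(0) and u(1) ([flux1_eq0_crossing]).  Together, 1/4 <= u <= 4 and
    0 <= h <= 4, whatever m and q are ([solution_profile]).

    Compactness: the solutions are equi-Lipschitz, so a subsequence converges uniformly
    ([lipschitz_subsequence]).  Then k converges pointwise, since powers are jointly
    continuous in base and exponent ([powR_cvg]), so do K by dominated convergence and
    the slopes ([slope_cvg]), and the limit is a profile for the exponent p
    ([limit_profile]), hence a solution ([profile_solution]).  The bounded pointwise
    convergence of the slopes gives the convergence of the gradients in L^p
    ([LB_norm_cvg0]), and interpolating between the sup norm and the Lipschitz bound gives
    that in the Hoelder norms ([holder_norm_le]). *)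

(** * Integrals of real-valued functions *)

Section real_integrals.
Context d (T : measurableType d) (R : realType) (mu : {measure set T -> \bar R}).
Implicit Types (D : set T) (f g h : T -> R).

Lemma integrable_measurable D f :
  mu.-integrable D (EFin \o f) -> measurable_fun D f.
Proof. by move=> /measurable_int /measurable_EFinP. Qed.

Lemma integrable_le D f g : measurable D -> measurable_fun D f ->
  (forall x, D x -> `|f x| <= g x) ->
  mu.-integrable D (EFin \o g) -> mu.-integrable D (EFin \o f).
Proof.
move=> mD mf fg ig; apply: le_integrable ig => //; first exact/measurable_EFinP.
move=> x Dx /=; by rewrite lee_fin (le_trans (fg x Dx))// ler_norm.
Qed.

Lemma integrable_bounded D f (M : R) : measurable D -> (mu D < +oo)%E ->
  measurable_fun D f -> (forall x, D x -> `|f x| <= M) ->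
  mu.-integrable D (EFin \o f).
Proof.
move=> mD Doo mf fM; apply: measurable_bounded_integrable => //.
exists M; split; first exact: num_real.
by move=> y My x Dx; apply: (le_trans (fM x Dx)); exact: ltW.
Qed.

Lemma integrable_mul_bounded D f g (M : R) : measurable D ->
  measurable_fun D f -> (forall x, D x -> `|f x| <= M) ->
  mu.-integrable D (EFin \o g) ->
  mu.-integrable D (EFin \o (fun x => f x * g x)).
Proof.
move=> mD mf fM ig; rewrite (_ : _ \o _ = (EFin \o f) \* (EFin \o g))%E//.
apply: integrableMr => //.
exists M; split; first exact: num_real.
by move=> y My x Dx; apply: (le_trans (fM x Dx)); exact: ltW.
Qed.

Lemma integrable_real_sum D (I : Type) (s : seq I) (f : I -> T -> R) :
  measurable D -> (forall i, mu.-integrable D (EFin \o f i)) ->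
  mu.-integrable D (EFin \o (fun x => \sum_(i <- s) f i x)).
Proof.
move=> mD fi.
apply: (eq_integrable mD (fun x => \sum_(i <- s) (f i x)%:E)%E).
  by move=> x _ /=; rewrite sumEFin.
by apply: integrable_sum => // i _; exact: fi.
Qed.

Lemma Rintegral_sum D (I : Type) (s : seq I) (f : I -> T -> R) :
  measurable D -> (forall i, mu.-integrable D (EFin \o f i)) ->
  \int[mu]_(x in D) (\sum_(i <- s) f i x) =
  \sum_(i <- s) \int[mu]_(x in D) f i x.
Proof.
move=> mD fi; elim: s => [|i s ih].
  by under eq_Rintegral do rewrite big_nil; rewrite big_nil Rintegral_cst// mul0r.
under eq_Rintegral do rewrite big_cons.
rewrite big_cons RintegralD// ?ih//.
exact: integrable_real_sum.
Qed.

Lemma eq_Rintegral_ae D f g : measurable D -> measurable_fun D f ->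
  measurable_fun D g -> {ae mu, forall x, D x -> f x = g x} ->
  \int[mu]_(x in D) f x = \int[mu]_(x in D) g x.
Proof.
move=> mD mf mg fg; congr fine; apply: ae_eq_integral => //.
- exact/measurable_EFinP.
- exact/measurable_EFinP.
- by apply: filterS fg => x /= /[apply] ->.
Qed.

Lemma Rintegral_ge0_eq0 D f : measurable D -> mu.-integrable D (EFin \o f) ->
  (forall x, D x -> 0 <= f x) -> \int[mu]_(x in D) f x = 0 ->
  {ae mu, forall x, D x -> f x = 0}.
Proof.
move=> mD fi f0 if0.
have : (\int[mu]_(x in D) `|(EFin \o f) x| = 0)%E.
  under eq_integral => x xD.
    rewrite gee0_abs; last by rewrite lee_fin; apply: f0; exact: set_mem.
    over.
  rewrite -[LHS]fineK; first by congr EFin.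
  exact: integrable_fin_num.
move/ae_eq_integral_abs => /(_ mD (measurable_int _ fi)).
by apply: filterS => x /= /[apply] -[].
Qed.

Lemma Rintegral_eq0 D f : (forall x, D x -> f x = 0) -> \int[mu]_(x in D) f x = 0.
Proof.
move=> f0; rewrite /Rintegral (eq_integral (cst 0%E)) ?integral0//.
by move=> x /set_mem Dx; rewrite f0.
Qed.

Lemma Rintegral_dominated_cvg D (f_ : nat -> T -> R) f g : measurable D ->
  (forall n, measurable_fun D (f_ n)) ->
  (forall x, D x -> f_ ^~ x @ \oo --> f x) ->
  mu.-integrable D (EFin \o g) ->
  (forall n x, D x -> `|f_ n x| <= g x) ->
  mu.-integrable D (EFin \o f) /\
  \int[mu]_(x in D) f_ n x @[n --> \oo] --> \int[mu]_(x in D) f x.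
Proof.
move=> mD mf_ cf ig fg.
have mf : measurable_fun D f by exact: measurable_fun_cvg mf_ cf.
have cef : {ae mu, forall x, D x ->
    (fun n => (EFin \o f_ n) x) @ \oo --> (EFin \o f) x}.
  by apply: aeW => x Dx; apply/fine_cvgP; split;
    [exact: nearW | exact: cf].
have cfg : {ae mu, forall x n, D x -> (`|(EFin \o f_ n) x| <= (EFin \o g) x)%E}.
  by apply: aeW => x n Dx; rewrite lee_fin; exact: fg.
have [fi _ cvf] := dominated_convergence mD
  (fun n => (measurable_EFinP _ _).2 (mf_ n)) ((measurable_EFinP _ _).2 mf)
  cef ig cfg.
split => //; apply: fine_cvg; rewrite fineK//.
exact: integrable_fin_num.
Qed.

(** The sets over which the integral vanishes form a Dynkin system. *)
Lemma Rintegral_pi_system_eq0 D f (G : set (set T)) :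
  (@measurable _ T) = <<s G >> -> setI_closed G -> measurable D ->
  mu.-integrable D (EFin \o f) ->
  \int[mu]_(x in D) f x = 0 ->
  (forall A, G A -> \int[mu]_(x in D `&` A) f x = 0) ->
  {ae mu, forall x, D x -> f x = 0}.
Proof.
move=> GE GI mD fi fD0 fG0.
have mdiff A : measurable A -> mu.-integrable (D `&` A) (EFin \o f).
  by move=> mA; apply: integrableS fi => //; exact: measurableI.
have all0 A : measurable A -> (\int[mu]_(x in D `&` A) (f x)%:E = 0)%E.
  rewrite GE; move: A; apply: (@dynkin_induction _ T G) => //.
  - rewrite setIT -[LHS]fineK; first by congr EFin.
    exact: integrable_fin_num.
  - move=> A GA /=; rewrite -[LHS]fineK; first by congr EFin; exact: fG0.
    apply: integrable_fin_num; first by apply: measurableI => //; rewrite GE;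
      exact: sub_gen_smallest.
    by apply: mdiff; rewrite GE; exact: sub_gen_smallest.
  - move=> S mS S0.
    have : (\int[mu]_(x in D) (f x)%:E = 0)%E.
      rewrite -[LHS]fineK; first by congr EFin.
      exact: integrable_fin_num.
    rewrite -{1}(setIT D) -(setUv S) setIUr integral_setU_EFin//.
    + by rewrite S0 add0e.
    + exact: measurableI.
    + by apply: measurableI => //; exact: measurableC.
    + by rewrite -setIUr setUv setIT; exact: integrable_measurable.
    + rewrite disj_set2E; apply/eqP.
      by rewrite setIACA setICr setI0.
  - move=> F mF tF F0; rewrite setI_bigcupr integral_bigcup//=.
    + by rewrite eseries0.
    + exact: trivIset_setIl.
    + by move=> k; exact: measurableI.
    + rewrite -setI_bigcupr; apply: mdiff; exact: bigcup_measurable.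
have /integral_ae_eq h : forall E, E `<=` D -> measurable E ->
    (\int[mu]_(x in E) (EFin \o f) x = \int[mu]_(x in E) (cst 0 : T -> \bar R) x)%E.
  by move=> E ED mE; rewrite integral0 -(all0 E mE) setIidr.
by have := h mD fi (measurable_cst _); apply: filterS => x /= /[apply] -[].
Qed.

End real_integrals.

(** * Borel sets and Lebesgue measure in dimension n *)

Section measurable_continuous.
Context (R : realType) (n : nat).

Lemma measurable_rV_forall (A : 'I_n -> set R) :
  (forall i, measurable (A i)) ->
  measurable [set x : 'rV[R]_n | forall i, A i (x ord0 i)].
Proof.
move=> mA; rewrite (_ : [set x | _] =
    \bigcap_(i in [set: 'I_n]) [set x : 'rV[R]_n | A i (x ord0 i)]); last first.
  by apply/seteqP; split => x /= h i; [move=> _; exact: h|exact: h].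
apply: fin_bigcap_measurable => // i _.
rewrite -[X in measurable X]setTI.
exact: (@measurable_rV_coord R n i).
Qed.

(** An open set is the union of the countably many rational boxes that it contains. *)
Lemma measurable_rV_open (U : set 'rV[R]_n) : open U -> measurable U.
Proof.
move=> oU.
pose Q (q : 'rV[rat]_n) (k : nat) := [set x : 'rV[R]_n |
  forall i, `](ratr (q ord0 i) - k.+1%:R^-1), (ratr (q ord0 i) + k.+1%:R^-1)[%classic
    (x ord0 i)].
pose F (z : 'rV[rat]_n * nat) := if `[< Q z.1 z.2 `<=` U >] then Q z.1 z.2 else set0.
have -> : U = \bigcup_z F z.
  apply/seteqP; split => [x Ux|x [z _]]; last first.
    by rewrite /F; case: ifPn => // /asboolP; apply.
  have : nbhs x U by rewrite nbhsE/=; exists U.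
  move=> /nbhs_ballP[e /= e0 eU].
  (* half of the radius, as a point of the box may be twice as far from x as its centre *)
  have [k ke] : exists k : nat, k.+1%:R^-1 < e / 2.
    have e20 : 0 < e / 2 by rewrite divr_gt0.
    have [k _ /(_ _ (leqnn k)) h] := near_infty_natSinv_lt (PosNum e20).
    by exists k.
  have Hq i : exists q : rat, ratr q \in
      `](x ord0 i - k.+1%:R^-1), (x ord0 i + k.+1%:R^-1)[.
    by apply: rat_in_itvoo; rewrite ltrBlDr -addrA ltrDl addr_gt0.
  pose q := \row_i (sval (cid (Hq i))).
  exists (q, k) => //; rewrite /F /=.
  have Qx : Q q k x.
    move=> i /=; rewrite /q mxE; case: cid => r /=; rewrite !in_itv/=.
    move: (ratr r) (k.+1%:R^-1) (x ord0 i) => a b c /andP[? ?].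
    by apply/andP; split; lra.
  case: ifPn => // /asboolP; case => y Qy; apply: eU; split => // i j.
  have := Qx j; have := Qy j; rewrite /= !in_itv/= (ord1 i) /ball /=.
  move: (q ord0 j) ke => r; move: (ratr r) (k.+1%:R^-1) => a b ke /andP[? ?] /andP[? ?].
  by rewrite ltr_norml; apply/andP; split; lra.
apply: countable_bigcupT_measurable => // z; rewrite /F; case: ifPn => // _.
apply: (@measurable_rV_forall (fun i => `](ratr (z.1 ord0 i) - z.2.+1%:R^-1),
  (ratr (z.1 ord0 i) + z.2.+1%:R^-1)[%classic)) => i.
exact: measurable_itv.
Qed.

Lemma continuous_rV_measurable (f : 'rV[R]_n -> R) :
  continuous f -> measurable_fun setT f.
Proof.
move=> cf; apply: (measurability _ (RGenOpens.measurableE R)).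
move=> _ [_ [a [b ->]] <-]; rewrite setTI; apply: measurable_rV_open.
by apply: open_comp => //; exact: interval_open.
Qed.

End measurable_continuous.

Section rV_integral.
Context (R : realType).
Local Notation leb n := (@lebesgue_rV R n).
Local Notation mu := (@lebesgue_measure R).

Lemma integrable_rV_cons n (f : 'rV[R]_n.+1 -> \bar R) :
  (leb n.+1).-integrable setT f ->
  (mu \x leb n)%E.-integrable setT (f \o @rV_cons R n).
Proof.
move=> /integrableP[mf foo]; apply/integrableP; split.
  by apply: measurableT_comp => //; exact: measurable_rV_cons.
move: foo; rewrite /= /lebesgue_rV_step ge0_integral_pushforward//.
- exact: measurable_rV_cons.
- exact: measurableT_comp.
Qed.

Lemma integral_rV_cons n (f : 'rV[R]_n.+1 -> \bar R) :
  (leb n.+1).-integrable setT f ->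
  (\int[leb n.+1]_x f x = \int[mu \x leb n]_x f (rV_cons x))%E.
Proof.
move=> fi; rewrite /= /lebesgue_rV_step integral_pushforward//.
- exact: measurable_rV_cons.
- exact: measurable_int fi.
- exact: integrable_rV_cons.
Qed.

Definition cube n (M : R) : set 'rV[R]_n := [set x | forall i, `|x ord0 i| <= M].
Arguments cube : clear implicits.

Lemma measurable_cube n M : measurable (cube n M).
Proof.
apply: (@measurable_rV_forall R n (fun=> [set t | `|t| <= M])) => _.
rewrite (_ : [set t | _] = `[-M, M]%classic) //.
by apply/seteqP; split => t; rewrite /= in_itv/= ler_norml.
Qed.

Lemma lebesgue_cube n (M : R) : 0 <= M -> leb n (cube n M) = ((2 * M) ^+ n)%:E.
Proof.
move=> M0; elim: n => [|n ih].
  rewrite /= expr0 diracE mem_set// => i; by case: i.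
rewrite /= /lebesgue_rV_step /pushforward.
have -> : @rV_cons R n @^-1` cube n.+1 M = `[-M, M]%classic `*` cube n M.
  apply/seteqP; split => [[t y] h /=|[t y] [/= tM h] i].
    split; first by have := h ord0; rewrite rV_cons0 /= in_itv/= ler_norml.
    by move=> i; have := h (lift ord0 i); rewrite rV_consS.
  case: (unliftP ord0 i) => [j ->|->]; first by rewrite rV_consS; exact: h.
  by rewrite rV_cons0 ler_norml; move: tM; rewrite /= in_itv.
rewrite product_measure1E//; last exact: measurable_cube.
rewrite [in RHS]exprS EFinM -ih; congr (_ * _)%E.
transitivity (mu `[(- M)%R, M]%classic) => //.
rewrite lebesgue_measure_itv/= lte_fin; case: ifPn => [_|].
  by rewrite -EFinB; congr EFin; ring.
by rewrite -leNgt => ?; congr EFin; lra.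
Qed.

End rV_integral.
Arguments cube {R} n M.

(** * The divergence theorem for compactly supported functions *)

Section along_lines.
Context (R : realType).

(** Derivatives in a direction are derivatives in one variable along a line.  This lets
    the one-variable chain rule be used in any dimension. *)
Lemma is_derive_line (V : normedModType R) (f : V -> R) (x v : V) (t df : R) :
  is_derive (t *: v + x) v f df <-> is_derive t 1 (fun s : R => f (s *: v + x)) df.
Proof.
have E : (fun h : R => h^-1 *: ((f \o shift (t *: v + x)) (h *: v) - f (t *: v + x)))
  = (fun h : R => h^-1 *: (((fun s : R => f (s *: v + x)) \o shift t) (h *: (1 : R)) -
       f (t *: v + x))).
  apply/funext => h /=; congr (_ *: (f _ - _)).
  by rewrite scalerDl addrA /GRing.scale/= mulr1.
split=> -[df1 df2]; split.
- by move: df1; rewrite /derivable E.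
- by move: df2; rewrite /derive E.
- by rewrite /derivable E.
- by rewrite /derive E.
Qed.

Lemma is_derive_line0 (V : normedModType R) (f : V -> R) (x v : V) (df : R) :
  is_derive x v f df <-> is_derive (0 : R) 1 (fun s : R => f (s *: v + x)) df.
Proof.
by rewrite -(is_derive_line f x v 0 df) scale0r add0r.
Qed.

Lemma line_coord n (t : R) (i j : 'I_n) (x : 'rV[R]_n) :
  (t *: delta_mx ord0 i + x) ord0 j = t * (j == i)%:R + x ord0 j.
Proof. by rewrite [LHS]mxE; congr (_ + _); rewrite !mxE eqxx. Qed.

Lemma rV_cons_line0 n (t : R) (y : 'rV[R]_n) :
  rV_cons (t, y) = t *: delta_mx ord0 ord0 + rV_cons (0, y).
Proof.
apply/rowP => i; rewrite line_coord; case: (unliftP ord0 i) => [j ->|->].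
  by rewrite !rV_consS /= mulr0 add0r.
by rewrite !rV_cons0 /= mulr1 addr0.
Qed.

Lemma rV_cons_lineS n (t h : R) (y : 'rV[R]_n) j :
  rV_cons (t, h *: delta_mx ord0 j + y) =
  h *: delta_mx ord0 (lift ord0 j) + rV_cons (t, y).
Proof.
apply/rowP => i; rewrite line_coord; case: (unliftP ord0 i) => [k ->|->].
  by rewrite !rV_consS /= line_coord (inj_eq lift_inj).
by rewrite !rV_cons0 /= mulr0 add0r.
Qed.

Lemma continuous_rV_consr n (t : R) : continuous (fun y : 'rV[R]_n => rV_cons (t, y)).
Proof.
move=> y A /nbhs_ballP[e /= e0 eA]; apply/nbhs_ballP; exists e => //.
move=> y' yy'; apply: eA; split => // i j; rewrite (ord1 i).
case: (unliftP ord0 j) => [k ->|->]; last by rewrite !rV_cons0; exact: ballxx.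
by rewrite !rV_consS; apply yy'.2.
Qed.

Lemma continuous_rV_consl n (y : 'rV[R]_n) : continuous (fun t : R => rV_cons (t, y)).
Proof.
move=> t A /nbhs_ballP[e /= e0 eA]; apply/nbhs_ballP; exists e => //.
move=> t' tt'; apply: eA; split => // i j; rewrite (ord1 i).
case: (unliftP ord0 j) => [k ->|->]; last by rewrite !rV_cons0.
by rewrite !rV_consS; exact: ballxx.
Qed.

Lemma integral_derive_eq0 (F f : R -> R) (M : R) : 0 < M ->
  (forall t : R, is_derive t 1 F (f t)) -> continuous f ->
  (forall t, M <= `|t| -> F t = 0 /\ f t = 0) ->
  (\int[@lebesgue_measure R]_t (f t)%:E = 0)%E.
Proof.
move=> M0 dF cf z.
transitivity (\int[@lebesgue_measure R]_(t in `[(- M)%R, M]) (f t)%:E)%E.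
  rewrite [RHS]integral_mkcond; apply: eq_integral => t _.
  rewrite patchE; case: ifPn => // /negP tM.
  have [|_ ->//] := z t.
  rewrite leNgt; apply/negP; rewrite ltr_norml => /andP[? ?]; apply: tM.
  by rewrite inE/= in_itv/= !ltW.
have cF : continuous F.
  move=> t; apply: differentiable_continuous; apply/derivable1_diffP.
  by case: (dF t).
rewrite (@continuous_FTC2 _ f F); first last.
- by move=> t _; rewrite derive1E; case: (dF t).
- split; first by move=> t _; case: (dF t).
    exact/cvg_at_right_filter/cF.
  exact/cvg_at_left_filter/cF.
- exact: continuous_subspaceT.
- lra.
by rewrite !(z _ _).1 ?normrN ?ger0_norm ?subee// ltW.
Qed.

End along_lines.

Section divergence.
Context (R : realType).
Local Notation leb n := (@lebesgue_rV R n).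
Local Notation mu := (@lebesgue_measure R).

Lemma integrable_cube n (g : 'rV[R]_n -> R) (M C : R) : 0 <= M ->
  measurable_fun setT g -> (forall x, `|g x| <= C) ->
  (forall x : 'rV[R]_n, (exists j, M <= `|x ord0 j|) -> g x = 0) ->
  (leb n).-integrable setT (EFin \o g).
Proof.
move=> M0 mg gC g0; have mQ := @measurable_cube R n M.
rewrite (_ : EFin \o g = EFin \o (g \_ (cube n M))); last first.
  apply/funext => x /=; rewrite patchE; case: ifPn => // /negP.
  rewrite inE/= => /existsNP[j /negP]; rewrite -ltNge => /ltW Mj.
  by rewrite g0//; exists j.
rewrite -restrict_EFin; apply/integrable_restrict => //=.
rewrite setTI; apply: (@integrable_bounded _ _ _ _ _ _ C) => //.
- by rewrite [X in (X < _)%E](lebesgue_cube n M0) ltry.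
- exact: measurable_funTS.
Qed.

(** Fubini reduces this to one variable: the i-th derivative of a compactly supported
    function integrates to 0 along every line in direction i. *)
Lemma integral_partial_eq0 n (f g : 'rV[R]_n -> R) (M C : R) (i : 'I_n) :
  0 < M -> continuous g -> (forall x, `|g x| <= C) ->
  (forall x : 'rV[R]_n, is_derive x (delta_mx ord0 i) f (g x)) ->
  (forall x : 'rV[R]_n, (exists j, M <= `|x ord0 j|) -> f x = 0 /\ g x = 0) ->
  (\int[leb n]_x (g x)%:E = 0)%E.
Proof.
move=> M0; elim: n f g i => [f g [] //|n ih f g i cg gC dfg z].
have gi : (leb n.+1).-integrable setT (EFin \o g).
  apply: (@integrable_cube _ _ M C); rewrite ?ltW//.
    exact: continuous_rV_measurable.
  by move=> x /z[].
rewrite integral_rV_cons//.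
have gci := integrable_rV_cons gi.
case: (unliftP ord0 i) dfg => [j ->|->] dfg.
  rewrite -integral12_prod_meas1//=.
  rewrite [X in integral _ _ X](_ : _ = cst 0%E) ?integral0//.
  apply/funext => t; rewrite /fubini_F /=.
  apply: (ih (fun y => f (rV_cons (t, y))) (fun y => g (rV_cons (t, y))) j).
  - move=> y; apply: (@continuous_comp _ _ _ (fun y => rV_cons (t, y)) g).
      exact: continuous_rV_consr.
    exact: cg.
  - by move=> y; exact: gC.
  - move=> y; apply/is_derive_line0.
    have /is_derive_line0 := dfg (rV_cons (t, y)).
    congr (is_derive _ _ _ _); apply/funext => s.
    by rewrite rV_cons_lineS.
  - by move=> y [k yk]; apply: z; exists (lift ord0 k); rewrite rV_consS.
rewrite -integral21_prod_meas1//=.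
rewrite [X in integral _ _ X](_ : _ = cst 0%E) ?integral0//.
apply/funext => y; rewrite /fubini_G /=.
apply: (@integral_derive_eq0 _ (fun t => f (rV_cons (t, y)))
  (fun t => g (rV_cons (t, y))) M) => //.
- move=> t; have := (is_derive_line f (rV_cons (0, y)) (delta_mx ord0 ord0) t
    (g (rV_cons (t, y)))).1.
  rewrite -rV_cons_line0 => /(_ (dfg _)).
  congr (is_derive _ _ _ _); apply/funext => s; by rewrite -rV_cons_line0.
- move=> t; apply: (@continuous_comp _ _ _ (fun t : R => rV_cons (t, y)) g).
    exact: continuous_rV_consl.
  exact: cg.
- by move=> t tM; apply: z; exists ord0; rewrite rV_cons0.
Qed.

End divergence.

(** * Smooth functions *)

Section pointwise_derivatives.
Context (R : realType) (V : normedModType R).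
Implicit Types (f g : V -> R) (x v : V).

Lemma is_derive_add f g x v df dg : is_derive x v f df -> is_derive x v g dg ->
  is_derive x v (fun y => f y + g y) (df + dg).
Proof. by move=> hf hg; exact: is_deriveD. Qed.

Lemma is_derive_mul f g x v df dg : is_derive x v f df -> is_derive x v g dg ->
  is_derive x v (fun y => f y * g y) (f x * dg + g x * df).
Proof. by move=> hf hg; exact: is_deriveM. Qed.

Lemma is_derive_comp (h : R -> R) f x v a b : is_derive (f x) 1 h a ->
  is_derive x v f b -> is_derive x v (fun y => h (f y)) (a * b).
Proof.
move=> hh /is_derive_line0 hf; apply/is_derive_line0.
apply: (@is_derive1_comp _ h (fun s : R => f (s *: v + x)) 0) => //.
by rewrite scale0r add0r.
Qed.

Lemma is_derive_val_eq f x v df df' : is_derive x v f df -> df = df' ->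
  is_derive x v f df'.
Proof. by move=> h <-. Qed.

Lemma is_derive_near f g x v df : (\forall y \near x, f y = g y) ->
  is_derive x v f df -> is_derive x v g df.
Proof. exact: near_eq_is_derive. Qed.

End pointwise_derivatives.

Lemma is_derive_continuous (R : realType) (f : R -> R) (x df : R) :
  is_derive x 1 f df -> {for x, continuous f}.
Proof.
by move=> [df1 _]; apply: differentiable_continuous; apply/derivable1_diffP.
Qed.

Section flat.
Context (R : realType).
Implicit Types (P : {poly R}) (t : R).

(** For the polynomial 1 this is the standard smooth function exp(-1/t) that is flat
    at 0; polynomial factors make the family closed under differentiation. *)
Definition flat P t : R := if 0 < t then P.[t^-1] * expR (- t^-1) else 0.

(** The Taylor series of exp dominates each of its monomials. *)
Lemma poly_le_expR P : exists C : R, 0 <= C /\ forall y : R, 0 <= y -> `|P.[y]| <= C * expR y.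
Proof.
exists (\sum_(i < size P) `|P`_i| * i`!%:R); split.
  by apply: sumr_ge0 => i _; rewrite mulr_ge0.
move=> y y0; rewrite horner_coef (le_trans (ler_norm_sum _ _ _))//.
rewrite mulr_suml ler_sum// => i _; rewrite normrM -mulrA ler_wpM2l//.
rewrite ger0_norm ?exprn_ge0//; case: (nat_of_ord i) => [|n].
  by rewrite expr0 fact0 mul1r -expR0 ler_expR.
have F0 : 0 < (n.+1)`!%:R :> R by rewrite ltr0n fact_gt0.
rewrite -ler_pdivrMl// mulrC (le_trans _ (expR_ge1Dxn n y0))//.
by rewrite lerDr.
Qed.

(** Quadratic decay at 0 gives the derivative 0 there. *)
Lemma flat_le_sqr P : exists C : R, forall t, `|flat P t| <= C * t ^+ 2.
Proof.
(* two more powers of 1/t than in P give the factor t^2 *)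
have [C [C0 hC]] := poly_le_expR (P * 'X ^+ 2).
exists C => t; rewrite /flat; case: ifPn => [t0|_]; last first.
  by rewrite normr0 mulr_ge0// sqr_ge0.
have := hC t^-1; rewrite invr_ge0 (ltW t0) => /(_ isT).
have t20 : 0 < t ^+ 2 by rewrite exprn_gt0.
rewrite hornerM hornerXn normrM (@ger0_norm _ (t^-1 ^+ 2)) => [h|]; last first.
  by rewrite exprn_ge0// invr_ge0 ltW.
rewrite normrM (ger0_norm (expR_ge0 _)) expRN ler_pdivrMr ?expR_gt0//.
by rewrite mulrAC -ler_pdivrMr// -exprVn.
Qed.

Lemma is_derive_flat P t : is_derive t 1 (flat P) (flat ('X ^+ 2 * (P - P^`())) t).
Proof.
have [t0|t0|t0] := ltgtP t 0.
- rewrite {2}/flat ltNge (ltW t0)/=; apply: (@is_derive_near _ _ (cst 0)).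
    near=> y; rewrite /flat ifN// -leNgt ltW//.
    by near: y; exact: lt_nbhsl.
- rewrite {2}/flat t0.
  apply: (@is_derive_near _ _ (fun y : R => P.[y^-1] * expR (- y^-1))).
    near=> y; rewrite /flat ifT//.
    by near: y; exact: lt_nbhsr.
  have dV : is_derive t 1 (fun y : R => y^-1) (- t ^- 2).
    apply: (is_derive_val_eq (is_deriveV (f := id) (lt0r_neq0 t0) (is_derive_id t 1))).
    by rewrite /GRing.scale/= mulr1.
  have dNV : is_derive t 1 (fun y : R => - y^-1) (t ^- 2).
    by apply: (is_derive_val_eq (is_deriveN dV)); rewrite opprK.
  apply: (is_derive_val_eq (is_derive_mul
    (is_derive_comp (h := horner P) (is_derive_poly P _) dV)
    (is_derive_comp (h := expR) (is_derive_expR _) dNV))).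
  rewrite hornerM hornerXn hornerD hornerN exprVn.
  move: (t ^- 2) (P.[_]) (P^`().[_]) (expR _) => a b c d; ring.
- rewrite t0 [flat _ 0]/flat ltxx.
  have [C hC] := flat_le_sqr P.
  have c0 : (fun h : R => h^-1 *: ((flat P \o shift 0) (h *: (1 : R)) - flat P 0))
      @ 0^' --> (0 : R).
    apply/cvgr0Pnorm_lt => e e0.
    have C1 : 0 < `|C| + 1 by rewrite ltr_wpDl.
    have : \forall h \near (0 : R), `|h| < e / (`|C| + 1).
      by apply: nbhs0_lt; rewrite divr_gt0.
    move=> H; near=> h.
    have hn0 : h != 0 by near: h; exact: nbhs_dnbhs_neq.
    have hl : `|h| < e / (`|C| + 1) by near: h; exact: nbhs_dnbhs.
    rewrite /= addr0 [flat _ 0]/flat ltxx subr0 /GRing.scale/= mulr1 normrM normfV.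
    rewrite ltr_pdivrMl ?normr_gt0// (le_lt_trans (hC h))//.
    rewrite -[h ^+ 2]real_normK ?num_real// expr2 mulrA mulrC ltr_pM2l ?normr_gt0//.
    rewrite (@le_lt_trans _ _ ((`|C| + 1) * `|h|))// ?ler_wpM2r//; last first.
      by rewrite mulrC -ltr_pdivlMr.
    by rewrite (le_trans (ler_norm _))// lerDl.
  split; last exact: cvg_lim c0.
  by apply/cvg_ex; exists 0.
Unshelve. all: by end_near. Qed.

End flat.

(** A syntactic class that is closed under differentiation, so that each member has
    derivatives of all orders.  Primitives are included because the approximating radial
    fields are integrals of bumps. *)
Inductive smooth_fun (R : realType) : (R -> R) -> Prop :=
| smooth_flat P a b : smooth_fun (fun t => flat P (a * t + b))
| smooth_cst c : smooth_fun (fun=> c)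
| smooth_add f g : smooth_fun f -> smooth_fun g -> smooth_fun (fun t => f t + g t)
| smooth_mul f g : smooth_fun f -> smooth_fun g -> smooth_fun (fun t => f t * g t)
| smooth_primitive f g : smooth_fun f -> (forall t : R, is_derive t 1 g (f t)) ->
    smooth_fun g.

Section smooth_functions.
Context (R : realType).

Lemma is_derive_affine (a b t : R) : is_derive t 1 (fun s : R => a * s + b) a.
Proof.
apply: (is_derive_val_eq (is_derive_add
  (is_derive_mul (is_derive_cst a t 1) (is_derive_id t (1 : R)))
  (is_derive_cst b t 1))).
by rewrite /cst /= mulr1 mulr0 !addr0.
Qed.

Lemma smooth_fun_derive (f : R -> R) : smooth_fun f ->
  exists2 f', smooth_fun f' & forall t : R, is_derive t 1 f (f' t).
Proof.
elim=> [P a b|c|{}f g sf [f' sf' ff'] sg [g' sg' gg']|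
    {}f g sf [f' sf' ff'] sg [g' sg' gg']|{}f g sf _ fg].
- exists (fun t => flat ('X ^+ 2 * (P - P^`())) (a * t + b) * a).
    by apply: smooth_mul; [exact: smooth_flat|exact: smooth_cst].
  move=> t; apply: is_derive_comp; [exact: is_derive_flat|exact: is_derive_affine].
- exists (fun=> 0); [exact: smooth_cst|move=> t; exact: is_derive_cst].
- exists (fun t => f' t + g' t); first exact: smooth_add.
  by move=> t; exact: is_derive_add.
- exists (fun t => f t * g' t + g t * f' t).
    by apply: smooth_add; exact: smooth_mul.
  by move=> t; exact: is_derive_mul.
- by exists f.
Qed.

Lemma smooth_fun_continuous (f : R -> R) : smooth_fun f -> continuous f.
Proof.
by move=> /smooth_fun_derive[f' _ ff'] t; exact: is_derive_continuous (ff' t).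
Qed.

End smooth_functions.

Section euclidean.
Context (R : realType) (N : nat).
Implicit Types (x y : 'rV[R]_N).

Lemma dotv_ge0 x : 0 <= dotv x x.
Proof. by apply: sumr_ge0 => i _; rewrite -expr2 sqr_ge0. Qed.

Lemma dotv_eq0 x : (dotv x x == 0) = (x == 0).
Proof.
apply/eqP/eqP => [|->]; last by rewrite /dotv big1// => i _; rewrite mxE mul0r.
move/eqP; rewrite psumr_eq0 => [/allP h|i _]; last by rewrite -expr2 sqr_ge0.
apply/rowP => i; rewrite mxE; have := h i (mem_index_enum _).
by rewrite mulf_eq0 orbb => /eqP.
Qed.

Lemma dotv0r x : dotv x (0 : 'rV[R]_N) = 0.
Proof. by rewrite /dotv big1// => i _; rewrite mxE mulr0. Qed.

Lemma dotv_gt0 x : (0 < dotv x x) = (x != 0).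
Proof. by rewrite lt_neqAle dotv_ge0 andbT eq_sym dotv_eq0. Qed.

Lemma coord_continuous_rV (i : 'I_N) : continuous (fun x : 'rV[R]_N => x ord0 i).
Proof. exact: coord_continuous. Qed.

Lemma dotv_continuous : continuous (fun x : 'rV[R]_N => dotv x x).
Proof.
rewrite /dotv; elim: (index_enum 'I_N) => [|i s ih] x.
  by under eq_fun do rewrite big_nil; exact: cst_continuous.
under eq_fun do rewrite big_cons; apply: (@cvgD _ _ _ (nbhs x)); last exact: ih.
by apply: (@cvgM _ _ (nbhs x)); exact: coord_continuous_rV.
Qed.

Lemma is_derive_coord x (i j : 'I_N) :
  is_derive x (delta_mx ord0 i) (fun y : 'rV[R]_N => y ord0 j) (j == i)%:R.
Proof.
apply/is_derive_line0.
have -> : (fun s : R => (s *: delta_mx ord0 i + x) ord0 j) =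
   (fun s : R => (j == i)%:R * s + x ord0 j).
  by apply/funext => s; rewrite line_coord mulrC.
exact: is_derive_affine.
Qed.

Lemma is_derive_dotv x (i : 'I_N) :
  is_derive x (delta_mx ord0 i) (fun y : 'rV[R]_N => dotv y y) (2 * x ord0 i).
Proof.
have h j : is_derive x (delta_mx ord0 i) (fun y : 'rV[R]_N => y ord0 j * y ord0 j)
    (x ord0 j * (j == i)%:R + x ord0 j * (j == i)%:R).
  by apply: is_derive_mul; exact: is_derive_coord.
have -> : (fun y : 'rV[R]_N => dotv y y) =
    \sum_(j < N) (fun y : 'rV[R]_N => y ord0 j * y ord0 j).
  by apply/funext => y; rewrite fct_sumE.
apply: (is_derive_val_eq (is_derive_sum h)).
rewrite (bigD1 i)//= eqxx mulr1 big1 ?addr0; first by ring.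
by move=> j /negbTE ->; rewrite mulr0 addr0.
Qed.

End euclidean.

(** A syntactic class of functions of several variables that are smooth except perhaps at
    the origin, where the powers of the norm may be singular. *)
Inductive punctured_smooth (R : realType) (N : nat) : ('rV[R]_N -> R) -> Prop :=
| punctured_cst c : punctured_smooth (fun=> c)
| punctured_coord i : punctured_smooth (fun x => x ord0 i)
| punctured_add f g : punctured_smooth f -> punctured_smooth g ->
    punctured_smooth (fun x => f x + g x)
| punctured_mul f g : punctured_smooth f -> punctured_smooth g ->
    punctured_smooth (fun x => f x * g x)
| punctured_powR a : punctured_smooth (fun x => dotv x x `^ a)
| punctured_comp h f : smooth_fun h -> punctured_smooth f ->
    punctured_smooth (fun x => h (f x)).

Section punctured.
Context (R : realType) (N : nat).
Implicit Types (f g F : 'rV[R]_N -> R) (x : 'rV[R]_N).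

Lemma punctured_dotv : punctured_smooth (fun x : 'rV[R]_N => dotv x x).
Proof.
suff h (s : seq 'I_N) : punctured_smooth (fun x => \sum_(i <- s) x ord0 i * x ord0 i).
  exact: h.
elim: s => [|i s ih].
  under eq_fun do rewrite big_nil; exact: punctured_cst.
under eq_fun do rewrite big_cons; apply: punctured_add => //.
by apply: punctured_mul; exact: punctured_coord.
Qed.

Lemma punctured_prod (f : 'I_N -> 'rV[R]_N -> R) :
  (forall i, punctured_smooth (f i)) -> punctured_smooth (fun x => \prod_i f i x).
Proof.
move=> h; elim: (index_enum 'I_N) => [|i s ih].
  under eq_fun do rewrite big_nil; exact: punctured_cst.
by under eq_fun do rewrite big_cons; exact: punctured_mul.
Qed.

Lemma punctured_derive f : punctured_smooth f ->
  exists2 f' : 'I_N -> 'rV[R]_N -> R, forall i, punctured_smooth (f' i) &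
    forall x i, x != 0 -> is_derive x (delta_mx ord0 i) f (f' i x).
Proof.
elim=> [c|j|{}f g sf [f' sf' ff'] sg [g' sg' gg']|
    {}f g sf [f' sf' ff'] sg [g' sg' gg']|a|h {}f sh sf [f' sf' ff']].
- by exists (fun _ _ => 0) => [i|x i _]; [exact: punctured_cst|exact: is_derive_cst].
- exists (fun i _ => (j == i)%:R) => [i|x i _]; first exact: punctured_cst.
  exact: is_derive_coord.
- exists (fun i x => f' i x + g' i x) => [i|x i x0]; first exact: punctured_add.
  by apply: is_derive_add; [exact: ff'|exact: gg'].
- exists (fun i x => f x * g' i x + g x * f' i x) => [i|x i x0].
    by apply: punctured_add; exact: punctured_mul.
  by apply: is_derive_mul; [exact: ff'|exact: gg'].
- exists (fun i x => (a * dotv x x `^ (a - 1)) * (2 * x ord0 i)) => [i|x i x0].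
    apply: punctured_mul; apply: punctured_mul; try exact: punctured_cst.
    + exact: punctured_powR.
    + exact: punctured_coord.
  apply: (is_derive_comp (h := fun t => t `^ a)); last exact: is_derive_dotv.
  by apply: is_derive1_powR; rewrite dotv_gt0.
- have [h' sh' hh'] := smooth_fun_derive sh.
  exists (fun i x => h' (f x) * f' i x) => [i|x i x0].
    by apply: punctured_mul => //; exact: punctured_comp.
  by apply: is_derive_comp => //; exact: ff'.
Qed.

Lemma punctured_continuous f x : punctured_smooth f -> x != 0 -> {for x, continuous f}.
Proof.
move=> sf x0; elim: sf => [c|j|{}f g sf ihf sg ihg|{}f g sf ihf sg ihg|a|h {}f sh sf ih].
- exact: cst_continuous.
- exact: coord_continuous_rV.
- exact: (@cvgD _ _ _ (nbhs x)).
- exact: (@cvgM _ _ (nbhs x)).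
- apply: (@continuous_comp _ _ _ (fun x : 'rV[R]_N => dotv x x) (fun t : R => t `^ a)).
    exact: dotv_continuous.
  by apply: is_derive_continuous; apply: is_derive1_powR; rewrite dotv_gt0.
- by apply: continuous_comp => //; exact: smooth_fun_continuous.
Qed.

Lemma near_neq0 x : x != 0 -> \forall y \near x, y != 0.
Proof.
move=> x0; have oU : open [set y : 'rV[R]_N | dotv y y > 0].
  by apply: (@open_comp _ _ (fun x : 'rV[R]_N => dotv x x) [set t | t > 0]);
    [move=> y _; exact: dotv_continuous|exact: open_gt].
have : nbhs x [set y : 'rV[R]_N | dotv y y > 0].
  by apply: open_nbhs_nbhs; split => //=; rewrite dotv_gt0.
by apply: filterS => y /=; rewrite dotv_gt0.
Qed.

(** Where F vanishes identically, near the origin, so do all its derivatives; elsewhere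
    F is one of the syntactic functions. *)
Lemma punctured_partials f F (s : seq 'I_N) : punctured_smooth f ->
  (forall x, x != 0 -> F x = f x) -> (\forall x \near (0 : 'rV[R]_N), F x = 0) ->
  exists g, [/\ punctured_smooth g, forall x, x != 0 -> partials s F x = g x &
    \forall x \near (0 : 'rV[R]_N), partials s F x = 0].
Proof.
move=> sf Ff F0; elim: s => [|i s [g [sg Fg Fg0]]]; first by exists f.
have [g' sg' gg'] := punctured_derive sg.
exists (g' i); split => //=.
  move=> x x0; have : is_derive x (delta_mx ord0 i) (partials s F) (g' i x).
    apply: is_derive_near (gg' x i x0).
    by apply: filterS (near_neq0 x0) => y y0; rewrite Fg.
  by case.
move: Fg0 => /nbhs_interior; apply: filterS => x Hx.
have : is_derive x (delta_mx ord0 i) (partials s F) 0.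
  apply: is_derive_near (is_derive_cst (0 : R) x (delta_mx ord0 i)).
  by apply: filterS Hx.
by case.
Qed.

Lemma punctured_smoothT f F : punctured_smooth f ->
  (forall x, x != 0 -> F x = f x) -> (\forall x \near (0 : 'rV[R]_N), F x = 0) ->
  smooth F.
Proof.
move=> sf Ff F0 s; have [g [sg Fg Fg0]] := punctured_partials s sf Ff F0.
have [g' sg' gg'] := punctured_derive sg.
split=> [x|i x]; have [->|x0] := eqVneq x 0.
- apply: (@near_cst_continuous _ _ 0).
  exact: Fg0.
- have : (\forall y \near x, partials s F y = g y).
    by apply: filterS (near_neq0 x0) => y y0; rewrite Fg.
  move=> h; rewrite /continuous_at Fg//; apply: cvg_trans (punctured_continuous sg x0).
  have h2 : \forall y \near x, g y = partials s F y by apply: filterS h => y ->.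
  exact: near_eq_cvg h2.
- have : is_derive (0 : 'rV[R]_N) (delta_mx ord0 i) (partials s F) 0.
    apply: is_derive_near (is_derive_cst (0 : R) 0 (delta_mx ord0 i)).
    by apply: filterS Fg0.
  by case.
- have : is_derive x (delta_mx ord0 i) (partials s F) (g' i x).
    apply: is_derive_near (gg' x i x0).
    by apply: filterS (near_neq0 x0) => y y0; rewrite Fg.
  by case.
Qed.

End punctured.

(** * The unit ball and its test functions *)

Section unit_ball.
Context (R : realType) (N : nat).
Local Notation V := 'rV[R]_N.
Local Notation leb := (@lebesgue_rV R N).
Local Notation B := (@B R N).
Implicit Types (x : V).

Lemma enorm_ge0 x : 0 <= enorm x. Proof. exact: sqrtr_ge0. Qed.

Lemma enorm_sqr x : enorm x ^+ 2 = dotv x x.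
Proof. by rewrite sqr_sqrtr ?dotv_ge0. Qed.

Lemma enorm_eq0 x : (enorm x == 0) = (x == 0).
Proof. by rewrite sqrtr_eq0 -dotv_eq0 eq_le dotv_ge0 andbT. Qed.

Lemma enorm_gt0 x : (0 < enorm x) = (x != 0).
Proof. by rewrite sqrtr_gt0 dotv_gt0. Qed.

Lemma unit_ballE : B = [set x | dotv x x < 1].
Proof.
have h x : (enorm x < 1) = (dotv x x < 1).
  by rewrite -[X in _ < X]sqrtr1 ltr_sqrt.
by apply/seteqP; split => x; rewrite /B /= h.
Qed.

Lemma coord_le_enorm x i : `|x ord0 i| <= enorm x.
Proof.
rewrite -sqrtr_sqr ler_wsqrtr// /dotv (bigD1 i)//= -expr2 lerDl.
by apply: sumr_ge0 => j _; rewrite -expr2 sqr_ge0.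
Qed.

Lemma open_B : open B.
Proof.
rewrite unit_ballE; apply: (@open_comp _ _ (fun x : V => dotv x x) [set t | t < 1]).
  by move=> y _; exact: dotv_continuous.
exact: open_lt.
Qed.

Lemma measurable_B : measurable B.
Proof. by apply: measurable_rV_open; exact: open_B. Qed.

Lemma B_sub_cube : B `<=` cube N 1.
Proof. by move=> x Bx i; rewrite (le_trans (coord_le_enorm x i))// ltW. Qed.

Lemma lebesgue_B_lty : (leb B < +oo)%E.
Proof.
apply: (@le_lt_trans _ _ (leb (cube N 1))).
  by apply: le_measure; rewrite ?inE; [exact: measurable_B|exact: measurable_cube|
    exact: B_sub_cube].
by rewrite [X in (X < _)%E](lebesgue_cube N ler01) ltry.
Qed.

Lemma lebesgue_B_gt0 : (0 < leb B)%E.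
Proof.
have e0 : (0 : R) < N.+1%:R^-1 by [].
apply: (@lt_le_trans _ _ (leb (cube N N.+1%:R^-1))).
  by rewrite [X in (_ < X)%E](lebesgue_cube N (ltW e0)) lte_fin exprn_gt0// mulr_gt0.
apply: le_measure; rewrite ?inE; [exact: measurable_cube|exact: measurable_B|].
rewrite unit_ballE => x xQ /=; apply: (@le_lt_trans _ _ (\sum_(i < N) N.+1%:R^-1)).
  apply: ler_sum => i _; rewrite -expr2 -real_normK ?num_real//.
  have h := xQ i; rewrite expr2 -[leRHS]mulr1; apply: ler_pM => //.
  by apply: (le_trans h); rewrite invf_le1// ler1n.
by rewrite sumr_const card_ord -[X in X < _]mulr_natl ltr_pdivrMr// mul1r ltr_nat.
Qed.

Lemma lebesgue_origin : (0 < N)%N -> leb [set 0] = 0%E.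
Proof.
move=> N0; apply/eqP; rewrite eq_le measure_ge0 andbT; apply/lee_addgt0Pr => e e0.
rewrite add0e; pose M : R := Num.min (e / 2) (1 / 2).
have M0 : 0 < M by rewrite lt_min !divr_gt0.
apply: (@le_trans _ _ (leb (cube N M))).
  apply: le_measure; rewrite ?inE.
  - rewrite (_ : [set 0] = [set x : V | forall i, [set 0] (x ord0 i)]).
      by apply: (@measurable_rV_forall _ _ (fun=> [set 0])) => i; exact: measurable_set1.
    apply/seteqP; split => [x -> i|x /= h]; first by rewrite /= mxE.
    by apply/rowP => i; rewrite h mxE.
  - exact: measurable_cube.
  - by move=> x -> i; rewrite mxE normr0 ltW.
rewrite [X in (X <= _)%E](lebesgue_cube N (ltW M0)) lee_fin.
have : 2 * M <= 1 by rewrite -ler_pdivlMl// mulrC ge_min lexx orbT.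
case: N N0 => // n _ M1; rewrite exprS (@le_trans _ _ (2 * M))//.
  rewrite ler_piMr ?mulr_ge0 ?(ltW M0)//.
  by rewrite exprn_ile1// mulr_ge0// ltW.
by rewrite -ler_pdivlMl// mulrC ge_min lexx.
Qed.

Lemma measurable_rV_closed (K : set V) : closed K -> measurable K.
Proof.
move=> cK; rewrite -[K]setCK; apply: measurableC; apply: measurable_rV_open.
by rewrite openC.
Qed.

Lemma measurable_rV_compact (K : set V) : compact K -> measurable K.
Proof.
move=> cK; apply: measurable_rV_closed; exact: compact_closed.
Qed.

Lemma compact_ball (c : R) : compact [set x : V | dotv x x <= c].
Proof.
apply: bounded_closed_compact.
  exists (Num.sqrt c); split; first exact: num_real.
  move=> M cM x /= xc; rewrite (_ : `|x| = mx_norm x)// mx_normrE; apply/bigmax_leP; split.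
    by rewrite ltW// (le_lt_trans _ cM)// sqrtr_ge0.
  move=> [i j] _ /=; rewrite (ord1 i) (le_trans (coord_le_enorm x j))// ltW//.
  by rewrite (le_lt_trans _ cM)// ler_wsqrtr.
rewrite (_ : [set x | _] = (fun x : V => dotv x x) @^-1` [set t | t <= c])//.
apply: closed_comp; first by move=> x _; exact: dotv_continuous.
exact: closed_le.
Qed.

Lemma continuous_bounded_compact (f : V -> R) (K : set V) : compact K ->
  continuous f -> exists C, forall x, K x -> `|f x| <= C.
Proof.
move=> cK cf; have : compact (f @` K).
  by apply: continuous_compact => //; exact: continuous_subspaceT.
move=> /compact_bounded[M [_ MfK]]; exists (`|M| + 1) => x Kx.
by apply: (MfK _ _ (f x)); [rewrite ltr_pwDr// ler_norm|exists x].
Qed.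

Lemma locally_integrable_continuous (f : V -> R) : continuous f -> locally_integrable_B f.
Proof.
move=> cf K cK KB; have [C fC] := continuous_bounded_compact cK cf.
have mK := measurable_rV_compact cK.
apply: (integrable_bounded mK _ _ fC).
  apply: le_lt_trans lebesgue_B_lty.
  by apply: le_measure; rewrite ?inE//; exact: measurable_B.
by apply: measurable_funTS; exact: continuous_rV_measurable.
Qed.

Lemma integrable_locally (f : V -> R) : leb.-integrable B (EFin \o f) ->
  locally_integrable_B f.
Proof.
move=> fi K cK KB; apply: integrableS fi => //; first exact: measurable_B.
exact: measurable_rV_compact.
Qed.

End unit_ball.

Section test_functions.
Context (R : realType) (N : nat).
Local Notation V := 'rV[R]_N.
Local Notation leb := (@lebesgue_rV R N).
Local Notation B := (@B R N).
Implicit Types (x : V) (phi F f : V -> R).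

Lemma punctured_test_function f F (c : R) : punctured_smooth f ->
  (forall x, x != 0 -> F x = f x) -> (\forall x \near (0 : V), F x = 0) ->
  c < 1 -> (forall x, c <= dotv x x -> F x = 0) -> test_function F.
Proof.
move=> sf Ff F0 c1 Fc; split; first exact: punctured_smoothT sf Ff F0.
exists [set x | dotv x x <= c]; split.
- exact: compact_ball.
- by move=> x /= xc; rewrite unit_ballE /= (le_lt_trans xc).
- by move=> x /= /negP; rewrite -ltNge => /ltW; exact: Fc.
Qed.

Lemma test_continuous phi : test_function phi -> continuous phi.
Proof. by move=> [/(_ [::])[]]. Qed.

Lemma test_partial_continuous phi : test_function phi ->
  forall i, continuous (partial i phi).
Proof. by move=> [h _] i; have [] := h [:: i]. Qed.

Lemma test_is_derive phi : test_function phi -> forall x i,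
  is_derive x (delta_mx ord0 i) phi (partial i phi x).
Proof. by move=> [/(_ [::])[_ h] _] x i; exact: derivableP. Qed.

(** Outside of the support the derivatives vanish as well because its complement is open. *)
Lemma test_support phi : test_function phi ->
  exists K : set V, [/\ compact K, K `<=` B &
    forall x, ~ K x -> phi x = 0 /\ forall i, partial i phi x = 0].
Proof.
move=> tphi; have [_ [K [cK KB K0]]] := tphi; exists K; split => // x Kx.
split; first exact: K0.
move=> i; have oK : open (~` K).
  by rewrite openC; exact: compact_closed.
have nK : \forall y \near x, phi y = 0.
  have : nbhs x (~` K) by apply: open_nbhs_nbhs.
  by apply: filterS => y; exact: K0.
have : is_derive x (delta_mx ord0 i) phi 0.
  apply: is_derive_near (is_derive_cst (0 : R) x (delta_mx ord0 i)).
  by apply: filterS nK => y ->.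
by case.
Qed.

Lemma test_bounded phi : test_function phi -> exists C,
  forall x, `|phi x| <= C /\ forall i, `|partial i phi x| <= C.
Proof.
move=> tphi; have [K [cK KB K0]] := test_support tphi.
have [C hC] := continuous_bounded_compact cK (test_continuous tphi).
pose D i := sval (cid (continuous_bounded_compact cK (@test_partial_continuous phi tphi i))).
have hD i x : K x -> `|partial i phi x| <= D i.
  by rewrite /D; case: cid => E /= h; exact: h.
(* one bound for the function and for all its partial derivatives *)
exists (`|C| + \sum_i `|D i|) => x; have [Kx|/K0[h0 h1]] := pselect (K x).
  split; first by rewrite (le_trans (hC x Kx))// (le_trans (ler_norm _))// lerDl sumr_ge0.
  move=> i; rewrite (le_trans (hD i x Kx))// (le_trans (ler_norm _))//.
  by rewrite (bigD1 i)//= addrCA lerDl addr_ge0// sumr_ge0.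
have s0 : 0 <= `|C| + \sum_i `|D i| by rewrite addr_ge0// sumr_ge0.
by rewrite h0 normr0; split => // i; rewrite h1 normr0.
Qed.

(** The product of the function and a test function has compact support in the ball, so
    the integral of its derivative vanishes. *)
Lemma weak_gradient_C1 (U : V -> R) (G : V -> V) : continuous U ->
  (forall i, continuous (fun x => G x ord0 i)) ->
  (forall x i, is_derive x (delta_mx ord0 i) U (G x ord0 i)) ->
  weak_gradient U G.
Proof.
move=> cU cG dU; split; first exact: locally_integrable_continuous.
  by move=> i; exact: locally_integrable_continuous.
move=> phi tphi i; have [K [cK KB K0]] := test_support tphi.
have cphi := test_continuous tphi; have cdphi := @test_partial_continuous phi tphi i.
pose g1 x := U x * partial i phi x; pose g2 x := G x ord0 i * phi x.
have cg1 : continuous g1 by move=> x; apply: (@cvgM _ _ (nbhs x)); [exact: cU|exact: cdphi].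
have cg2 : continuous g2 by move=> x; apply: (@cvgM _ _ (nbhs x)); [exact: cG|exact: cphi].
have mB := @measurable_B R N.
have bd (g : V -> R) : continuous g -> (forall x, ~ K x -> g x = 0) ->
    exists C, forall x, `|g x| <= C.
  move=> cg g0; have [C hC] := continuous_bounded_compact cK cg.
  exists `|C| => x; have [Kx|/g0 ->] := pselect (K x); last by rewrite normr0.
  by rewrite (le_trans (hC x Kx))// ler_norm.
have g10 x : ~ K x -> g1 x = 0 by move=> /K0[_ h]; rewrite /g1 h mulr0.
have g20 x : ~ K x -> g2 x = 0 by move=> /K0[h _]; rewrite /g2 h mulr0.
have gi (g : V -> R) : continuous g -> (forall x, ~ K x -> g x = 0) ->
    leb.-integrable B (EFin \o g).
  move=> cg g0; have [C hC] := bd g cg g0.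
  apply: (integrable_bounded mB (@lebesgue_B_lty R N) _ (M := C)) => //.
  by apply: measurable_funTS; exact: continuous_rV_measurable.
have g1i := gi g1 cg1 g10; have g2i := gi g2 cg2 g20.
apply/eqP; rewrite -addr_eq0 -RintegralD//; apply/eqP.
have cg : continuous (fun x => g1 x + g2 x).
  by move=> x; apply: (@cvgD _ _ _ (nbhs x)); [exact: cg1|exact: cg2].
have [C hC] : exists C, forall x, `|g1 x + g2 x| <= C.
  by apply: bd => // x Kx; rewrite g10// g20// addr0.
have cubeK x : (exists j, 1 <= `|x ord0 j|) -> ~ K x.
  move=> [j xj] /KB; rewrite /B /= => /(le_lt_trans (coord_le_enorm x j)).
  by rewrite ltNge xj.
have I0 : (\int[leb]_x (g1 x + g2 x)%:E = 0)%E.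
  (* the support is contained in the unit ball, hence in the cube of half-side 1 *)
  apply: (@integral_partial_eq0 _ _ (fun x => U x * phi x) _ 1 C i) => //.
    move=> x; apply: (is_derive_val_eq (is_derive_mul (dU x i) (test_is_derive tphi x i))).
    by rewrite /g1 /g2; ring.
  by move=> x /cubeK Kx; rewrite g10// g20// addr0 (K0 _ Kx).1 mulr0.
rewrite Rintegral_mkcond /Rintegral -[RHS]/(fine 0) -I0; congr fine.
apply: eq_integral => x _; rewrite patchE; case: ifPn => // /negP Bx.
have Kx : ~ K x by move=> /KB Bx'; apply: Bx; rewrite inE.
by rewrite g10// g20// addr0.
Qed.

End test_functions.

(** * Uniqueness of weak gradients *)

Section flat_limit.
Context (R : realType).

Lemma flat1_ge0 (t : R) : 0 <= flat 1 t.
Proof. by rewrite /flat; case: ifPn => // _; rewrite hornerC mul1r expR_ge0. Qed.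

Lemma flat1_le1 (t : R) : flat 1 t <= 1.
Proof.
rewrite /flat; case: ifPn => // t0.
by rewrite hornerC mul1r -expR0 ler_expR oppr_le0 invr_ge0 ltW.
Qed.

Lemma flat1_norm (t : R) : `|flat 1 t| <= 1.
Proof. by rewrite ger0_norm ?flat1_ge0// flat1_le1. Qed.

Lemma flat1_le0 (t : R) : t <= 0 -> flat 1 t = 0.
Proof. by rewrite /flat ltNge => ->. Qed.

(** The rescaled flat function converges to the indicator of the positive half-line; a
    positive shift c makes it vanish near 0. *)
Lemma flat1_cvg (t c : R) : 0 <= c ->
  (fun n : nat => flat 1 (n.+1%:R * t - c)) @ \oo --> ((0 < t)%R%:R : R).
Proof.
move=> c0; have [t0|t0] := ltP 0 t; last first.
  rewrite (_ : (fun n => _) = cst 0); first exact: cvg_cst.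
  apply/funext => n; apply: flat1_le0; rewrite subr_le0 (le_trans _ c0)//.
  by rewrite mulr_ge0_le0.
have lin : (fun n : nat => n.+1%:R * t - c) @ \oo --> +oo.
  apply/cvgryPge => A; near=> n.
  rewrite lerBrDr -ler_pdivrMr//.
  rewrite (@le_trans _ _ n%:R) ?ler_nat//.
  by near: n; exact: nbhs_infty_ger.
have lin0 : \forall n \near \oo, 0 < n.+1%:R * t - c by move/cvgryPgt : lin.
have inv : (fun n : nat => - (n.+1%:R * t - c)^-1) @ \oo --> (0 : R).
  by rewrite -oppr0; apply: cvgN; apply/gtr0_cvgV0.
have -> : (true%:R : R) = expR 0 by rewrite expR0.
have ec : (fun n : nat => expR (- (n.+1%:R * t - c)^-1)) @ \oo --> expR (0 : R).
  by apply: (cvg_comp _ _ inv); exact: continuous_expR.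
apply: cvg_trans ec; apply: near_eq_cvg.
by apply: filterS lin0 => n hn; rewrite /flat hn hornerC mul1r.
Unshelve. all: by end_near. Qed.

End flat_limit.

Section orthants.
Context (R : realType) (N : nat).
Local Notation V := 'rV[R]_N.

Definition orthant (a : V) : set V := [set x | forall i, a ord0 i < x ord0 i].

Definition orthants : set (set V) := [set orthant a | a in setT].

Lemma orthants_setI : setI_closed orthants.
Proof.
move=> _ _ [a _ <-] [b _ <-].
exists (\row_i Num.max (a ord0 i) (b ord0 i)) => //.
apply/seteqP; split => x /=.
  by move=> h; split => i; have := h i; rewrite mxE gt_max => /andP[].
by move=> [h1 h2] i; rewrite mxE gt_max h1 h2.
Qed.

Lemma measurable_orthant a : measurable (orthant a).
Proof.
apply: (@measurable_rV_forall _ _ (fun i => [set t : R | a ord0 i < t])) => i.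
rewrite (_ : [set t | _] = `]a ord0 i, +oo[%classic); first exact: measurable_itv.
by apply/seteqP; split => t; rewrite /= in_itv/= andbT.
Qed.

(** Orthants are stable under intersection and generate the Borel sets, so they test
    whether a function vanishes almost everywhere. *)
Lemma measurable_orthantsE : (@measurable _ V) = <<s orthants>>.
Proof.
apply/seteqP; split; last first.
  apply: smallest_sub; first exact: sigma_algebra_measurable.
  by move=> _ [a _ <-]; exact: measurable_orthant.
apply: smallest_sub; first exact: smallest_sigma_algebra.
rewrite -bigcup_seq/=; apply: bigcup_sub => i _ A [Y mY <-]; rewrite setTI.
suff : (@measurable _ (measurableTypeR R)) `<=` [set Y | <<s orthants>> ((fun x : V => x ord0 i) @^-1` Y)].
  exact.
have -> : (@measurable _ (measurableTypeR R)) = <<s (@RGenOInfty.G R)>>.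
  exact: RGenOInfty.measurableE.
apply: smallest_sub.
  split.
  - rewrite /= preimage_set0; exact: sigma_algebra0.
  - by move=> Z /= hZ; rewrite setTD preimage_setC -setTD; apply: sigma_algebraCD.
  - by move=> F hF /=; rewrite preimage_bigcup; exact: sigma_algebra_bigcup.
move=> _ [a ->] /=.
have -> : (fun x : V => x ord0 i) @^-1` `]a, +oo[%classic =
    \bigcup_n orthant (\row_j if j == i then a else - n%:R).
  apply/seteqP; split => [x /= xa|x [n _ /(_ i)]]; last first.
    by rewrite /= mxE eqxx in_itv/= andbT.
  move: xa; rewrite in_itv/= andbT => xa.
  have [n hn] : exists n : nat, forall j, `|x ord0 j| < n%:R.
    exists (Num.bound (\sum_j `|x ord0 j|)) => j.
    apply: le_lt_trans (archi_boundP (sumr_ge0 _ _)) => //.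
    by rewrite (bigD1 j)//= lerDl sumr_ge0.
  exists n => // j; rewrite mxE; case: eqP => [->//|_].
  by have := hn j; rewrite ltr_norml => /andP[].
apply: sigma_algebra_bigcup => n.
by apply: sub_gen_smallest; exists (\row_j if j == i then a else - n%:R).
Qed.

End orthants.

Section uniqueness.
Context (R : realType) (N : nat).
Local Notation V := 'rV[R]_N.
Local Notation leb := (@lebesgue_rV R N).
Local Notation B := (@B R N).

(** Test functions that converge to the indicator of an orthant, within the annulus
    0 < |x|^2 < c.  Removing the origin keeps them in the syntactic class. *)
Definition box_bump (c : R) (a : V) (n : nat) (x : V) : R :=
  (\prod_i flat 1 (n.+1%:R * x ord0 i + - (n.+1%:R * a ord0 i))) *
  (flat 1 (n.+1%:R * dotv x x + -1) *
   flat 1 ((- n.+1%:R) * dotv x x + (n.+1%:R * c - 1))).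

Lemma box_bump_out c a n x : ~ (0 < dotv x x < c) -> box_bump c a n x = 0.
Proof.
move=> h; rewrite /box_bump; have [x0|x0] := leP (dotv x x) 0.
  rewrite (@flat1_le0 _ (n.+1%:R * dotv x x + -1)) ?mul0r ?mulr0//.
  by rewrite subr_le0 (le_trans _ ler01)// mulr_ge0_le0.
have [xc|xc] := ltP (dotv x x) c; first by exfalso; apply: h; rewrite x0.
rewrite (@flat1_le0 _ (- n.+1%:R * _ + _)) ?mulr0//.
rewrite mulNr addrA [- _ + _]addrC -mulrBr subr_le0.
by rewrite (@le_trans _ _ 0)// mulr_ge0_le0// subr_le0.
Qed.

Lemma box_bump_test c a n : c < 1 -> test_function (box_bump c a n).
Proof.
move=> c1; apply: (@punctured_test_function _ _ (box_bump c a n) _ c) => //.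
- rewrite /box_bump; apply: punctured_mul.
    apply: punctured_prod => i.
    apply: (punctured_comp (h := fun t => flat 1 (n.+1%:R * t + - (n.+1%:R * a ord0 i)))).
      exact: smooth_flat.
    exact: punctured_coord.
  apply: punctured_mul.
    by apply: (punctured_comp (h := fun t => flat 1 (n.+1%:R * t + -1)));
      [exact: smooth_flat|exact: punctured_dotv].
  by apply: (punctured_comp (h := fun t => flat 1 ((- n.+1%:R) * t + (n.+1%:R * c - 1))));
      [exact: smooth_flat|exact: punctured_dotv].
- have : \forall x \near (0 : V), dotv x x < n.+1%:R^-1.
    have := @dotv_continuous R N 0; move/cvgr_lt => /(_ n.+1%:R^-1).
    by rewrite /dotv big1 ?invr_gt0; [apply|move=> i _; rewrite mxE mul0r].
  apply: filterS => x xn; rewrite /box_bump (@flat1_le0 _ (n.+1%:R * dotv x x + -1)) ?mul0r ?mulr0//.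
  by rewrite subr_le0 -ler_pdivlMl// mulr1 ltW.
- by move=> x xc; apply: box_bump_out => /andP[_]; rewrite ltNge xc.
Qed.

Lemma box_bump_norm c a n x : `|box_bump c a n x| <= 1.
Proof.
rewrite /box_bump !normrM normr_prod.
have h : \prod_i `|flat 1 (n.+1%:R * x ord0 i + - (n.+1%:R * a ord0 i))| <= 1.
  by apply: prodr_ile1 => i _; rewrite normr_ge0 flat1_norm.
apply: mulr_ile1 => //; rewrite ?mulr_ge0 ?prodr_ge0//.
by apply: mulr_ile1; rewrite ?flat1_norm.
Qed.

Lemma box_bump_cvg c a x : 0 < dotv x x < c ->
  box_bump c a ^~ x @ \oo --> (\1_(orthant a) x : R).
Proof.
move=> /andP[x0 xc].
have h1 i : (fun n : nat => flat 1 (n.+1%:R * x ord0 i + - (n.+1%:R * a ord0 i)))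
    @ \oo --> ((a ord0 i < x ord0 i)%R%:R : R).
  rewrite -subr_gt0; have := @flat1_cvg R (x ord0 i - a ord0 i) 0 (lexx _).
  by under eq_fun do rewrite subr0 mulrBr.
have h2 : (fun n : nat => flat 1 (n.+1%:R * dotv x x + -1)) @ \oo --> (1 : R).
  by have := @flat1_cvg R (dotv x x) 1 ler01; rewrite x0.
have h3 : (fun n : nat => flat 1 ((- n.+1%:R) * dotv x x + (n.+1%:R * c - 1))) @ \oo --> (1 : R).
  have := @flat1_cvg R (c - dotv x x) 1 ler01; rewrite subr_gt0 xc.
  rewrite [X in X @ \oo --> _ -> _](_ : _ = fun n : nat =>
    flat 1 ((- n.+1%:R) * dotv x x + (n.+1%:R * c - 1)))//.
  by apply/funext => n; congr (flat _ _); ring.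
have hp : (fun n : nat => \prod_i flat 1 (n.+1%:R * x ord0 i + - (n.+1%:R * a ord0 i)))
    @ \oo --> (\prod_i (a ord0 i < x ord0 i)%R%:R : R).
  elim: (index_enum 'I_N) => [|i s ih].
    under eq_fun do rewrite big_nil; rewrite big_nil; exact: cvg_cst.
  under eq_fun do rewrite big_cons; rewrite big_cons; exact: cvgM.
have H := cvgM hp (cvgM h2 h3); rewrite !mulr1 in H.
suff -> : (\1_(orthant a) x : R) = \prod_i (a ord0 i < x ord0 i)%R%:R by exact: H.
rewrite indicE.
have [/set_mem xa|/negP xa] := boolP (x \in orthant a).
  by rewrite big1// => i _; rewrite xa.
have /existsNP[i /negP xi] : ~ (forall i, a ord0 i < x ord0 i).
  by move=> h; apply: xa; rewrite inE.
by rewrite (bigD1 i)//= (negbTE xi) mul0r.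
Qed.

Lemma ae_neq0 : (0 < N)%N -> {ae leb, forall x : V, x <> 0}.
Proof.
move=> N0; exists [set 0]; split; [|exact: lebesgue_origin|by move=> x /contrapT].
apply: measurable_rV_closed; apply: accessible_closed_set1; apply: hausdorff_accessible.
exact: norm_hausdorff.
Qed.

(** The fundamental lemma of the calculus of variations. *)
Lemma test_null_ae_eq0 (g : V -> R) : (0 < N)%N -> locally_integrable_B g ->
  (forall phi, test_function phi -> \int[leb]_(x in B) (g x * phi x) = 0) ->
  {ae leb, forall x, B x -> g x = 0}.
Proof.
move=> N0 gi g0.
(* annuli that exhaust the punctured ball; g is integrable on each of them *)
pose D (k : nat) : set V := [set x | 0 < dotv x x < 1 - k.+2%:R^-1].
have c1 k : 1 - k.+2%:R^-1 < 1 :> R by rewrite gtrBl.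
have mD k : measurable (D k).
  apply: measurable_rV_open; rewrite (_ : D k = (fun x : V => dotv x x) @^-1` `]0, 1 - k.+2%:R^-1[%classic).
    by apply: open_comp; [move=> x _; exact: dotv_continuous|exact: interval_open].
  by apply/seteqP; split => x; rewrite /D /= in_itv.
have giD k : leb.-integrable (D k) (EFin \o g).
  apply: (@integrableS _ _ _ _ [set x | dotv x x <= 1 - k.+2%:R^-1]) => //.
  - by apply: measurable_rV_compact; exact: compact_ball.
  - by move=> x; rewrite /D /= => /andP[_ /ltW].
  - apply: gi; first exact: compact_ball.
    by move=> x /= h; rewrite unit_ballE /= (le_lt_trans h).
have key k a : \int[leb]_(x in D k `&` orthant a) g x = 0.
  pose f_ n x := box_bump (1 - k.+2%:R^-1) a n x * g x.
  have mb n : measurable_fun (D k) (box_bump (1 - k.+2%:R^-1) a n).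
    apply: measurable_funTS; apply: continuous_rV_measurable.
    by apply: test_continuous; exact: box_bump_test.
  have f0 n : \int[leb]_(x in D k) f_ n x = 0.
    rewrite -(g0 _ (box_bump_test a n (c1 k))) Rintegral_mkcond [RHS]Rintegral_mkcond.
    apply: eq_Rintegral => x _; rewrite !patchE /f_ mulrC.
    have [/set_mem xD|/negP xD] := boolP (x \in D k).
      rewrite ifT// inE unit_ballE /=; have /andP[_ h] := xD; exact: lt_trans (c1 k).
    case: ifPn => // _; rewrite box_bump_out ?mulr0//.
    by move=> h; apply: xD; rewrite inE.
  have mg := integrable_measurable (giD k).
  have cf x : D k x -> f_ ^~ x @ \oo --> (g \_ (orthant a)) x.
    move=> Dx; rewrite patchE.
    have : f_ ^~ x @ \oo --> (\1_(orthant a) x * g x : R).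
      by apply: cvgM; [exact: box_bump_cvg|exact: cvg_cst].
    rewrite indicE; by case: ifPn => _ /=; rewrite ?mul1r ?mul0r.
  have fg n x : D k x -> `|f_ n x| <= (Num.norm \o g) x.
    by move=> Dx; rewrite /f_ normrM /= ler_piMl// box_bump_norm.
  have [_ H] := Rintegral_dominated_cvg (mD k) (fun n => measurable_funM (mb n) mg)
    cf (integrable_norm (giD k)) fg.
  rewrite Rintegral_mkcondr -(cvg_lim _ H)//.
  by rewrite (_ : (fun n => _) = cst 0) ?lim_cst//; apply/funext => n; rewrite f0.
have aeD k : {ae leb, forall x, D k x -> g x = 0}.
  apply: (Rintegral_pi_system_eq0 (@measurable_orthantsE R N) (@orthants_setI R N)) => //.
  (* this orthant contains the whole ball *)
  - rewrite -(key k (\row_i (- 2))); congr (Rintegral _ _ _).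
    apply/esym/setIidPl => x /andP[_ xk] i; rewrite mxE.
    have : B x by rewrite unit_ballE /=; exact: lt_trans (c1 k).
    move=> /B_sub_cube/(_ i); rewrite ler_norml => /andP[h _].
    by apply: lt_le_trans h; rewrite ltrN2 ltr1n.
  - by move=> _ [a _ <-]; exact: key.
have ae0 := ae_neq0 N0.
have := ae_foralln aeD; move: ae0; apply: filterS2 => x x0 h; rewrite unit_ballE /= => x1.
have xx0 : 0 < dotv x x by rewrite dotv_gt0; apply/eqP.
have d0 : 0 < 1 - dotv x x by rewrite subr_gt0.
have [k _ hk] := near_infty_natSinv_lt (PosNum d0).
apply: (h k); rewrite /D /= xx0 /= ltrBrDl addrC -ltrBrDl; apply: lt_trans (hk k (leqnn k)).
by rewrite ltf_pV2 ?posrE// ltr_nat.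
Qed.

Lemma weak_gradient_unique (u : V -> R) G G' : (0 < N)%N ->
  weak_gradient u G -> weak_gradient u G' ->
  {ae leb, forall x, B x -> G x = G' x}.
Proof.
move=> N0 [lu lG hG] [_ lG' hG'].
have mB := @measurable_B R N.
have test_mul_integrable (g : V -> R) phi : locally_integrable_B g -> test_function phi ->
    leb.-integrable B (EFin \o (fun x => g x * phi x)).
  move=> lg tphi; have [K [cK KB K0]] := test_support tphi.
  have mK := measurable_rV_compact cK; have [C hC] := test_bounded tphi.
  have : leb.-integrable K (EFin \o (fun x => phi x * g x)).
    apply: (integrable_mul_bounded (M := C)) => //.
    - by apply: measurable_funTS; apply: continuous_rV_measurable; exact: test_continuous.
    - by move=> x _; exact: (hC x).1.
    - exact: lg.
  rewrite -(setIidr KB) => /(integrable_restrict leb mK mB _).1.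
  apply: eq_integrable => // x _; rewrite /= patchE; case: ifPn => /= [_|/negP xK].
    by rewrite mulrC.
  by rewrite (K0 x _).1 ?mulr0// => Kx; apply: xK; rewrite inE.
have each i : {ae leb, forall x, B x -> G x ord0 i - G' x ord0 i = 0}.
  apply: test_null_ae_eq0 => //.
    move=> K cK KB; have mK := measurable_rV_compact cK.
    rewrite (_ : _ \o _ = (EFin \o (fun x => G x ord0 i)) \- (EFin \o (fun x => G' x ord0 i)))%E//.
    by apply: integrableB => //; [exact: lG|exact: lG'].
  move=> phi tphi; under eq_Rintegral do rewrite mulrBl.
  rewrite RintegralB//; try exact: test_mul_integrable.
  by apply/eqP; rewrite subr_eq0 -eqr_opp -hG// -hG'.
have : {ae leb, forall x, forall i, B x -> G x ord0 i - G' x ord0 i = 0}.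
  (* countably many null sets, indexed by all naturals: those above N impose nothing *)
  pose P n x := forall i : 'I_N, nat_of_ord i = n -> B x -> G x ord0 i - G' x ord0 i = 0.
  have : forall n, {ae leb, forall x, P n x}.
    move=> n; have [nN|nN] := ltnP n N.
      apply: filterS (each (Ordinal nN)) => x h i iE Bx.
      by rewrite -(h Bx) (_ : i = Ordinal nN)//; exact/val_inj.
    by apply: aeW => x i iE; have := ltn_ord i; rewrite iE ltnNge nN.
  move=> /ae_foralln; apply: filterS => x h i; exact: (h i i).
apply: filterS => x h Bx; apply/rowP => i.
by apply/eqP; rewrite -subr_eq0; apply/eqP; exact: h.
Qed.

End uniqueness.

(** * The divergence theorem for smooth radial fields *)

Section radial_power.
Context (R : realType) (N : nat).
Local Notation V := 'rV[R]_N.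
Local Notation B := (@B R N).
Implicit Types (x : V).
Hypothesis N0 : (0 < N)%N.

(** The volume variable |x|^N: the measure of a ball is proportional to its value on the
    boundary.  As a power of |x|^2 it is one of the syntactic smooth functions. *)
Definition tau x : R := dotv x x `^ (N%:R / 2).

Lemma tauE x : tau x = enorm x ^+ N.
Proof.
rewrite /tau -powR_mulrn ?enorm_ge0// /enorm -powR12_sqrt ?dotv_ge0//.
by rewrite -powRrM mulrC.
Qed.

Lemma tau_ge0 x : 0 <= tau x. Proof. exact: powR_ge0. Qed.

Lemma tau_gt0 x : (0 < tau x) = (x != 0).
Proof. by rewrite lt_neqAle tau_ge0 andbT eq_sym tauE expf_eq0 N0 enorm_eq0. Qed.

Lemma tau0 : tau (0 : V) = 0.
Proof. by apply/eqP; rewrite eq_le tau_ge0 andbT leNgt tau_gt0 eqxx. Qed.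

Lemma tau_lt1 x : B x -> tau x < 1.
Proof. by move=> Bx; rewrite tauE exprn_ilt1 ?enorm_ge0// -lt0n. Qed.

Lemma tau_continuous : continuous tau.
Proof.
rewrite (_ : tau = fun x => enorm x ^+ N); last by apply/funext => x; exact: tauE.
move=> x; apply: (@continuous_comp _ _ _ (@enorm R N) (fun t : R => t ^+ N)); last exact: exprn_continuous.
apply: (@continuous_comp _ _ _ (fun x : V => dotv x x) (@Num.sqrt R)).
  exact: dotv_continuous.
exact: sqrt_continuous.
Qed.

Lemma near0_tau_lt (a : R) : 0 < a -> \forall x \near (0 : V), tau x < a.
Proof.
by move=> a0; have := @tau_continuous 0; move/cvgr_lt => /(_ a); rewrite tau0; exact.
Qed.

Lemma measurable_tau : measurable_fun setT tau.
Proof. by apply: continuous_rV_measurable; exact: tau_continuous. Qed.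

End radial_power.

Section gauss_smooth.
Context (R : realType) (N : nat).
Local Notation V := 'rV[R]_N.
Local Notation leb := (@lebesgue_rV R N).
Local Notation B := (@B R N).
Implicit Types (x : V).
Hypothesis N0 : (0 < N)%N.
Variables (k K : R -> R) (al be : R).
Hypotheses (sk : smooth_fun k) (dK : forall t : R, is_derive t 1 K (k t)).
Hypotheses (al0 : 0 < al) (be0 : 0 < be) (be1 : be < 1).
Hypotheses (K0 : forall t, t <= al -> K t = 0) (K1 : forall t, be <= t -> K t = 0).

Let Phi (i : 'I_N) x := (K (tau x) * dotv x x `^ (- (N%:R / 2))) * x ord0 i.

(** K vanishes near 0 and for arguments close to 1, hence the field is smooth with compact
    support in the ball. *)
Lemma radial_field_test i : test_function (Phi i).
Proof.
apply: (@punctured_test_function _ _ (Phi i) _ (be `^ (2 / N%:R))) => //.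
- rewrite /Phi; apply: punctured_mul; last exact: punctured_coord.
  apply: punctured_mul; last exact: punctured_powR.
  apply: punctured_comp; last exact: punctured_powR.
  exact: smooth_primitive dK.
- by apply: filterS (near0_tau_lt N0 al0) => x xn; rewrite /Phi K0 ?mul0r// ltW.
- rewrite -[X in _ < X](_ : 1 `^ (2 / N%:R) = 1); last by rewrite powR1.
  by rewrite gt0_ltr_powR ?nnegrE ?ler01 ?(ltW be0)// divr_gt0// ltr0n.
- move=> x xc; rewrite /Phi K1 ?mul0r// /tau.
  have e1 : (2 / N%:R) * (N%:R / 2) = 1 :> R by field; rewrite pnatr_eq0 -lt0n.
  apply: (@le_trans _ _ (be `^ ((2 / N%:R) * (N%:R / 2)))).
    by rewrite e1 powRr1// ltW.
  by rewrite powRrM ge0_ler_powR ?nnegrE ?powR_ge0 ?dotv_ge0// divr_ge0.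
Qed.

(** For K(t) = t the field is x, of divergence N; in the volume variable the divergence is
    always N times the derivative of K. *)
Lemma radial_field_divergence x : \sum_i partial i (Phi i) x = N%:R * k (tau x).
Proof.
have NR : (N%:R : R) != 0 by rewrite pnatr_eq0 -lt0n.
have k0 t : t < al -> k t = 0.
  move=> tal; have : is_derive t 1 K 0.
    apply: is_derive_near (is_derive_cst (0 : R) t 1).
    near=> s; rewrite K0//= ltW//; near: s; exact: lt_nbhsl.
  by case => _ <-; case: (dK t).
have [->|x0] := eqVneq x 0.
  rewrite k0 ?tau0// mulr0 big1// => i _.
  have : is_derive (0 : V) (delta_mx ord0 i) (Phi i) 0.
    apply: is_derive_near (is_derive_cst (0 : R) 0 (delta_mx ord0 i)).
    by apply: filterS (near0_tau_lt N0 al0) => y yn; rewrite /Phi K0 ?mul0r// ltW.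
  by case.
have r0 : 0 < dotv x x by rewrite dotv_gt0.
set n2 : R := N%:R / 2.
have dtau i : is_derive x (delta_mx ord0 i) (@tau R N)
    ((n2 * dotv x x `^ (n2 - 1)) * (2 * x ord0 i)).
  apply: (is_derive_comp (h := fun t => t `^ n2)); last exact: is_derive_dotv.
  exact: is_derive1_powR.
have dpow i : is_derive x (delta_mx ord0 i) (fun x : V => dotv x x `^ (- n2))
    ((- n2 * dotv x x `^ (- n2 - 1)) * (2 * x ord0 i)).
  apply: (is_derive_comp (h := fun t => t `^ (- n2))); last exact: is_derive_dotv.
  exact: is_derive1_powR.
have dPhi i : partial i (Phi i) x = (K (tau x) * dotv x x `^ (- n2)) +
    N%:R * (k (tau x) * (dotv x x)^-1 -
       K (tau x) * dotv x x `^ (- n2) * (dotv x x)^-1) * (x ord0 i * x ord0 i).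
  have := is_derive_mul (is_derive_mul (is_derive_comp (dK (tau x)) (dtau i)) (dpow i))
    (is_derive_coord x i i).
  case=> _; rewrite /partial => ->; rewrite eqxx mulr1.
  have -> : dotv x x `^ (n2 - 1) = dotv x x `^ n2 * (dotv x x)^-1.
    by rewrite powRB ?powRr1 ?ltW// (gt_eqF r0) implybT.
  have -> : dotv x x `^ (- n2 - 1) = dotv x x `^ (- n2) * (dotv x x)^-1.
    by rewrite powRB ?powRr1 ?ltW// (gt_eqF r0) implybT.
  have pn : dotv x x `^ n2 * dotv x x `^ (- n2) = 1.
    by rewrite powRN divff// gt_eqF// powR_gt0.
  have n2E : N%:R = 2 * n2 by rewrite /n2; field.
  rewrite n2E; move: pn; move: (dotv x x `^ n2) (dotv x x `^ (- n2)) => a b ab.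
  move: (k (tau x)) (K (tau x)) (dotv x x)^-1 (x ord0 i) => kt Kt r y.
  transitivity (Kt * b + 2 * n2 * (kt * (a * b) * r - Kt * b * r) * (y * y)).
    ring.
  by rewrite ab mulr1.
under eq_bigr do rewrite dPhi.
rewrite big_split/= sumr_const card_ord -mulr_sumr -/(dotv x x) -mulr_natl.
move: (K _ * _) (k _) => a b; field; exact: lt0r_neq0.
Unshelve. all: by end_near. Qed.

Lemma gauss_smooth phi (G : V -> V) : weak_gradient phi G ->
  leb.-integrable B (EFin \o phi) ->
  (forall i, leb.-integrable B (EFin \o (fun x => G x ord0 i))) ->
  \int[leb]_(x in B) (K (tau x) / tau x * dotv x (G x)) =
  - N%:R * \int[leb]_(x in B) (k (tau x) * phi x).
Proof.
move=> [_ _ wG] iphi iG; have mB := @measurable_B R N.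
have tPhi := radial_field_test.
have mtest (f : V -> R) : continuous f -> measurable_fun B f.
  by move=> cf; apply: measurable_funTS; exact: continuous_rV_measurable.
have i1 i : leb.-integrable B (EFin \o (fun x => partial i (Phi i) x * phi x)).
  have [C hC] := test_bounded (tPhi i).
  apply: (integrable_mul_bounded (M := C)) => //.
    by apply: mtest; exact: (@test_partial_continuous _ _ _ (tPhi i) i).
  by move=> x _; exact: (hC x).2.
have i2 i : leb.-integrable B (EFin \o (fun x => Phi i x * G x ord0 i)).
  have [C hC] := test_bounded (tPhi i).
  apply: (integrable_mul_bounded (M := C)) => //.
    by apply: mtest; exact: test_continuous (tPhi i).
  by move=> x _; exact: (hC x).1.
have -> : \int[leb]_(x in B) (K (tau x) / tau x * dotv x (G x)) =
    \int[leb]_(x in B) (\sum_i (Phi i x * G x ord0 i)).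
  apply: eq_Rintegral => x _; rewrite /dotv mulr_sumr; apply: eq_bigr => i _.
  by rewrite /Phi powRN mulrA.
have -> : - N%:R * \int[leb]_(x in B) (k (tau x) * phi x) =
    - \int[leb]_(x in B) (\sum_i (partial i (Phi i) x * phi x)).
  have -> : \int[leb]_(x in B) (\sum_i (partial i (Phi i) x * phi x)) =
      \int[leb]_(x in B) (N%:R * (k (tau x) * phi x)).
    by apply: eq_Rintegral => x _; rewrite -mulr_suml radial_field_divergence mulrA.
  rewrite mulNr RintegralZl//.
  have := @integrable_real_sum _ _ _ leb B _ (index_enum 'I_N) _ mB i1.
  move=> /(integrableZl mB N%:R^-1); apply: eq_integrable => // x _ /=.
  rewrite -mulr_suml radial_field_divergence -EFinM mulrA mulrA mulVf ?mul1r//.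
  by rewrite pnatr_eq0 -lt0n.
rewrite !Rintegral_sum// -sumrN; apply: eq_bigr => i _.
under eq_Rintegral do rewrite mulrC.
under [in RHS]eq_Rintegral do rewrite mulrC.
by rewrite wG// opprK.
Qed.

End gauss_smooth.

(** * Radial fields with a step function as divergence *)

Section gauss_step.
Context (R : realType) (N : nat).
Local Notation V := 'rV[R]_N.
Local Notation leb := (@lebesgue_rV R N).
Local Notation mu := (@lebesgue_measure R).
Local Notation B := (@B R N).
Implicit Types (x : V) (b t : R).
Hypothesis N0 : (0 < N)%N.

(** A smooth approximation from below of the indicator of the interval from b to 1, with
    support inside. *)
Definition bump b (n : nat) t : R :=
  flat 1 (n.+1%:R * t + (- (n.+1%:R * b) - 1)) *
  flat 1 ((- n.+1%:R) * t + (n.+1%:R - 1)).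

Lemma smooth_bump b n : smooth_fun (bump b n).
Proof. by apply: smooth_mul; exact: smooth_flat. Qed.

Lemma bump_left b n t : t <= b + n.+1%:R^-1 -> bump b n t = 0.
Proof.
move=> h; rewrite /bump flat1_le0 ?mul0r//.
rewrite addrA -mulrBr subr_le0 -ler_pdivlMl// mulr1.
by move: h; move: (n.+1%:R^-1) => a h; lra.
Qed.

Lemma bump_right b n t : 1 - n.+1%:R^-1 <= t -> bump b n t = 0.
Proof.
move=> h; rewrite /bump [X in _ * X]flat1_le0 ?mulr0//.
rewrite (_ : _ + _ = n.+1%:R * (1 - t) - 1); last by ring.
rewrite subr_le0 -ler_pdivlMl// mulr1.
by move: h; move: (n.+1%:R^-1) => a h; lra.
Qed.

Lemma bump_ge0 b n t : 0 <= bump b n t.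
Proof. by rewrite mulr_ge0// flat1_ge0. Qed.

Lemma bump_le b n t : bump b n t <= \1_`]b, 1[ t.
Proof.
rewrite indicE; have [/set_mem tb|/negP tb] := boolP (t \in _).
  by rewrite mulr_ile1 ?flat1_ge0 ?flat1_le1.
have [h|h] := leP t b; first by rewrite bump_left// (le_trans h)// lerDl.
have [h1|h1] := leP 1 t; first by rewrite bump_right// (le_trans _ h1)// gerBl.
by exfalso; apply: tb; rewrite inE/= in_itv/= h h1.
Qed.

Lemma bump_cvg b t : bump b ^~ t @ \oo --> (\1_`]b, 1[ t : R).
Proof.
have h1 : (fun n : nat => flat 1 (n.+1%:R * t + (- (n.+1%:R * b) - 1))) @ \oo -->
    ((b < t)%R%:R : R).
  have := @flat1_cvg R (t - b) 1 ler01; rewrite subr_gt0.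
  by rewrite (_ : (fun n => _) = fun n : nat => flat 1 (n.+1%:R * t + (- (n.+1%:R * b) - 1)))//;
    apply/funext => n; congr (flat _ _); ring.
have h2 : (fun n : nat => flat 1 ((- n.+1%:R) * t + (n.+1%:R - 1))) @ \oo -->
    ((t < 1)%R%:R : R).
  have := @flat1_cvg R (1 - t) 1 ler01; rewrite subr_gt0.
  by rewrite (_ : (fun n => _) = fun n : nat => flat 1 ((- n.+1%:R) * t + (n.+1%:R - 1)))//;
    apply/funext => n; congr (flat _ _); ring.
have H := cvgM h1 h2.
suff -> : (\1_`]b, 1[ t : R) = (b < t)%R%:R * (t < 1)%R%:R by exact: H.
rewrite indicE -natrM mulnb; congr (_%:R).
by rewrite mem_setE in_itv.
Qed.

Definition bump_prim b n t : R := \int[mu]_(s in `]-oo, t]) bump b n s.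

Lemma integrable_itv01 b (A : set R) : 0 <= b -> measurable A ->
  mu.-integrable A (EFin \o (\1_`]b, 1[ : R -> R)).
Proof.
move=> b0 mA; apply: (@integrableS _ _ _ _ setT) => //.
exact: (integrable_indic_itv b 1 false true).
Qed.

Lemma integrable_bump b n (A : set R) : 0 <= b -> measurable A ->
  mu.-integrable A (EFin \o bump b n).
Proof.
move=> b0 mA; apply: (integrable_le _ _ _ (integrable_itv01 b0 mA)) => //.
  apply: measurable_funTS; apply: continuous_measurable_fun.
  by apply: smooth_fun_continuous; exact: smooth_bump.
by move=> t _; rewrite ger0_norm ?bump_ge0// bump_le.
Qed.

Lemma is_derive_bump_prim b n t : 0 <= b -> is_derive t 1 (bump_prim b n) (bump b n t).
Proof.
move=> b0.
have tt1 : t < t + 1 by rewrite ltrDl.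
have ib := integrable_bump n b0 (measurable_itv (Interval -oo%O (BRight (t + 1)))).
have cb : continuous (bump b n) by apply: smooth_fun_continuous; exact: smooth_bump.
have H := continuous_FTC1 tt1 ib.
have [||h1 h2] := H; [by rewrite /= ltNyr|exact: cb|].
by split; [exact: h1|rewrite -derive1E; exact: h2].
Qed.

Lemma integral_step b t : 0 <= b -> t <= 1 ->
  \int[mu]_(s in `]-oo, t]) (\1_`]b, 1[ s : R) = Num.max (t - b) 0.
Proof.
move=> b0 t1; rewrite /Rintegral integral_indic//.
have [bt|tb] := ltP b t.
  rewrite max_l ?subr_ge0 ?(ltW bt)//.
  have [tt1|t1'] := ltP t 1.
    rewrite (_ : `]b, 1[ `&` `]-oo, t] = `]b, t]%classic :> set R).
      have h : (mu `]b, t]%classic = (t - b)%:E)%E by rewrite lebesgue_measure_itv/= lte_fin bt.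
      by rewrite [X in fine X]h.
    apply/seteqP; split => s; rewrite /= !in_itv/=; first by move=> [/andP[-> _] ->].
    by move=> /andP[-> st]; split => //; exact: le_lt_trans tt1.
  rewrite (_ : `]b, 1[ `&` `]-oo, t] = `]b, 1[%classic :> set R).
    have h : (mu `]b, 1%R[%classic = (1 - b)%:E)%E.
      by rewrite lebesgue_measure_itv/= lte_fin (lt_le_trans bt t1).
    by rewrite [X in fine X]h /=; congr (_ - _); apply/eqP; rewrite eq_le t1 t1'.
  apply/seteqP; split => s; rewrite /= !in_itv/=; first by case.
  by move=> /andP[h1 h2]; rewrite h1 h2; split => //; apply: le_trans t1'; exact: ltW.
rewrite max_r ?subr_le0// (_ : `]b, 1[ `&` `]-oo, t] = set0 :> set R) ?measure0//.
apply/seteqP; split => s //=; rewrite !in_itv/= => -[/andP[bs _] st].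
by move: (lt_le_trans bs st); rewrite ltNge tb.
Qed.

Lemma bump_prim_cvg b t : 0 <= b -> t <= 1 ->
  bump_prim b ^~ t @ \oo --> Num.max (t - b) 0.
Proof.
move=> b0 t1; rewrite -(integral_step b0 t1).
have mA : measurable (`]-oo, t]%classic : set R) by exact: measurable_itv.
have mb n : measurable_fun `]-oo, t] (bump b n).
  by apply: (@integrable_measurable _ _ _ mu); exact: integrable_bump.
have bb n s : `]-oo, t]%classic s -> `|bump b n s| <= \1_`]b, 1[ s.
  by move=> _; rewrite ger0_norm ?bump_ge0// bump_le.
have [_ H] := Rintegral_dominated_cvg (mu := mu) mA mb (fun s _ => @bump_cvg b s)
  (integrable_itv01 b0 mA) bb.
exact: H.
Qed.

Lemma bump_prim_ge0 b n t : 0 <= bump_prim b n t.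
Proof. by apply: Rintegral_ge0 => s _; exact: bump_ge0. Qed.

Lemma bump_prim_le b n t : 0 <= b -> 0 <= t <= 1 -> bump_prim b n t <= t.
Proof.
move=> b0 /andP[t0 t1]; apply: (@le_trans _ _ (Num.max (t - b) 0)).
  rewrite -(integral_step b0 t1); apply: le_Rintegral => //.
  - exact: integrable_bump.
  - exact: integrable_itv01.
  - by move=> s _; exact: bump_le.
by rewrite ge_max t0 andbT lerBlDr lerDl.
Qed.

Lemma bump_prim_left b n t : t <= b + n.+1%:R^-1 -> bump_prim b n t = 0.
Proof.
move=> h; rewrite /bump_prim -[RHS](Rintegral_set0 mu (bump b n)).
rewrite Rintegral_mkcond [RHS]Rintegral_mkcond; apply: eq_Rintegral => s _.
rewrite !patchE in_set0; case: ifPn => //; rewrite inE/= in_itv/= => st.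
by rewrite bump_left// (le_trans st).
Qed.

Lemma bump_prim_right b n t : 1 - n.+1%:R^-1 <= t -> bump_prim b n t = bump_prim b n 1.
Proof.
move=> h; rewrite /bump_prim Rintegral_mkcond [RHS]Rintegral_mkcond.
apply: eq_Rintegral => s _; rewrite !patchE !mem_setE !in_itv/=.
have [h1|h1] := leP (1 - n.+1%:R^-1) s.
  by rewrite bump_right// !if_same.
by rewrite (ltW (lt_le_trans h1 h)) (le_trans (ltW h1))// gerBl.
Qed.

(** A crude bound that dominates the approximating fields and their divergences. *)
Lemma normr_cross_le (a b x y t : R) : 0 <= a <= 1 -> 0 <= b <= 1 -> 0 <= x <= t ->
  0 <= y <= t -> `|a * x - b * y| <= 2 * t.
Proof.
move=> /andP[a0 a1] /andP[b0 b1] /andP[x0 xt] /andP[y0 yt].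
rewrite (le_trans (ler_normB _ _))// mulr_natl mulr2n !normrM !ger0_norm//.
by rewrite lerD// -[leRHS]mul1r ler_pM.
Qed.

Lemma measurable_gt_tau b (D : set V) : measurable D ->
  measurable_fun D (fun x => (b < tau x)%R%:R : R).
Proof.
move=> mD; apply: measurable_funTS.
rewrite (_ : (fun x => _) = (\1_(`]b, +oo[%classic) : R -> R) \o (@tau R N)); last first.
  by apply/funext => x /=; rewrite indicE mem_setE in_itv/= andbT.
apply: measurableT_comp => //; exact: measurable_tau.
Qed.

Lemma measurable_invr_tau (D : set V) : measurable D ->
  measurable_fun D (fun x => (tau x)^-1 : R).
Proof.
move=> mD; apply: measurable_funTS.
rewrite (_ : (fun x => (tau x)^-1) = (fun x => tau x `^ (-1))); last first.
  by apply/funext => x; rewrite powR_inv1// tau_ge0.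
apply: (@measurableT_comp _ _ _ _ _ _ (fun y : R => y `^ (-1))) => //.
exact: measurable_tau.
Qed.

Lemma integrable_radial_component (G : V -> V) :
  (forall i, leb.-integrable B (EFin \o (fun x => G x ord0 i))) ->
  leb.-integrable B (EFin \o (fun x => dotv x (G x))).
Proof.
move=> iG; apply: integrable_real_sum => [|i]; first exact: measurable_B.
apply: (integrable_mul_bounded (M := 1)) => //; first exact: measurable_B.
  by apply: measurable_funTS; exact: measurable_rV_coord.
by move=> x Bx; rewrite (le_trans (coord_le_enorm x i))// ltW.
Qed.

(** The step function with jump at b has a nonzero mean; subtracting its mean 1 - b
    makes the field vanish on the unit sphere.  The approximations below are smooth, of mean
    zero, and supported away from 0 and 1. *)
Lemma gauss_step phi (G : V -> V) b : 0 <= b < 1 -> weak_gradient phi G ->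
  leb.-integrable B (EFin \o phi) ->
  (forall i, leb.-integrable B (EFin \o (fun x => G x ord0 i))) ->
  \int[leb]_(x in B)
     ((Num.max (tau x - b) 0 - (1 - b) * tau x) / tau x * dotv x (G x)) =
  - N%:R * \int[leb]_(x in B) (((b < tau x)%R%:R - (1 - b)) * phi x).
Proof.
move=> /andP[b0 b1] wG iphi iG; have mB := @measurable_B R N.
have idot := integrable_radial_component iG.
(* cross-multiplying by the means of the bumps for b and 0 makes the combination
   have mean zero *)
pose I c n := bump_prim c n 1.
pose k n t := I 0 n * bump b n t - I b n * bump 0 n t.
pose K n t := I 0 n * bump_prim b n t - I b n * bump_prim 0 n t.
have I01 c n : 0 <= c -> 0 <= I c n <= 1.
  by move=> c0; rewrite bump_prim_ge0 bump_prim_le// ler01 lexx.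
have sk n : smooth_fun (k n).
  have := smooth_add (smooth_mul (smooth_cst (I 0 n)) (smooth_bump b n))
     (smooth_mul (smooth_cst (- I b n)) (smooth_bump 0 n)).
  by under eq_fun do rewrite mulNr.
have dK n t : is_derive t 1 (K n) (k n t).
  have := is_derive_add
    (is_derive_mul (is_derive_cst (I 0 n) t 1) (is_derive_bump_prim n t b0))
    (is_derive_mul (is_derive_cst (- I b n) t 1) (is_derive_bump_prim n t (lexx 0))).
  rewrite /cst /= !mulr0 !addr0 mulNr -/(k n t).
  by under eq_fun do rewrite mulNr.
have gs (n : nat) : \int[leb]_(x in B) (K n (tau x) / tau x * dotv x (G x)) =
    - N%:R * \int[leb]_(x in B) (k n (tau x) * phi x).
  (* the bump with index 0 is zero, and the interval for the support would be empty *)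
  case: n => [|n].
    have I0 c : 0 <= c -> I c 0%N = 0.
      by move=> c0; rewrite /I bump_prim_left// invr1 lerDr.
    rewrite !Rintegral_eq0 ?mulr0// => x _; rewrite /K /k !I0// !mul0r subrr mul0r//.
    by rewrite mul0r.
  have lt2 : n.+2%:R^-1 < 1 :> R by rewrite invf_lt1// ltr1n.
  apply: (@gauss_smooth _ _ N0 (k n.+1) (K n.+1) (n.+2%:R^-1) (1 - n.+2%:R^-1)) => //.
  - by rewrite subr_gt0.
  - move=> t tn; rewrite /K !bump_prim_left ?mulr0 ?subrr// ?add0r//.
    by rewrite (le_trans tn)// lerDr.
  - by move=> t tn; rewrite /K !(@bump_prim_right _ _ t)// /I mulrC subrr.
have cI c : 0 <= c <= 1 -> I c @ \oo --> 1 - c.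
  move=> /andP[c0 c1]; have := bump_prim_cvg c0 (lexx 1).
  by rewrite max_l// subr_ge0.
have cI0 := cI 0 (introT andP (conj (lexx 0) ler01)).
have cIb := cI b (introT andP (conj b0 (ltW b1))).
rewrite subr0 in cI0.
have mk n : measurable_fun setT (k n).
  by apply: continuous_measurable_fun; exact: smooth_fun_continuous.
have mK n : measurable_fun setT (K n).
  by apply: continuous_measurable_fun => t; exact: is_derive_continuous (dK n t).
have mtau : measurable_fun B (@tau R N) by apply: measurable_funTS; exact: measurable_tau.
have tau01 x : B x -> 0 <= tau x <= 1 by move=> Bx; rewrite tau_ge0 ltW// tau_lt1.
have mLn n : measurable_fun B (fun x => K n (tau x) / tau x * dotv x (G x)).
  apply: measurable_funM; last exact: integrable_measurable idot.
  by apply: measurable_funM; [exact: measurableT_comp|exact: measurable_invr_tau].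
have bLn n x : B x -> `|K n (tau x) / tau x * dotv x (G x)| <= 2 * `|dotv x (G x)|.
  move=> Bx; rewrite normrM ler_wpM2r//; have [->|x0] := eqVneq x 0.
    by rewrite tau0// invr0 mulr0 normr0.
  have t0 : 0 < tau x by rewrite tau_gt0.
  rewrite normrM normfV (gtr0_norm t0) ler_pdivrMr//.
  have a5 := bump_prim_ge0 b n (tau x); have a6 := bump_prim_le n b0 (tau01 x Bx).
  have a7 := bump_prim_ge0 0 n (tau x); have a8 := bump_prim_le n (lexx 0) (tau01 x Bx).
  exact: (normr_cross_le (I01 0 n (lexx 0)) (I01 b n b0)
    (introT andP (conj a5 a6)) (introT andP (conj a7 a8))).
have cL x : B x -> (fun n => K n (tau x) / tau x * dotv x (G x)) @ \oo -->
    ((Num.max (tau x - b) 0 - (1 - b) * tau x) / tau x * dotv x (G x) : R).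
  move=> Bx; apply: cvgM; last exact: cvg_cst.
  apply: cvgM; last exact: cvg_cst.
  have /andP[t0 t1] := tau01 x Bx.
  rewrite -[X in X - _]mul1r; apply: cvgB; apply: cvgM => //; first exact: bump_prim_cvg.
  by have := bump_prim_cvg (lexx 0) t1; rewrite subr0 max_l.
have i2dot : leb.-integrable B (EFin \o (fun x => 2 * `|dotv x (G x)|)).
  have := integrableZl mB 2 (integrable_norm idot).
  by apply: eq_integrable => // x _ /=; rewrite EFinM.
have [_ L1] := Rintegral_dominated_cvg mB mLn cL i2dot bLn.
(* the limit of the divergences, which is the wanted one off the origin *)
pose kl x : R := (b < tau x)%R%:R - (1 - b) * (0 < tau x)%R%:R.
have mRn n : measurable_fun B (fun x => k n (tau x) * phi x).
  apply: measurable_funM; last exact: integrable_measurable iphi.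
  exact: measurableT_comp.
have b01 c n t : 0 <= bump c n t <= 1 by rewrite bump_ge0 mulr_ile1 ?flat1_ge0 ?flat1_le1.
have bRn n x : B x -> `|k n (tau x) * phi x| <= 2 * `|phi x|.
  move=> Bx; rewrite normrM ler_wpM2r// -[leRHS]mulr1.
  have /andP[a5 a6] := b01 b n (tau x); have /andP[a7 a8] := b01 0 n (tau x).
  exact: (normr_cross_le (I01 0 n (lexx 0)) (I01 b n b0)
    (introT andP (conj a5 a6)) (introT andP (conj a7 a8))).
have cR x : B x -> (fun n => k n (tau x) * phi x) @ \oo --> (kl x * phi x : R).
  move=> Bx; apply: cvgM; last exact: cvg_cst.
  have ind c : (\1_`]c, 1[ (tau x) : R) = (c < tau x)%R%:R.
    by rewrite indicE mem_setE in_itv/= tau_lt1// andbT.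
  rewrite /kl -!ind -[X in X - _]mul1r.
  by apply: cvgB; apply: cvgM => //; exact: bump_cvg.
have i2phi : leb.-integrable B (EFin \o (fun x => 2 * `|phi x|)).
  have := integrableZl mB 2 (integrable_norm iphi).
  by apply: eq_integrable => // x _ /=; rewrite EFinM.
have [iR L2] := Rintegral_dominated_cvg mB mRn cR i2phi bRn.
have : (fun n => - N%:R * \int[leb]_(x in B) (k n (tau x) * phi x)) @ \oo -->
    (- N%:R * \int[leb]_(x in B) (kl x * phi x) : R).
  by apply: cvgM => //; exact: cvg_cst.
under eq_fun do rewrite -gs.
move=> L3; rewrite -(cvg_lim _ L1)// (cvg_lim _ L3)//; congr (_ * _).
apply: eq_Rintegral_ae => //.
- exact: integrable_measurable iR.
- apply: measurable_funM; last exact: integrable_measurable iphi.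
  apply: measurable_funB => //.
  exact: measurable_gt_tau.
have : {ae leb, forall x, x <> 0} by exact: ae_neq0.
apply: filterS => x /eqP x0 Bx; congr (_ * _).
by rewrite /kl tau_gt0// x0 mulr1.
Qed.

End gauss_step.

(** * Radial fields with a monotone divergence *)

Section primitive.
Context (R : realType).
Local Notation mu := (@lebesgue_measure R).
Implicit Types (k : R -> R) (s t M : R).

Definition primitive k t : R := \int[mu]_(s in `[0, t]) k s.

Lemma integrable_bounded_itv k M s t (b1 b2 : bool) : measurable_fun setT k ->
  (forall t, `|k t| <= M) ->
  mu.-integrable [set` Interval (BSide b1 s) (BSide b2 t)] (EFin \o k).
Proof.
move=> mk kM; apply: (integrable_bounded (M := M)) => //.
- have h := @lebesgue_measure_itv R (Interval (BSide b1 s) (BSide b2 t)).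
  by rewrite [X in (X < _)%E]h; case: ifPn => // _; rewrite -EFinB ltry.
- exact: measurable_funTS.
Qed.

Lemma primitive_le0 k t : t <= 0 -> primitive k t = 0.
Proof.
rewrite le_eqVlt => /predU1P[->|t0]; first by rewrite /primitive set_itv1 Rintegral_set1.
by rewrite /primitive set_itv_ge ?Rintegral_set0// -leNgt bnd_simp.
Qed.

Lemma primitiveB k M s t : measurable_fun setT k -> (forall t, `|k t| <= M) ->
  0 <= s -> s <= t ->
  primitive k t - primitive k s = \int[mu]_(r in `]s, t]) k r.
Proof.
move=> mk kM s0 st; rewrite /primitive Rintegral_itvB ?bnd_simp//.
exact: integrable_bounded_itv mk kM.
Qed.

Lemma Rintegral_itv_oc_cst s t (c : R) : s <= t ->
  \int[mu]_(r in `]s, t]) c = c * (t - s).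
Proof.
move=> st; rewrite Rintegral_cst//; congr (_ * _).
have h := @lebesgue_measure_itv R (Interval (BRight s) (BRight t)).
rewrite [X in fine X]h /= lte_fin; case: ltP => // ts.
by rewrite (_ : t = s) ?subrr//; apply/eqP; rewrite eq_le ts st.
Qed.

(** Valid on the whole line because the primitive is 0 for negative arguments. *)
Lemma primitive_lipschitz k M s t : measurable_fun setT k ->
  (forall t, `|k t| <= M) -> `|primitive k t - primitive k s| <= M * `|t - s|.
Proof.
move=> mk kM; have M0 : 0 <= M by rewrite (le_trans _ (kM 0)).
have pos a b : 0 <= a -> a <= b -> `|primitive k b - primitive k a| <= M * (b - a).
  move=> a0 ab; rewrite (primitiveB mk kM a0 ab).
  have ik := @integrable_bounded_itv k M a b false false mk kM.
  rewrite (le_trans (le_normr_Rintegral _ ik))// -(Rintegral_itv_oc_cst M ab).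
  apply: le_Rintegral => //; first exact: integrable_norm.
  by apply: (@integrable_bounded_itv _ `|M|) => // r; rewrite normr_id.
have all a b : a <= b -> `|primitive k b - primitive k a| <= M * (b - a).
  move=> ab; have [a0|/ltW a0] := leP 0 a; first exact: pos.
  rewrite (primitive_le0 k a0) -(primitive_le0 k (lexx 0)).
  have [b0|/ltW b0] := leP 0 b.
    by apply: (le_trans (pos 0 b (lexx _) b0)); rewrite subr0 ler_wpM2l// lerBrDl gerDr.
  by rewrite !primitive_le0// subrr normr0 mulr_ge0// subr_ge0.
have [st|/ltW ts] := leP s t; first by rewrite (ger0_norm (_ : 0 <= t - s)) ?subr_ge0// all.
by rewrite distrC (distrC t) (ger0_norm (_ : 0 <= s - t)) ?subr_ge0// all.
Qed.

Lemma primitive_continuous k M : measurable_fun setT k ->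
  (forall t, `|k t| <= M) -> continuous (primitive k).
Proof.
move=> mk kM s; have M0 : 0 <= M by rewrite (le_trans _ (kM 0)).
apply/cvgrPdist_lt => e e0.
have M1 : 0 < M + 1 by rewrite ltr_wpDl.
near=> t; rewrite (le_lt_trans (primitive_lipschitz t s mk kM))//.
have : `|s - t| < e / (M + 1).
  by near: t; apply: cvgr_dist_lt; rewrite ?divr_gt0.
rewrite ltr_pdivlMr// mulrC; apply: le_lt_trans.
by rewrite ler_wpM2r// lerDl.
Unshelve. all: by end_near. Qed.

Lemma primitive_norm k M t : measurable_fun setT k -> (forall t, `|k t| <= M) ->
  0 <= t -> `|primitive k t| <= M * t.
Proof.
move=> mk kM t0; have := primitive_lipschitz 0 t mk kM.
by rewrite (primitive_le0 k (lexx 0)) !subr0 (ger0_norm t0).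
Qed.

Lemma primitiveD k1 k2 M1 M2 t : measurable_fun setT k1 -> measurable_fun setT k2 ->
  (forall t, `|k1 t| <= M1) -> (forall t, `|k2 t| <= M2) ->
  primitive (fun s => k1 s + k2 s) t = primitive k1 t + primitive k2 t.
Proof.
move=> m1 m2 b1 b2; rewrite /primitive RintegralD//.
  exact: integrable_bounded_itv m1 b1.
exact: integrable_bounded_itv m2 b2.
Qed.

Lemma primitiveZ k M c t : measurable_fun setT k -> (forall t, `|k t| <= M) ->
  primitive (fun s => c * k s) t = c * primitive k t.
Proof.
by move=> mk kM; rewrite /primitive RintegralZl//; exact: integrable_bounded_itv mk kM.
Qed.

End primitive.

Section gauss_monotone.
Context (R : realType) (N : nat).
Local Notation V := 'rV[R]_N.
Local Notation leb := (@lebesgue_rV R N).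
Local Notation mu := (@lebesgue_measure R).
Local Notation B := (@B R N).
Implicit Types (x : V) (b t : R) (k : R -> R).
Hypothesis N0 : (0 < N)%N.

Definition omega : R := fine (leb B).

Lemma omega_gt0 : 0 < omega.
Proof.
rewrite /omega fine_gt0// lebesgue_B_gt0/=; exact: lebesgue_B_lty.
Qed.

Lemma integrable_cstB (c : R) : leb.-integrable B (EFin \o (fun=> c)).
Proof.
apply: (integrable_bounded (M := `|c|)) => //; first exact: measurable_B.
exact: lebesgue_B_lty.
Qed.

Lemma weak_gradient_cst (c : R) : weak_gradient (fun=> c : R) (fun=> 0 : V).
Proof.
apply: weak_gradient_C1.
- by move=> x; exact: cst_continuous.
- move=> i; rewrite (_ : (fun=> _) = fun=> 0); last by apply/funext => x; rewrite mxE.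
  by move=> x; exact: cst_continuous.
- by move=> x i; rewrite mxE; exact: is_derive_cst.
Qed.

Lemma integrable_gt_tau b phi : leb.-integrable B (EFin \o phi) ->
  leb.-integrable B (EFin \o (fun x => (b < tau x)%R%:R * phi x)).
Proof.
move=> iphi; apply: (integrable_mul_bounded (M := 1)) => //.
- exact: measurable_B.
- by apply: measurable_gt_tau; exact: measurable_B.
- by move=> x _; case: ltP; rewrite ?normr1 ?normr0.
Qed.

(** The case of no gradient: phi has the same mean on all annuli. *)
Lemma gauss_no_gradient b phi : 0 <= b <= 1 -> weak_gradient phi (fun=> 0 : V) ->
  leb.-integrable B (EFin \o phi) ->
  \int[leb]_(x in B) ((b < tau x)%R%:R * phi x) = (1 - b) * \int[leb]_(x in B) phi x.
Proof.
move=> /andP[b0 b1] wphi iphi; have mB := @measurable_B R N.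
move: b1; rewrite le_eqVlt => /predU1P[->|b1].
  rewrite subrr mul0r Rintegral_eq0// => x Bx.
  by rewrite ltNge (ltW (tau_lt1 N0 Bx))/= mul0r.
have := @gauss_step _ _ N0 phi (fun=> 0) b.
rewrite b0 b1 => /(_ isT wphi iphi).
rewrite Rintegral_eq0 => [|x _]; last by rewrite dotv0r mulr0.
move=> h; have i0 i : leb.-integrable B (EFin \o (fun _ : V => (0 : V) ord0 i)).
  rewrite (_ : (fun=> _) = fun=> 0); first exact: integrable_cstB.
  by apply/funext => x; rewrite mxE.
move/(_ i0)/esym/eqP : h; rewrite mulf_eq0 oppr_eq0 pnatr_eq0 -leqn0 leqNgt N0/=.
under eq_Rintegral do rewrite mulrBl.
rewrite RintegralB//; last 2 first.
- exact: integrable_gt_tau.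
- apply: (integrable_mul_bounded (M := `|1 - b|)) => //.
rewrite RintegralZl// subr_eq0 => /eqP; exact.
Qed.

Lemma Rintegral_gt_tau b : 0 <= b <= 1 ->
  \int[leb]_(x in B) ((b < tau x)%R%:R : R) = (1 - b) * omega.
Proof.
move=> b01; have := gauss_no_gradient b01 (weak_gradient_cst 1) (integrable_cstB 1).
rewrite Rintegral_cst; last exact: measurable_B.
rewrite mul1r => <-; by apply: eq_Rintegral => x _; rewrite mulr1.
Qed.

(** A sphere is contained in annuli of arbitrarily small measure. *)
Lemma ae_tau_neq b : {ae leb, forall x, B x -> tau x <> b}.
Proof.
have mB := @measurable_B R N.
have [b0|b0] := leP b 0.
  apply: filterS (@ae_neq0 R N N0) => x /eqP x0 _ tb.
  by move: b0; rewrite -tb leNgt tau_gt0// x0.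
have [b1|b1] := leP 1 b.
  by apply: aeW => x Bx tb; move: b1; rewrite -tb leNgt tau_lt1.
pose g x : R := (tau x == b)%:R.
have mg : measurable_fun B g.
  apply: measurable_funTS.
  rewrite (_ : g = (\1_([set b] : set R) : R -> R) \o (@tau R N)); last first.
    apply/funext => x /=; rewrite indicE /g; congr (_%:R); congr nat_of_bool.
    by apply/idP/idP => [/eqP h|/set_mem h]; [rewrite inE|apply/eqP].
  by apply: measurableT_comp => //; exact: measurable_tau.
have ig : leb.-integrable B (EFin \o g).
  apply: (integrable_le _ _ _ (integrable_cstB 1)) => // x _.
  by rewrite /g; case: eqP; rewrite ?normr1 ?normr0.
have g0 : \int[leb]_(x in B) g x = 0.
  apply/eqP; rewrite eq_le Rintegral_ge0 ?andbT; last by move=> x _; rewrite /g.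
  apply/ler_addgt0Pr => e e0; rewrite add0r.
  (* annulus below the sphere of relative measure d *)
  pose d := Num.min b (e / omega).
  have d0 : 0 < d by rewrite lt_min b0 divr_gt0// omega_gt0.
  have db : d <= b by rewrite ge_min lexx.
  have i1 c : leb.-integrable B (EFin \o (fun x => (c < tau x)%R%:R : R)).
    by have := integrable_gt_tau c (integrable_cstB 1); under eq_fun do rewrite mulr1.
  apply: (@le_trans _ _ (\int[leb]_(x in B) ((b - d < tau x)%R%:R - (b < tau x)%R%:R))).
    apply: le_Rintegral => //.
      by have := integrableB mB (i1 (b - d)) (i1 b).
    move=> x _; rewrite /g; case: eqP => [->|_].
      by rewrite ltxx subr0 gtrBl d0.
    have [bt|tb] := ltP b (tau x); last by rewrite subr0.
    by rewrite (lt_trans _ bt) ?subrr// gtrBl.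
  rewrite RintegralB// !Rintegral_gt_tau ?(ltW b0) ?(ltW b1)//; last first.
    by rewrite subr_ge0 db/= (le_trans _ (ltW b1))// gerBl ltW.
  rewrite -mulrBl (_ : _ - _ - _ = d); last by ring.
  by rewrite -ler_pdivlMr ?omega_gt0// ge_min lexx orbT.
have := Rintegral_ge0_eq0 mB ig (fun x _ => ler0n _ _) g0.
apply: filterS => x /= h Bx tb; have := h Bx; rewrite /g tb eqxx.
by move/eqP; rewrite oner_eq0.
Qed.

Section defect.
Variables (phi : V -> R) (G : V -> V).
Hypotheses (wG : weak_gradient phi G) (iphi : leb.-integrable B (EFin \o phi)).
Hypothesis iG : forall i, leb.-integrable B (EFin \o (fun x => G x ord0 i)).

(** The difference of the two sides in the divergence theorem for the field that is
    obtained from k after subtracting its mean. *)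
Definition defect_density k x : R :=
  (primitive k (tau x) - primitive k 1 * tau x) / tau x * dotv x (G x) +
  N%:R * ((k (tau x) - primitive k 1) * phi x).

(** The divergence theorem for k is the statement that this vanishes.  As a function of
    k it is linear and bounded in the sup norm. *)
Definition defect k : R := \int[leb]_(x in B) defect_density k x.

Lemma measurable_radial_field k M : measurable_fun setT k -> (forall t, `|k t| <= M) ->
  measurable_fun B (fun x => (primitive k (tau x) - primitive k 1 * tau x) / tau x).
Proof.
move=> mk kM; have mB := @measurable_B R N.
apply: measurable_funM; last exact: measurable_invr_tau.
apply: measurable_funB.
  apply: measurable_funTS; apply: measurableT_comp; last exact: measurable_tau.
  by apply: continuous_measurable_fun; exact: primitive_continuous mk kM.
by apply: measurable_funM => //; apply: measurable_funTS; exact: measurable_tau.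
Qed.

Lemma radial_field_bound k M x : measurable_fun setT k -> (forall t, `|k t| <= M) ->
  `|(primitive k (tau x) - primitive k 1 * tau x) / tau x| <= 2 * M.
Proof.
move=> mk kM; have M0 : 0 <= M by rewrite (le_trans _ (kM 0)).
have [t0|t0] := leP (tau x) 0.
  have -> : tau x = 0 by apply/eqP; rewrite eq_le t0 tau_ge0.
  by rewrite invr0 mulr0 normr0 mulr_ge0.
rewrite normrM normfV (gtr0_norm t0) ler_pdivrMr// (le_trans (ler_normB _ _))//.
rewrite normrM (gtr0_norm t0) (_ : 2 * M * tau x = M * tau x + M * 1 * tau x); last by ring.
rewrite lerD ?(primitive_norm mk kM) ?(ltW t0)// ler_wpM2r ?(ltW t0)//.
exact: primitive_norm mk kM ler01.
Qed.

Lemma defect_density_bound k M x : measurable_fun setT k -> (forall t, `|k t| <= M) ->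
  `|defect_density k x| <= M * (2 * `|dotv x (G x)| + 2 * N%:R * `|phi x|).
Proof.
move=> mk kM; rewrite (le_trans (ler_normD _ _))// mulrDr lerD//.
  by rewrite normrM mulrCA mulrA ler_wpM2r// radial_field_bound.
rewrite 2!normrM (ger0_norm (ler0n _ _)).
rewrite (_ : M * _ = N%:R * (2 * M * `|phi x|)); last by ring.
rewrite ler_wpM2l// ler_wpM2r// (le_trans (ler_normB _ _))//.
rewrite (_ : 2 * M = M + M * 1); last by ring.
by rewrite lerD// (primitive_norm mk kM).
Qed.

Lemma integrable_defect_bound : leb.-integrable B
  (EFin \o (fun x => 2 * `|dotv x (G x)| + 2 * N%:R * `|phi x|)).
Proof.
have mB := @measurable_B R N.
have h1 := integrableZl mB 2 (integrable_norm (integrable_radial_component iG)).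
have h2 := integrableZl mB (2 * N%:R) (integrable_norm iphi).
by have := integrableD mB h1 h2; apply: eq_integrable.
Qed.

Lemma integrable_defect k M : measurable_fun setT k -> (forall t, `|k t| <= M) ->
  leb.-integrable B (EFin \o defect_density k).
Proof.
move=> mk kM; have mB := @measurable_B R N.
have := integrableZl mB M integrable_defect_bound.
move=> h; apply: (integrable_le mB _ (fun x _ => defect_density_bound x mk kM)) => //.
apply: measurable_funD.
  apply: measurable_funM; first exact: measurable_radial_field mk kM.
  exact: integrable_measurable (integrable_radial_component iG).
apply: measurable_funM => //; apply: measurable_funM; last exact: integrable_measurable iphi.
apply: measurable_funB => //; apply: measurable_funTS.
by apply: measurableT_comp => //; exact: measurable_tau.
Qed.

Lemma defectD k1 k2 M1 M2 : measurable_fun setT k1 -> measurable_fun setT k2 ->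
  (forall t, `|k1 t| <= M1) -> (forall t, `|k2 t| <= M2) ->
  defect (fun s => k1 s + k2 s) = defect k1 + defect k2.
Proof.
move=> m1 m2 b1 b2; have mB := @measurable_B R N.
rewrite /defect -RintegralD//; [|exact: integrable_defect m1 b1|exact: integrable_defect m2 b2].
apply: eq_Rintegral => x _; rewrite /defect_density.
by rewrite !(primitiveD _ m1 m2 b1 b2); ring.
Qed.

Lemma defectZ k M c : measurable_fun setT k -> (forall t, `|k t| <= M) ->
  defect (fun s => c * k s) = c * defect k.
Proof.
move=> mk kM; have mB := @measurable_B R N.
rewrite /defect -RintegralZl//; last exact: integrable_defect mk kM.
apply: eq_Rintegral => x _; rewrite /defect_density.
by rewrite !(primitiveZ _ _ mk kM); ring.
Qed.

Lemma defect_bound k M : measurable_fun setT k -> (forall t, `|k t| <= M) ->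
  `|defect k| <= M * \int[leb]_(x in B) (2 * `|dotv x (G x)| + 2 * N%:R * `|phi x|).
Proof.
move=> mk kM; have mB := @measurable_B R N.
have ik := integrable_defect mk kM.
rewrite (le_trans (le_normr_Rintegral mB ik))// -RintegralZl//; last exact: integrable_defect_bound.
apply: le_Rintegral => //.
- exact: integrable_norm.
- by have := integrableZl mB M integrable_defect_bound; apply: eq_integrable.
- by move=> x _; exact: defect_density_bound.
Qed.

End defect.
End gauss_monotone.

Section monotone.
Context (R : realType) (N : nat).
Local Notation V := 'rV[R]_N.
Local Notation leb := (@lebesgue_rV R N).
Local Notation mu := (@lebesgue_measure R).
Local Notation B := (@B R N).
Implicit Types (x : V) (b t : R) (k : R -> R).
Hypothesis N0 : (0 < N)%N.
Variables (phi : V -> R) (G : V -> V).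
Hypotheses (wG : weak_gradient phi G) (iphi : leb.-integrable B (EFin \o phi)).
Hypothesis iG : forall i, leb.-integrable B (EFin \o (fun x => G x ord0 i)).

(** Up to the value at the threshold, an upward closed set is a half-line. *)
Lemma upset_threshold (A : set R) : (forall s t, A s -> s <= t -> A t) ->
  exists b, [/\ 0 <= b <= 1, forall t, b < t -> t < 1 -> A t &
    forall t, 0 <= t -> t < b -> ~ A t].
Proof.
(* 1 is added so that the infimum exists and is at most 1 *)
move=> upA; pose E := [set t | 0 <= t <= 1 /\ (A t \/ t = 1)].
have E1 : E 1 by split; [rewrite ler01 lexx|right].
have lbE : lbound E 0 by move=> t [/andP[]].
have hE : has_inf E by split; [exists 1|exists 0].
exists (inf E); split.
- by rewrite lb_le_inf ?ge_inf//; [exists 0|exists 1].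
- move=> t bt t1; have [s [s01 sA] st] := inf_lt (hE.1) bt.
  case: sA => [As|s1]; first exact: upA As (ltW st).
  by move: st; rewrite s1 ltNge (ltW t1).
- move=> t t0 tb At; move: tb; rewrite ltNge => /negP; apply.
  have [t1|t1] := leP t 1; last by rewrite (le_trans (ge_inf _ E1)) ?(ltW t1)//; exists 0.
  by apply: ge_inf; [exists 0|split; [rewrite t0|left]].
Qed.

Lemma measurable_upset (A : set R) : (forall s t, A s -> s <= t -> A t) -> measurable A.
Proof.
move=> upA; apply: is_interval_measurable => s t As At r /andP[sr rt].
exact: upA As sr.
Qed.

Lemma primitive_upset (A : set R) b t : (forall s t, A s -> s <= t -> A t) ->
  0 <= b <= 1 -> (forall t, b < t -> t < 1 -> A t) ->
  (forall t, 0 <= t -> t < b -> ~ A t) -> 0 <= t <= 1 ->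
  primitive (\1_A : R -> R) t = Num.max (t - b) 0.
Proof.
move=> upA /andP[b0 b1] bA bnA /andP[t0 t1]; have mA := measurable_upset upA.
rewrite /primitive /Rintegral integral_indic//.
have m1 a c : measurable (`[a, c]%classic : set R) by exact: measurable_itv.
have [bt|tb] := ltP b t.
  have h1 : (mu `]b, t[%classic = (t - b)%:E)%E by rewrite lebesgue_measure_itv/= lte_fin bt.
  have h2 : (mu `[b, t]%classic = (t - b)%:E)%E by rewrite lebesgue_measure_itv/= lte_fin bt.
  rewrite max_l ?subr_ge0 ?(ltW bt)// [X in fine X](_ : _ = (t - b)%:E)//.
  apply/eqP; rewrite eq_le; apply/andP; split.
    rewrite -[X in (_ <= X)%E]h2; apply: le_measure; rewrite ?inE//; first exact: measurableI.
    move=> s [As]; rewrite /= !in_itv/= => /andP[s0 ->]; rewrite andbT leNgt.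
    by apply/negP => sb; exact: bnA s0 sb As.
  rewrite -[X in (X <= _)%E]h1; apply: le_measure; rewrite ?inE//; first exact: measurableI.
  move=> s; rewrite /= !in_itv/= => /andP[bs st]; split.
    by apply: bA => //; exact: lt_le_trans t1.
  by rewrite (ltW st) (le_trans b0)// ltW.
rewrite max_r ?subr_le0// [X in fine X](_ : _ = 0%E)//.
apply/eqP; rewrite eq_le measure_ge0 andbT.
have h3 : (mu [set b] = 0)%E by exact: lebesgue_measure_set1.
rewrite -[X in (_ <= X)%E]h3; apply: le_measure; rewrite ?inE//; first exact: measurableI.
move=> s [As]; rewrite /= in_itv/= => /andP[s0 st]; apply/eqP; rewrite eq_le (le_trans st)//=.
by rewrite leNgt; apply/negP => sb; exact: bnA s0 sb As.
Qed.

Lemma indic_norm (A : set R) t : `|\1_A t : R| <= 1.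
Proof. by rewrite indicE ger0_norm// lern1 leq_b1. Qed.

Lemma defect_upset (A : set R) : (forall s t, A s -> s <= t -> A t) ->
  defect phi G (\1_A : R -> R) = 0.
Proof.
move=> upA; have [b [b01 bA bnA]] := upset_threshold upA.
have mA := measurable_upset upA; have mB := @measurable_B R N.
have mI : measurable_fun setT (\1_A : R -> R) by exact: measurable_indic.
have p1 : primitive (\1_A : R -> R) 1 = 1 - b.
  rewrite (primitive_upset upA b01 bA bnA) ?ler01 ?lexx// max_l// subr_ge0.
  by case/andP: b01.
have idot := integrable_radial_component iG.
have gs : \int[leb]_(x in B)
     ((Num.max (tau x - b) 0 - (1 - b) * tau x) / tau x * dotv x (G x)) =
  - N%:R * \int[leb]_(x in B) (((b < tau x)%R%:R - (1 - b)) * phi x).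
  move: (b01) => /andP[b0]; rewrite le_eqVlt => /predU1P[->|b1].
    rewrite !Rintegral_eq0 ?mulr0// => x Bx; rewrite subrr.
      by rewrite ltNge (ltW (tau_lt1 N0 Bx)) subrr mul0r.
    by rewrite max_r ?subr_le0 ?(ltW (tau_lt1 N0 Bx))// mul0r subrr !mul0r.
  by apply: gauss_step => //; rewrite b0.
have i1 : leb.-integrable B (EFin \o (fun x =>
    (Num.max (tau x - b) 0 - (1 - b) * tau x) / tau x * dotv x (G x))).
  apply: (eq_integrable mB (EFin \o (fun x => (primitive (\1_A : R -> R) (tau x) -
      primitive (\1_A : R -> R) 1 * tau x) / tau x * dotv x (G x)))).
    move=> x /set_mem Bx /=; rewrite p1 (primitive_upset upA b01 bA bnA)//.
    by rewrite tau_ge0 (ltW (tau_lt1 N0 Bx)).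
  apply: (integrable_mul_bounded (M := 2 * 1)) => //.
    exact: measurable_radial_field mI (@indic_norm A).
  by move=> x _; exact: radial_field_bound mI (@indic_norm A).
have i2 : leb.-integrable B (EFin \o (fun x => ((b < tau x)%R%:R - (1 - b)) * phi x)).
  apply: (integrable_mul_bounded (M := 2)) => //.
    by apply: measurable_funB => //; exact: measurable_gt_tau.
  move=> x _; move: b01 => /andP[b0 b1]; rewrite ler_norml.
  by case: ltP => _ /=; apply/andP; split; lra.
have : \int[leb]_(x in B)
     ((Num.max (tau x - b) 0 - (1 - b) * tau x) / tau x * dotv x (G x) +
       N%:R * (((b < tau x)%R%:R - (1 - b)) * phi x)) = 0.
  rewrite RintegralD//; last by have := integrableZl mB N%:R i2; apply: eq_integrable.
  by rewrite RintegralZl// gs mulNr addNr.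
move=> <-; rewrite /defect; apply: eq_Rintegral_ae => //.
- exact/integrable_measurable/(integrable_defect iphi iG mI (@indic_norm A)).
- apply: measurable_funD; first exact: integrable_measurable i1.
  by apply: measurable_funM => //; exact: integrable_measurable i2.
have := @ae_tau_neq R N N0 b; apply: filterS2 (@ae_neq0 R N N0) => x /eqP x0 tb Bx.
rewrite /defect_density p1 (primitive_upset upA b01 bA bnA); last first.
  by rewrite tau_ge0 (ltW (tau_lt1 N0 Bx)).
congr (_ + _ * ((_ - _) * _)); rewrite indicE; congr (_%:R); congr nat_of_bool.
have := tb Bx; have [bt _|tb' _|->//] := ltgtP b (tau x).
  by rewrite mem_set//; apply: bA => //; exact: tau_lt1.
by rewrite memNset//; apply: bnA => //; exact: tau_ge0.
Qed.

Lemma defect_steps (k : R -> R) (n : nat) (c : R) : {homo k : s t / s <= t} ->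
  [/\ measurable_fun setT (fun t => c * \sum_(i < n) (\1_[set s | i.+1%:R <= k s] t : R)),
     (forall t, `|c * \sum_(i < n) (\1_[set s | i.+1%:R <= k s] t : R)| <= `|c| * n%:R) &
     defect phi G (fun t => c * \sum_(i < n) (\1_[set s | i.+1%:R <= k s] t : R)) = 0].
Proof.
move=> hk; pose A i := [set s | i.+1%:R <= k s].
have upA i s t : A i s -> s <= t -> A i t by move=> h st; exact: le_trans h (hk _ _ st).
have [m1 m2 m3] : [/\ measurable_fun setT (fun t => \sum_(i < n) (\1_(A i) t : R)),
     (forall t, `|\sum_(i < n) (\1_(A i) t : R)| <= n%:R) &
     defect phi G (fun t => \sum_(i < n) (\1_(A i) t : R)) = 0].
  elim: n => [|n [h1 h2 h3]].
    split.
    - rewrite (_ : (fun t => _) = cst 0); first exact: measurable_cst.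
      by apply/funext => t; rewrite big_ord0.
    - by move=> t; rewrite big_ord0 normr0.
    - have -> : (fun t => \sum_(i < 0) (\1_(A i) t : R)) = fun t => 0 * \1_(A 0) t.
        by apply/funext => t; rewrite big_ord0 mul0r.
      rewrite (defectZ iphi iG 0 _ (@indic_norm (A 0)))  ?mul0r//.
      by apply: measurable_indic; exact: measurable_upset (upA 0%N).
  have mAn : measurable_fun setT (\1_(A n) : R -> R).
    by apply: measurable_indic; exact: measurable_upset (upA n).
  split.
  - by under eq_fun do rewrite big_ord_recr; exact: measurable_funD.
  - move=> t; rewrite big_ord_recr/= (le_trans (ler_normD _ _))// -natr1 lerD//.
    exact: indic_norm.
  - have -> : (fun t => \sum_(i < n.+1) (\1_(A i) t : R)) =
        (fun t => \sum_(i < n) (\1_(A i) t : R) + \1_(A n) t).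
      by apply/funext => t; rewrite big_ord_recr.
    by rewrite (defectD iphi iG h1 mAn h2 (@indic_norm (A n))) h3 defect_upset ?addr0//; exact: upA.
split.
- exact: measurable_funM.
- by move=> t; rewrite normrM ler_wpM2l.
- by rewrite (defectZ iphi iG c m1 m2) m3 mulr0.
Qed.

(** Counting the levels below y gives its integer part. *)
Lemma step_approximation (y : R) (n : nat) : 0 <= y <= n%:R ->
  0 <= y - \sum_(i < n) ((i.+1%:R <= y)%R%:R : R) <= 1.
Proof.
move=> /andP[y0 yn]; have := truncn_itv y0 => /andP[h1 h2].
have -> : \sum_(i < n) ((i.+1%:R <= y)%R%:R : R) = (Num.truncn y)%:R.
  have tn : (Num.truncn y <= n)%N.
    by rewrite -(ler_nat R) (le_trans h1).
  rewrite (eq_bigr (fun i : 'I_n => ((i < Num.truncn y)%N%:R : R))); last first.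
    move=> i _; congr (_%:R); congr nat_of_bool; apply/idP/idP => h.
      by rewrite -ltnS -(ltr_nat R) (le_lt_trans h).
    by rewrite (le_trans _ h1)// ler_nat.
  rewrite -natr_sum; congr (_%:R).
  rewrite -(big_mkord xpredT (fun i => (i < Num.truncn y)%N : nat)).
  set T := Num.truncn y in tn *.
  have S1 : (\sum_(0 <= i < T) (i < T)%N = T)%N.
    transitivity (\sum_(0 <= i < T) 1)%N; last by rewrite sum_nat_const_nat muln1 subn0.
    by apply: eq_big_nat => i /andP[_ ->].
  have S2 : (\sum_(T <= i < n) (i < T)%N = 0)%N.
    by rewrite big_nat big1// => i /andP[h _]; rewrite ltnNge h.
  by rewrite (big_cat_nat _ tn)//= S1 S2 addn0.
by rewrite subr_ge0 h1 lerBlDl natr1 ltW.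
Qed.

(** A bounded nondecreasing k is within c of a sum of c times indicators of upward closed
    sets, and the defect is bounded by the sup norm. *)
Lemma gauss_monotone (k : R -> R) (M : R) : {homo k : s t / s <= t} ->
  (forall t, 0 <= k t <= M) -> defect phi G k = 0.
Proof.
move=> hk kM; have M0 : 0 <= M by have /andP[h1 h2] := kM 0; exact: le_trans h1 h2.
have mk : measurable_fun setT k by exact: nondecreasing_measurable.
have kn t : `|k t| <= M by have /andP[h1 h2] := kM t; rewrite ger0_norm.
set C := \int[leb]_(x in B) (2 * `|dotv x (G x)| + 2 * N%:R * `|phi x|).
have C0 : 0 <= C.
  by apply: Rintegral_ge0 => x _; rewrite addr_ge0// mulr_ge0// mulr_ge0.
suff H (n : nat) : `|defect phi G k| <= (M + 1) / n.+1%:R * C.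
  apply/eqP; rewrite -normr_le0; apply/ler_addgt0Pr => e e0; rewrite add0r.
  have D0 : 0 <= (M + 1) * C by rewrite mulr_ge0// addr_ge0.
  have := archi_boundP (divr_ge0 D0 (ltW e0)); set n := Num.bound _ => hn.
  rewrite (le_trans (H n))// mulrAC ler_pdivrMr// -ler_pdivrMl// [X in X <= _]mulrC.
  by rewrite (le_trans (ltW hn))// ler_nat.
(* M + 1 instead of M keeps the height of the steps positive *)
pose c : R := (M + 1) / n.+1%:R.
have c0 : 0 < c by rewrite divr_gt0// ltr_wpDl.
pose k' t := k t / c.
have hk' : {homo k' : s t / s <= t}.
  by move=> s t st; rewrite /k' ler_wpM2r ?invr_ge0 ?(ltW c0)// hk.
have [s1 s2 s3] := defect_steps n.+1 c hk'.
set s := (fun t => c * _) in s1 s2 s3.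
have app t : `|k t + -1 * s t| <= c.
  have : 0 <= k' t <= n.+1%:R.
    have /andP[h1 h2] := kM t; rewrite /k' divr_ge0 ?(ltW c0)//= ler_pdivrMr// /c.
    by rewrite mulrC divfK ?pnatr_eq0// (le_trans h2)// lerDl.
  move=> /step_approximation; set S := \sum_(i < _) _ => /andP[h1 h2].
  have sE : s t = c * S.
    rewrite /s; congr (_ * _); apply: eq_bigr => i _; rewrite indicE; congr (_%:R); congr nat_of_bool.
    by apply/idP/idP => [/set_mem//|h]; rewrite inE.
  have kE : k t = c * k' t by rewrite /k' mulrC divfK// gt_eqF.
  rewrite sE kE mulN1r -mulrBr ger0_norm; last by apply: mulr_ge0 => //; exact: ltW.
  by rewrite ger_pMr.
have ms : measurable_fun setT (fun t => k t + -1 * s t).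
  by apply: measurable_funD => //; exact: measurable_funM.
have bs t : `|-1 * s t| <= `|c| * n.+1%:R by rewrite mulN1r normrN; exact: s2.
have := defect_bound iphi iG ms app.
rewrite (defectD iphi iG mk _ kn bs); last exact: measurable_funM.
by rewrite (defectZ iphi iG _ s1 s2) s3 mulr0 addr0.
Qed.

End monotone.

(** * Weak gradients of radial functions *)

Section radial_C1.
Context (R : realType) (N : nat).
Local Notation V := 'rV[R]_N.
Local Notation mu := (@lebesgue_measure R).
Implicit Types (x : V) (h : R -> R).

Definition radial_grad h x : V := (h (enorm x) / enorm x) *: x.

Lemma enorm_continuous : continuous (@enorm R N).
Proof.
move=> x; apply: (@continuous_comp _ _ _ (fun x : V => dotv x x) (@Num.sqrt R)).
  exact: dotv_continuous.
exact: sqrt_continuous.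
Qed.

Lemma measurable_enorm : measurable_fun setT (@enorm R N).
Proof. by apply: continuous_rV_measurable; exact: enorm_continuous. Qed.

Lemma enorm0 : enorm (0 : V) = 0.
Proof. by apply/eqP; rewrite enorm_eq0. Qed.

Lemma enormZ (a : R) x : enorm (a *: x) = `|a| * enorm x.
Proof.
rewrite /enorm (_ : dotv _ _ = a ^+ 2 * dotv x x).
  by rewrite sqrtrM ?sqr_ge0// sqrtr_sqr.
rewrite /dotv mulr_sumr; apply: eq_bigr => i _; rewrite !mxE; ring.
Qed.

Lemma enorm_delta (i : 'I_N) : enorm (delta_mx ord0 i : V) = 1.
Proof.
rewrite /enorm /dotv (bigD1 i)//= mxE !eqxx mulr1 big1 ?addr0 ?sqrtr1//.
by move=> j ji; rewrite mxE (negbTE ji) andbF mulr0.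
Qed.

Lemma radial_gradE h x i : radial_grad h x ord0 i = h (enorm x) / enorm x * x ord0 i.
Proof. by rewrite mxE. Qed.

Lemma radial_grad_coord_le h x i : `|radial_grad h x ord0 i| <= `|h (enorm x)|.
Proof.
rewrite radial_gradE; have [->|x0] := eqVneq x 0; first by rewrite mxE mulr0 normr0.
have e0 : 0 < enorm x by rewrite enorm_gt0.
rewrite !normrM normfV (gtr0_norm e0) -mulrA ler_piMr//.
by rewrite mulrC ler_pdivrMr// mul1r coord_le_enorm.
Qed.

Lemma radial_grad_dot h x : x != 0 -> dotv (radial_grad h x) (radial_grad h x) = h (enorm x) ^+ 2.
Proof.
move=> x0; have e0 : 0 < enorm x by rewrite enorm_gt0.
rewrite /dotv; under eq_bigr do rewrite radial_gradE.
transitivity ((h (enorm x) / enorm x) ^+ 2 * dotv x x).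
  by rewrite /dotv mulr_sumr; apply: eq_bigr => i _; ring.
by rewrite -enorm_sqr; field; exact: lt0r_neq0.
Qed.

Lemma enorm_radial_grad h x : x != 0 -> enorm (radial_grad h x) = `|h (enorm x)|.
Proof. by move=> x0; rewrite /enorm radial_grad_dot// sqrtr_sqr. Qed.

Lemma is_derive_primitive h M (r : R) : continuous h -> (forall t, `|h t| <= M) -> 0 < r ->
  is_derive r 1 (primitive h) (h r).
Proof.
move=> ch hM r0; have rr : r < r + 1 by rewrite ltrDl.
have mh : measurable_fun setT h by exact: continuous_measurable_fun.
have ih := @integrable_bounded_itv R h M 0 (r + 1) true false mh hM.
have [h1 h2] := continuous_FTC1_closed rr ih r0 (ch r).
by split; [exact: h1|rewrite -derive1E; exact: h2].
Qed.

(** Makes the composition with the norm differentiable at the origin, with derivative 0. *)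
Lemma primitive_small h M (e : R) : continuous h -> (forall t, `|h t| <= M) -> h 0 = 0 ->
  0 < e -> exists2 d, 0 < d & forall s, 0 <= s -> s < d -> `|primitive h s| <= e * s.
Proof.
move=> ch hM h0 e0.
have mh : measurable_fun setT h by exact: continuous_measurable_fun.
have := ch 0; rewrite /continuous_at h0 => /cvgr0Pnorm_lt /(_ e e0).
move=> /nbhs_ballP[d /= d0 hd]; exists d => // s s0 sd.
have ih (t : R) := @integrable_bounded_itv R h M 0 t true false mh hM.
rewrite (le_trans (le_normr_Rintegral _ (ih s)))//.
apply: (@le_trans _ _ (\int[mu]_(t in `[0, s]) e)).
  apply: le_Rintegral => //; first exact: integrable_norm.
    exact: (@integrable_bounded_itv R (fun=> e) `|e|).
  move=> t; rewrite /= in_itv/= => /andP[t0 ts]; apply/ltW/hd.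
  by rewrite /ball /= sub0r normrN ger0_norm// (le_lt_trans ts).
rewrite Rintegral_cst// (_ : fine _ = s)//.
have H := @lebesgue_measure_itv R (Interval (BLeft 0) (BRight s)).
rewrite [X in fine X]H /= lte_fin; case: ltP => //= s0'; first by rewrite subr0.
by apply/eqP; rewrite eq_le s0 s0'.
Qed.

(** The function is continuously differentiable, also at the origin because h(0) = 0. *)
Lemma weak_gradient_radial h M (c : R) : continuous h -> (forall t, `|h t| <= M) ->
  h 0 = 0 -> weak_gradient (fun x : V => c + primitive h (enorm x)) (radial_grad h).
Proof.
move=> ch hM h0; have M0 : 0 <= M by rewrite (le_trans _ (hM 0)).
have mh : measurable_fun setT h by exact: continuous_measurable_fun.
have cp := primitive_continuous mh hM.
apply: weak_gradient_C1.
- move=> x; apply: (@cvgD _ _ _ (nbhs x)); first exact: cvg_cst.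
  apply: (@continuous_comp _ _ _ (@enorm R N) (primitive h)); first exact: enorm_continuous.
  exact: cp.
- move=> i x; have [->|x0] := eqVneq x 0.
    rewrite /continuous_at radial_gradE mxE mulr0.
    apply/(cvgr0Pnorm_lt (F := nbhs (0 : V))) => e e0.
    have : \forall y \near (0 : V), `|h (enorm y)| < e.
      have : {for (0 : V), continuous (h \o (@enorm R N))}.
        by apply: continuous_comp; [exact: enorm_continuous|exact: ch].
      move=> H; have H2 : h (enorm y) @[y --> (0 : V)] --> h (enorm (0 : V)) by exact: H.
      rewrite enorm0 h0 in H2.
      by move/(cvgr0Pnorm_lt (F := nbhs (0 : V))) : H2 => /(_ e e0).
    by apply: filterS => y; apply: le_lt_trans; exact: radial_grad_coord_le.
  rewrite (_ : (fun x : V => _) = fun x => h (enorm x) * (enorm x)^-1 * x ord0 i); last first.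
    by apply/funext => y; rewrite radial_gradE.
  apply: (@cvgM _ _ (nbhs x)); last exact: coord_continuous_rV.
  apply: (@cvgM _ _ (nbhs x)).
    by apply: (@continuous_comp _ _ _ (@enorm R N) h); [exact: enorm_continuous|exact: ch].
  apply: cvgV; last exact: enorm_continuous.
  by rewrite enorm_eq0.
- move=> x i; have [->|x0] := eqVneq x 0.
    rewrite radial_gradE mxE mulr0; apply/is_derive_line0.
    have -> : (fun s : R => c + primitive h (enorm (s *: delta_mx ord0 i + (0 : V)))) =
        (fun s : R => c + primitive h `|s|).
      by apply/funext => s; rewrite addr0 enormZ enorm_delta mulr1.
    have c0 : (fun r : R => r^-1 *: (((fun s : R => c + primitive h `|s|) \o shift 0)
         (r *: (1 : R)) - (c + primitive h `|0 : R|))) @ 0^' --> (0 : R).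
      apply/cvgr0Pnorm_lt => e e0.
      have [d d0 hd] := primitive_small ch hM h0 (divr_gt0 e0 (ltr0n R 2)).
      have H : \forall r \near (0 : R), `|r| < d by apply: nbhs0_lt.
      near=> r.
      have rn0 : r != 0 by near: r; exact: nbhs_dnbhs_neq.
      have rd : `|r| < d by near: r; exact: nbhs_dnbhs.
      rewrite /= addr0 normr0 (primitive_le0 h (lexx 0)) addr0 addrAC subrr add0r.
      rewrite /GRing.scale/= mulr1 normrM normfV ltr_pdivrMl ?normr_gt0//.
      rewrite (le_lt_trans (hd _ _ rd))// mulrC ltr_pM2l ?normr_gt0//.
      by rewrite ltr_pdivrMr// ltr_pMr// ltr1n.
    split; last exact: cvg_lim c0.
    by apply/cvg_ex; exists 0.
  have e0 : 0 < enorm x by rewrite enorm_gt0.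
  have de : is_derive x (delta_mx ord0 i) (@enorm R N) (x ord0 i / enorm x).
    have d0 : 0 < dotv x x by rewrite dotv_gt0.
    have H := is_derive_comp (h := @Num.sqrt R)
      (f := fun y : V => dotv y y) (is_derive1_sqrt d0) (is_derive_dotv x i).
    apply: (is_derive_val_eq H).
    by rewrite -/(enorm x); field; exact: lt0r_neq0.
  apply: (is_derive_val_eq (is_derive_add (is_derive_cst c x (delta_mx ord0 i))
     (is_derive_comp (is_derive_primitive ch hM e0) de))).
  by rewrite add0r radial_gradE mulrA mulrAC.
Unshelve. all: by end_near. Qed.

End radial_C1.

(** * Sobolev functions on the ball *)

Section sobolev.
Context (R : realType) (N : nat).
Local Notation V := 'rV[R]_N.
Local Notation leb := (@lebesgue_rV R N).
Local Notation B := (@B R N).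
Implicit Types (x : V) (f u : V -> R) (m : R).
Hypothesis N0 : (0 < N)%N.

Lemma LB_norm_powR m f : m != 0 ->
  LB_norm m f = ((\int[leb]_(x in B) (`|f x| `^ m)%:E) `^ m^-1)%E.
Proof.
move=> m0; rewrite /LB_norm unlock; congr (_ `^ _)%E.
rewrite [RHS]integral_mkcond; apply: eq_integral => x _.
by rewrite /= !patchE; case: ifPn => _ //=; rewrite /= ?normr0 ?powR0.
Qed.

Lemma measurable_norm_powR (D : set V) f m : measurable_fun D f ->
  measurable_fun D (fun x => `|f x| `^ m).
Proof.
move=> mf; apply: (@measurableT_comp _ _ _ _ _ _ (fun y : R => y `^ m)) => //.
exact: measurableT_comp.
Qed.

Lemma LBP m f : 0 < m -> LB m f <->
  measurable_fun B f /\ leb.-integrable B (EFin \o (fun x => `|f x| `^ m)).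
Proof.
move=> m0; have mB := @measurable_B R N; have mn : m != 0 by rewrite gt_eqF.
have normE : finite_norm leb m%:E (f \_ B) <-> (\int[leb]_(x in B) (`|f x| `^ m)%:E < +oo)%E.
  rewrite /finite_norm -/(LB_norm m f) LB_norm_powR//; split.
    by apply: lty_poweRy; rewrite invr_neq0.
  exact: poweR_lty.
have ip : measurable_fun B f -> ((\int[leb]_(x in B) (`|f x| `^ m)%:E < +oo)%E <->
    leb.-integrable B (EFin \o (fun x => `|f x| `^ m))).
  move=> mf; have mp := measurable_norm_powR m mf.
  split=> [h|/integrableP[_]].
    apply/integrableP; split; first exact/measurable_EFinP.
    by under eq_integral do rewrite /= ger0_norm ?powR_ge0//.
  by under eq_integral do rewrite /= ger0_norm ?powR_ge0//.
have mE : (f \_ B \in mfun) <-> measurable_fun B f.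
  rewrite inE; split => h; first by apply/(measurable_restrictT _ mB).
  by apply/(measurable_restrictT _ mB).
split=> [/andP[h1 h2]|[h1 h2]].
  have mf := mE.1 h1; split => //; apply/(ip mf)/normE.
  by move: h2; rewrite inE.
apply/andP; split; first exact/mE.
by rewrite inE; apply/normE/(ip h1).
Qed.

Lemma powR_le1D (m : R) (a : R) : 1 <= m -> 0 <= a -> a <= 1 + a `^ m.
Proof.
move=> m1 a0; have [a1|a1] := leP a 1; first by rewrite (le_trans a1)// lerDl powR_ge0.
by rewrite (@le_trans _ _ (a `^ m)) ?lerDr// le1r_powR// ltW.
Qed.

Lemma LB_integrable m f : 1 <= m -> LB m f -> leb.-integrable B (EFin \o f).
Proof.
move=> m1 /(LBP f (lt_le_trans ltr01 m1))[mf fi]; have mB := @measurable_B R N.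
have := integrableD mB (@integrable_cstB R N 1) fi.
move=> h; apply: (integrable_le mB mf (g := fun x => 1 + `|f x| `^ m)) => //.
by move=> x _; exact: powR_le1D.
Qed.

Lemma LB_bounded m f M : 0 < m -> measurable_fun B f -> (forall x, B x -> `|f x| <= M) ->
  LB m f.
Proof.
move=> m0 mf fM; apply/LBP => //; split => //.
apply: (integrable_bounded (M := M `^ m) (@measurable_B R N) (@lebesgue_B_lty R N)).
  exact: measurable_norm_powR.
move=> x Bx; rewrite ger0_norm ?powR_ge0//.
have h := fM x Bx; apply: ge0_ler_powR; rewrite ?nnegrE ?(ltW m0)//.
exact: le_trans h.
Qed.

(** The ball is a countable union of compact balls. *)
Lemma locally_integrable_measurable f : locally_integrable_B f -> measurable_fun B f.
Proof.
move=> lf; pose D (k : nat) : set V := [set x | dotv x x <= 1 - k.+2%:R^-1].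
have -> : B = \bigcup_k D k.
  apply/seteqP; split => [x|x [k _]]; rewrite unit_ballE /D /=.
    move=> x1; have d0 : 0 < 1 - dotv x x by rewrite subr_gt0.
    have [k _ hk] := near_infty_natSinv_lt (PosNum d0); exists k => //=.
    rewrite ltW// ltrBrDl addrC -ltrBrDl; apply: lt_trans (hk k (leqnn k)).
    by rewrite ltf_pV2 ?posrE// ltr_nat.
  by move=> h; rewrite (le_lt_trans h)// gtrBl.
apply/measurable_fun_bigcup => k.
  by apply: measurable_rV_compact; exact: compact_ball.
apply: (@integrable_measurable _ _ _ leb); apply: lf; first exact: compact_ball.
by move=> x /= h; rewrite unit_ballE /= (le_lt_trans h)// gtrBl.
Qed.

Lemma wgrad_weak_gradient u G : weak_gradient u G -> weak_gradient u (wgrad u).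
Proof. by move=> h; exact: xgetI h. Qed.

Lemma wgrad_ae u G : weak_gradient u G -> {ae leb, forall x, B x -> wgrad u x = G x}.
Proof. by move=> h; exact: (weak_gradient_unique N0 (wgrad_weak_gradient h) h). Qed.

Lemma measurable_wgrad u G i : weak_gradient u G -> measurable_fun B (fun x => wgrad u x ord0 i).
Proof.
by move=> /wgrad_weak_gradient[_ h _]; apply: locally_integrable_measurable; exact: h.
Qed.

(** By uniqueness the chosen weak gradient agrees almost everywhere with the bounded one. *)
Lemma W1_bounded m u G M : 0 < m -> weak_gradient u G ->
  (forall x, B x -> `|u x| <= M) -> (forall x i, B x -> `|G x ord0 i| <= M) -> W1 m u.
Proof.
move=> m0 wG uM GM; have mB := @measurable_B R N; split.
- apply: LB_bounded uM => //.
  by case: (wG) => lu _ _; exact: locally_integrable_measurable.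
- by exists G.
- move=> i; apply/LBP => //; have mw := measurable_wgrad i wG.
  split => //.
  have mG : measurable_fun B (fun x => G x ord0 i).
    by case: (wG) => _ lG _; apply: locally_integrable_measurable; exact: lG.
  have /(LBP _ m0)[_ h] := LB_bounded m0 mG (fun x => GM x i).
  move/integrableP : h => [_ h]; apply/integrableP; split.
    by apply/measurable_EFinP; exact: measurable_norm_powR.
  have E : (\int[leb]_(x in B) `|(EFin \o (fun x => (`|wgrad u x ord0 i| `^ m)%R)) x| =
      \int[leb]_(x in B) `|(EFin \o (fun x => (`|G x ord0 i| `^ m)%R)) x|)%E; last by rewrite E.
  apply: ae_eq_integral => //.
  - by do 2 apply: measurableT_comp => //; exact: measurable_norm_powR.
  - by do 2 apply: measurableT_comp => //; exact: measurable_norm_powR.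
  - by apply: filterS (wgrad_ae wG) => x /= h' Bx; rewrite h'.
Qed.

Lemma W1_integrable m u : 1 <= m -> W1 m u ->
  [/\ weak_gradient u (wgrad u), leb.-integrable B (EFin \o u) &
     forall i, leb.-integrable B (EFin \o (fun x => wgrad u x ord0 i))].
Proof.
move=> m1 [Lu [G wG] Lw]; split; first exact: wgrad_weak_gradient wG.
- exact: LB_integrable Lu.
- by move=> i; exact: LB_integrable (Lw i).
Qed.

End sobolev.

(** * The source, its flux and the slope *)

Section powR_limits.
Context (R : realType).

Lemma powR_invK (m A : R) : 0 <= A -> m != 0 -> (A `^ m) `^ m^-1 = A.
Proof. by move=> A0 m0; rewrite -powRrM divff ?powRr1. Qed.

(** At a limit a = 0 the exponents stay above b/2 > 0, so the powers are small;
    elsewhere this is the continuity of exp and ln. *)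
Lemma powR_cvg (T : Type) (F : set_system T) (f g : T -> R) (a b : R) : ProperFilter F ->
  (forall t, 0 <= f t) -> 0 < b -> f @ F --> a -> g @ F --> b ->
  (fun t => f t `^ g t) @ F --> a `^ b.
Proof.
move=> FF f0 b0 fa gb.
have a0 : 0 <= a.
  rewrite leNgt; apply/negP => a0; move/cvgr_lt : (fa) => /(_ _ a0) /filter_ex[t].
  by rewrite ltNge f0.
move: a0; rewrite le_eqVlt => /predU1P[a0|a0]; last first.
  have H : (fun t => expR (g t * ln (f t))) @ F --> expR (b * ln a).
    have H1 : (fun t => ln (f t)) @ F --> ln a.
      by apply: (cvg_comp _ _ fa); exact: continuous_ln.
    by apply: (cvg_comp _ _ (cvgM gb H1)); exact: continuous_expR.
  have -> : a `^ b = expR (b * ln a) by rewrite /powR gt_eqF.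
  apply: cvg_trans H; apply: near_eq_cvg.
  have : \forall t \near F, 0 < f t by move/cvgr_gt : fa; exact.
  by apply: filterS => t ft; rewrite /powR gt_eqF.
rewrite -a0 powR0 ?gt_eqF//; apply/cvgr0Pnorm_lt => e e0.
(* f < 1 and g > b/2 give f^g <= f^(b/2) < e *)
have b2 : 0 < b / 2 by rewrite divr_gt0.
have d0 : 0 < Num.min 1 (e `^ (b / 2)^-1) by rewrite lt_min ltr01 powR_gt0.
have H1 : \forall t \near F, f t < Num.min 1 (e `^ (b / 2)^-1).
  by move/cvgr_lt : fa; apply; rewrite -a0.
have H2 : \forall t \near F, b / 2 < g t.
  by move/cvgr_gt : gb; apply; rewrite ltr_pdivrMr// ltr_pMr// ltr1n.
apply: filterS2 H1 H2 => t; rewrite lt_min => /andP[f1 fe] gt.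
rewrite ger0_norm ?powR_ge0//.
have := f0 t; rewrite le_eqVlt => /predU1P[<-|ft].
  by rewrite powR0// gt_eqF// (lt_trans b2).
apply: (@le_lt_trans _ _ (f t `^ (b / 2))).
  by apply: ger_powR; [rewrite ft ltW|exact: ltW].
rewrite [ltRHS](_ : e = (e `^ (b / 2)^-1) `^ (b / 2)); last first.
  by rewrite -powRrM mulVf ?powRr1 ?gt_eqF// ltW.
by rewrite gt0_ltr_powR// nnegrE ?powR_ge0// ltW.
Qed.

End powR_limits.

Section flux.
Context (R : realType) (N : nat).
Local Notation mu := (@lebesgue_measure R).
Implicit Types (t r s : R) (U K : R -> R).
Hypothesis N0 : (0 < N)%N.

(** The right-hand side u^(q-1) - u^(m-1) of the equation, with the opposite sign. *)
Definition source (m q : R) U t : R := U t `^ (m - 1) - U t `^ (q - 1).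

Definition clamp01 r : R := Num.min (Num.max r 0) 1.

(** The slope h that solves h(r)^(m-1) = K(r^N) / (N r^(N-1)) on [0, 1].  Clamping
    the argument extends it continuously by constants. *)
Definition slope (m : R) K r : R :=
  (K (clamp01 r ^+ N) / (N%:R * clamp01 r ^+ N.-1)) `^ (m - 1)^-1.

Lemma clamp01_itv r : 0 <= clamp01 r <= 1.
Proof. by rewrite /clamp01 le_min le_max lexx orbT ler01 ge_min lexx orbT. Qed.

Lemma clamp01_id r : 0 <= r <= 1 -> clamp01 r = r.
Proof. by move=> /andP[r0 r1]; rewrite /clamp01 max_l// min_l. Qed.

Lemma clamp01_le0 r : r <= 0 -> clamp01 r = 0.
Proof. by move=> r0; rewrite /clamp01 max_r// min_l. Qed.

Lemma clamp01_ge1 r : 1 <= r -> clamp01 r = 1.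
Proof. by move=> r1; rewrite /clamp01 max_l ?min_r// (le_trans ler01). Qed.

Lemma clamp01_homo : {homo clamp01 : s t / s <= t}.
Proof.
move=> s t st; rewrite /clamp01 le_min !ge_min lexx orbT andbT.
by apply/orP; left; rewrite ge_max !le_max st lexx orbT.
Qed.

Lemma clamp01_lipschitz s t : `|clamp01 s - clamp01 t| <= `|s - t|.
Proof.
wlog st : s t / s <= t.
  by move=> H; have [/H//|/ltW/H] := leP s t; rewrite distrC (distrC t).
have h := clamp01_homo st; rewrite distrC (distrC s) !ger0_norm ?subr_ge0//.
have [s0|s0] := leP s 0; have [t0|t0] := leP t 0.
- by rewrite !clamp01_le0// subrr subr_ge0.
- rewrite (clamp01_le0 s0) subr0 (@le_trans _ _ t) ?lerDl ?oppr_ge0//.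
  by rewrite /clamp01 max_l ?(ltW t0)// ge_min lexx.
- by move: (le_lt_trans t0 s0); rewrite ltNge st.
- have [t1|t1] := leP t 1.
    by rewrite !clamp01_id// ?(ltW s0) ?(ltW t0)// (le_trans st).
  rewrite (clamp01_ge1 (ltW t1)); have [s1|s1] := leP s 1.
    by rewrite clamp01_id ?(ltW s0)// lerD2r ltW.
  by rewrite clamp01_ge1 ?(ltW s1)// subrr subr_ge0.
Qed.

Lemma clamp01_continuous : continuous clamp01.
Proof.
move=> r; apply/cvgrPdist_lt => e e0; near=> t.
have rt : `|r - t| < e by near: t; apply: cvgr_dist_lt => //; exact: cvg_id.
exact: le_lt_trans (clamp01_lipschitz _ _) rt.
Unshelve. all: by end_near. Qed.

Variables (m q M : R) (U : R -> R).
Hypotheses (m1 : 1 < m) (mq : m < q) (hU : {homo U : s t / s <= t})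
  (UM : forall t, 0 <= U t <= M).

Let m10 : 0 < m - 1. Proof. by rewrite subr_gt0. Qed.
Let q10 : 0 < q - 1. Proof. by rewrite subr_gt0 (lt_trans m1). Qed.
Let k := source m q U.
Let K := primitive k.

Lemma powR_homo (e : R) : 0 < e -> {homo (fun t => U t `^ e) : s t / s <= t}.
Proof.
move=> e0 s t st; apply: ge0_ler_powR; rewrite ?nnegrE ?(ltW e0)//.
- by case/andP: (UM s).
- by case/andP: (UM t).
- exact: hU.
Qed.

Lemma powR_bound (e : R) t : 0 < e -> 0 <= U t `^ e <= M `^ e.
Proof.
move=> e0; rewrite powR_ge0; apply: ge0_ler_powR; rewrite ?nnegrE ?(ltW e0)//.
- by case/andP: (UM t).
- by case/andP: (UM t) => h1 h2; exact: le_trans h2.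
- by case/andP: (UM t).
Qed.

Lemma measurable_powRU (e : R) : 0 < e -> measurable_fun setT (fun t => U t `^ e).
Proof. by move=> e0; apply: nondecreasing_measurable => //; exact: powR_homo. Qed.

Lemma measurable_source : measurable_fun setT k.
Proof. by apply: measurable_funB; exact: measurable_powRU. Qed.

Let C : R := M `^ (m - 1) + M `^ (q - 1).

Lemma source_bound t : `|k t| <= C.
Proof.
rewrite (le_trans (ler_normB _ _))// !ger0_norm ?powR_ge0//.
by rewrite lerD//; [case/andP: (powR_bound t m10)|case/andP: (powR_bound t q10)].
Qed.

Lemma source_ge0 t : U t <= 1 -> 0 <= k t.
Proof.
move=> Ut; rewrite subr_ge0; case/andP: (UM t); rewrite le_eqVlt => /predU1P[<-|U0] _.
  by rewrite !powR0 ?gt_eqF.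
by apply: ger_powR; [rewrite U0|rewrite lerD2r ltW].
Qed.

Lemma source_le0 t : 1 <= U t -> k t <= 0.
Proof. by move=> Ut; rewrite subr_le0; apply: ler_powR => //; rewrite lerD2r ltW. Qed.

(** Drop the negative part of the source and use that U is monotone. *)
Lemma flux_le t : 0 <= t -> K t <= U t `^ (m - 1) * t.
Proof.
move=> t0; have h := primitiveB measurable_source source_bound (lexx 0) t0.
rewrite -[X in _ * X]subr0 -(Rintegral_itv_oc_cst _ t0) /K.
rewrite -[X in X <= _]subr0 -[X in _ - X](primitive_le0 k (lexx 0)) h.
apply: le_Rintegral => //.
- exact: integrable_bounded_itv measurable_source source_bound.
- exact: (@integrable_bounded_itv R (fun=> _) `|U t `^ (m - 1)|).
- move=> s; rewrite /= in_itv/= => /andP[s0 st].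
  by rewrite /k /source lerBlDr (le_trans (powR_homo m10 st))// lerDl powR_ge0.
Qed.

Lemma flux_norm t : 0 <= t -> `|K t| <= C * t.
Proof. exact: primitive_norm measurable_source source_bound. Qed.

Lemma flux_continuous : continuous K.
Proof. exact: primitive_continuous measurable_source source_bound. Qed.

Hypothesis K1 : K 1 = 0.

(** The source is nonnegative until U crosses 1 and nonpositive afterwards, so K increases
    from 0 and then decreases to 0. *)
Lemma flux_ge0 t : 0 <= t <= 1 -> 0 <= K t.
Proof.
move=> /andP[t0 t1]; have [Ut|Ut] := leP (U t) 1.
  apply: Rintegral_ge0 => s; rewrite /= in_itv/= => /andP[s0 st].
  by apply: source_ge0; exact: le_trans (hU st) Ut.
have := primitiveB measurable_source source_bound t0 t1; rewrite -/k -/K K1 sub0r => h.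
rewrite -oppr_le0 h -oppr_ge0.
have ik := @integrable_bounded_itv R k C t 1 false false measurable_source source_bound.
rewrite -mulN1r -RintegralZl//; apply: Rintegral_ge0 => s; rewrite /= in_itv/= => /andP[ts s1].
rewrite mulN1r oppr_ge0; apply: source_le0; apply: le_trans (ltW Ut) _; exact/hU/ltW.
Qed.

(** The flux is of order r^N at the origin, so that the quotient is of order r. *)
Lemma flux_ratio_bound r : 0 <= r <= 1 ->
  0 <= K (r ^+ N) / (N%:R * r ^+ N.-1) <= C * r.
Proof.
move=> /andP[r0 r1]; have NR : 0 < N%:R :> R by rewrite ltr0n.
have rN : 0 <= r ^+ N <= 1 by rewrite exprn_ge0// exprn_ile1.
have C0 : 0 <= C by rewrite addr_ge0// powR_ge0.
have D0 : 0 <= N%:R * r ^+ N.-1 by rewrite mulr_ge0// exprn_ge0.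
rewrite (divr_ge0 (flux_ge0 rN) D0) /=.
move: r0; rewrite le_eqVlt => /predU1P[<-|r0].
  by rewrite expr0n gtn_eqF// /K (primitive_le0 k (lexx 0)) mul0r mulr0.
rewrite ler_pdivrMr ?mulr_gt0 ?exprn_gt0//.
have h : K (r ^+ N) <= C * r ^+ N.
  by rewrite (le_trans (ler_norm _))// flux_norm//; case/andP: rN.
rewrite (le_trans h)// -[in leLHS](prednK N0) exprS mulrA.
rewrite [leRHS](_ : _ = (C * r) * (N%:R * r ^+ N.-1)); last by ring.
rewrite ler_wpM2l ?mulr_ge0 ?(ltW r0)// ler_peMl ?exprn_ge0 ?(ltW r0)//.
by rewrite ler1n.
Qed.

Lemma slope_ge0 r : 0 <= slope m K r. Proof. exact: powR_ge0. Qed.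

Lemma slope0 : slope m K 0 = 0.
Proof.
rewrite /slope clamp01_id ?lexx ?ler01// expr0n gtn_eqF// /K (primitive_le0 k (lexx 0)).
by rewrite mul0r powR0// gt_eqF// invr_gt0.
Qed.

Lemma slope1 : slope m K 1 = 0.
Proof.
rewrite /slope clamp01_id ?lexx ?ler01// expr1n K1 mul0r powR0// gt_eqF// invr_gt0.
exact: m10.
Qed.

(** The key a priori inequality: the slope is bounded by the value of the function itself. *)
Lemma slope_le r : 0 < r <= 1 -> slope m K r <= U (r ^+ N).
Proof.
move=> /andP[r0 r1]; have NR : 0 < N%:R :> R by rewrite ltr0n.
have rr : 0 <= r <= 1 by rewrite ltW.
rewrite /slope clamp01_id//.
have /andP[h0 _] := flux_ratio_bound rr.
have U0 : 0 <= U (r ^+ N) by case/andP: (UM (r ^+ N)).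
rewrite -[leRHS](powR_invK U0 (lt0r_neq0 m10)).
apply: ge0_ler_powR; rewrite ?nnegrE ?powR_ge0 ?invr_ge0 ?(ltW m10)//.
rewrite ler_pdivrMr ?mulr_gt0 ?exprn_gt0//.
rewrite (le_trans (flux_le (exprn_ge0 N (ltW r0))))// ler_wpM2l ?powR_ge0//.
rewrite -[in leLHS](prednK N0) exprS ler_wpM2r ?exprn_ge0 ?(ltW r0)//.
by rewrite (le_trans r1)// ler1n.
Qed.

Lemma slope_bound r : `|slope m K r| <= M.
Proof.
have M0 : 0 <= M by case/andP: (UM 0) => a b; exact: le_trans b.
rewrite ger0_norm ?slope_ge0//; have /andP[c0 c1] := clamp01_itv r.
have -> : slope m K r = slope m K (clamp01 r) by rewrite /slope (clamp01_id (clamp01_itv r)).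
move: c0; rewrite le_eqVlt => /predU1P[<-|c0]; first by rewrite slope0.
apply: le_trans (slope_le _) _; first by rewrite c0.
by case/andP: (UM (clamp01 r ^+ N)).
Qed.

Lemma slope_continuous : continuous (slope m K).
Proof.
have C0 : 0 <= C by rewrite addr_ge0// powR_ge0.
move=> r; pose w r := K (clamp01 r ^+ N) / (N%:R * clamp01 r ^+ N.-1).
have w0 s : 0 <= w s by case/andP: (flux_ratio_bound (clamp01_itv s)).
suff cw : {for r, continuous w}.
  apply: (@powR_cvg R R (nbhs r) w (fun=> (m - 1)^-1)) => //.
    by rewrite invr_gt0.
  exact: cvg_cst.
have cX n : {for r, continuous (fun r => clamp01 r ^+ n)}.
  apply: (@continuous_comp _ _ _ clamp01 (fun s : R => s ^+ n)).
    exact: clamp01_continuous.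
  exact: exprn_continuous.
have /andP[c0 c1] := clamp01_itv r; move: c0; rewrite le_eqVlt => /predU1P[c0|c0].
  have wr : w r = 0.
    by rewrite /w -c0 expr0n gtn_eqF// /K (primitive_le0 k (lexx 0)) mul0r.
  suff H : w @ r --> (0 : R) by rewrite -wr in H.
  apply: (@squeeze_cvgr _ _ _ _ (fun=> 0) (fun s => C * clamp01 s)).
  - by apply: nearW => s; exact: flux_ratio_bound (clamp01_itv s).
  - exact: cvg_cst.
  - rewrite [X in _ --> X](_ : _ = C * clamp01 r); last by rewrite -c0 mulr0.
    by apply: cvgM; [exact: cvg_cst|exact: clamp01_continuous].
apply: cvgM.
  by apply: (@continuous_comp _ _ _ (fun r => clamp01 r ^+ N) K); [exact: cX|exact: flux_continuous].
apply: cvgV.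
  by rewrite mulf_neq0// ?expf_neq0 ?gt_eqF// ltr0n.
by apply: cvgM; [exact: cvg_cst|exact: cX].
Qed.

End flux.

(** * Monotonicity of the gradient field *)

Section cauchy_schwarz.
Context (R : realType) (N : nat).
Implicit Types (x y a b : 'rV[R]_N) (m : R).

Lemma dotvC x y : dotv x y = dotv y x.
Proof. by apply: eq_bigr => i _; rewrite mulrC. Qed.

Lemma dotvDl x y a : dotv (x + y) a = dotv x a + dotv y a.
Proof. by rewrite -big_split/=; apply: eq_bigr => i _; rewrite mxE mulrDl. Qed.

Lemma dotvZl (c : R) x a : dotv (c *: x) a = c * dotv x a.
Proof. by rewrite /dotv mulr_sumr; apply: eq_bigr => i _; rewrite mxE mulrA. Qed.

Lemma dotvBl x y a : dotv (x - y) a = dotv x a - dotv y a.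
Proof. by rewrite dotvDl -scaleN1r dotvZl mulN1r. Qed.

Lemma dotvBr x y a : dotv a (x - y) = dotv a x - dotv a y.
Proof. by rewrite !(dotvC a) dotvBl. Qed.

Lemma dotv0l a : dotv 0 a = 0.
Proof. by rewrite -(scale0r a) dotvZl mul0r. Qed.

(** Expand the square of |b| a - |a| b. *)
Lemma dotv_le_enorm a b : dotv a b <= enorm a * enorm b.
Proof.
have [->|a0] := eqVneq a 0; first by rewrite enorm0 mul0r dotv0l.
have [->|b0] := eqVneq b 0; first by rewrite enorm0 mulr0 dotvC dotv0l.
have ea : 0 < enorm a by rewrite enorm_gt0.
have eb : 0 < enorm b by rewrite enorm_gt0.
have := dotv_ge0 (enorm b *: a - enorm a *: b).
rewrite dotvBl !dotvBr !(dotvZl, dotvC _ (_ *: _)) -!enorm_sqr (dotvC b a).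
move: ea eb; move: (enorm a) (enorm b) (dotv a b) => A C d A0 C0 h.
have {}h : 0 <= (A * C) * (2 * (A * C - d)) by move: h; congr (_ <= _); ring.
by move: h; rewrite pmulr_rge0 ?mulr_gt0// pmulr_rge0// subr_ge0.
Qed.

Lemma normr_dotv_le a b : `|dotv a b| <= enorm a * enorm b.
Proof.
rewrite ler_norml dotv_le_enorm andbT lerNl -mulN1r -dotvZl.
by rewrite (le_trans (dotv_le_enorm _ _))// enormZ normrN1 mul1r.
Qed.

Lemma enorm_lipschitz x y : `|enorm x - enorm y| <= enorm (x - y).
Proof.
rewrite -ler_sqr ?nnegrE ?enorm_ge0// -[leLHS]normrX ger0_norm ?sqr_ge0//.
rewrite enorm_sqr dotvBl !dotvBr -!enorm_sqr (dotvC y x) sqrrB.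
have := dotv_le_enorm x y; lra.
Qed.

Lemma powR_mulr_self m (A : R) : 1 < m -> 0 <= A -> A `^ (m - 2) * A = A `^ (m - 1).
Proof.
move=> m1; rewrite le_eqVlt => /predU1P[<-|A0].
  by rewrite mulr0 powR0// subr_eq0 gt_eqF.
rewrite -{2}(powRr1 (ltW A0)) -powRD; last by rewrite (gt_eqF A0) implybT.
by congr (_ `^ _); lra.
Qed.

(** The expression is the product of the differences of |a|^(m-1), |b|^(m-1) and of |a|, |b|,
    plus a nonnegative multiple of the defect in the Cauchy-Schwarz inequality. *)
Lemma powR_field_monotone m a b : 1 < m ->
  let E := enorm a `^ (m - 2) * dotv a a - enorm a `^ (m - 2) * dotv a b
    - enorm b `^ (m - 2) * dotv b a + enorm b `^ (m - 2) * dotv b b in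
  0 <= E /\ (E = 0 -> a = b).
Proof.
move=> m1 E; have m10 : 0 < m - 1 by rewrite subr_gt0.
have a0 := enorm_ge0 a; have b0 := enorm_ge0 b; have cs := dotv_le_enorm a b.
have EE : E = (enorm a `^ (m - 1) - enorm b `^ (m - 1)) * (enorm a - enorm b) +
    (enorm a `^ (m - 2) + enorm b `^ (m - 2)) * (enorm a * enorm b - dotv a b).
  rewrite /E (dotvC b a) -!enorm_sqr -!powR_mulr_self//; ring.
have p1 : 0 <= (enorm a `^ (m - 1) - enorm b `^ (m - 1)) * (enorm a - enorm b).
  have [ab|ab] := leP (enorm a) (enorm b).
    by apply: mulr_le0; rewrite subr_le0//; apply: ge0_ler_powR; rewrite ?nnegrE ?(ltW m10).
  by apply: mulr_ge0; rewrite subr_ge0 ?(ltW ab)//; apply: ge0_ler_powR;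
    rewrite ?nnegrE ?(ltW m10) ?(ltW ab).
have p2 : 0 <= (enorm a `^ (m - 2) + enorm b `^ (m - 2)) * (enorm a * enorm b - dotv a b).
  by apply: mulr_ge0; [rewrite addr_ge0 ?powR_ge0|rewrite subr_ge0].
split; first by rewrite EE addr_ge0.
rewrite EE => /eqP; rewrite paddr_eq0// => /andP[/eqP h1 /eqP h2].
have ab : enorm a = enorm b.
  apply/eqP; move/eqP : h1; rewrite mulf_eq0 !subr_eq0 => /orP[/eqP h|//].
  have := congr1 (fun z => z `^ (m - 1)^-1) h.
  by rewrite /= !(powR_invK _ (lt0r_neq0 m10))// => ->.
have [a00|a00] := eqVneq a 0.
  by rewrite a00; apply/esym/eqP; rewrite -enorm_eq0 -ab a00 enorm0.
have ea : 0 < enorm a by rewrite enorm_gt0.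
move/eqP : h2; rewrite -ab mulf_eq0 gt_eqF ?addr_gt0 ?powR_gt0//= subr_eq0 => /eqP h2.
apply/eqP; rewrite -subr_eq0 -dotv_eq0 dotvBl !dotvBr -!enorm_sqr (dotvC b a) -h2 -ab.
by apply/eqP; ring.
Qed.

(** Each coordinate is at most the m-th root of the sum on the right. *)
Lemma enorm_powR_le m a : 0 < m ->
  enorm a `^ m <= N%:R `^ (m / 2) * \sum_i `|a ord0 i| `^ m.
Proof.
move=> m0; set S := \sum_i _; have S0 : 0 <= S by apply: sumr_ge0 => i _; exact: powR_ge0.
have aS i : `|a ord0 i| <= S `^ m^-1.
  rewrite -[leLHS](powR_invK (normr_ge0 _) (lt0r_neq0 m0)).
  apply: ge0_ler_powR; rewrite ?nnegrE ?powR_ge0 ?invr_ge0 ?(ltW m0)//.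
  by rewrite /S (bigD1 i)//= lerDl; apply: sumr_ge0 => j _; exact: powR_ge0.
have -> : enorm a `^ m = (dotv a a) `^ (m / 2).
  rewrite -enorm_sqr -powR_mulrn ?enorm_ge0// -powRrM; congr (_ `^ _).
  by rewrite mulrC divfK.
have -> : N%:R `^ (m / 2) * S = (N%:R * S `^ (2 / m)) `^ (m / 2).
  rewrite powRM ?powR_ge0// -powRrM; congr (_ * _).
  by rewrite -[LHS](powRr1 S0); congr (_ `^ _); field; exact: lt0r_neq0.
apply: ge0_ler_powR; rewrite ?nnegrE ?dotv_ge0 ?mulr_ge0 ?powR_ge0 ?divr_ge0 ?(ltW m0)//.
rewrite /dotv mulr_natl -[X in _ *+ X]card_ord -sumr_const; apply: ler_sum => i _.
rewrite -expr2 -real_normK ?num_real// -[2 / m]mulrC powRrM powR_mulrn ?powR_ge0//.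
by apply: lerXn2r; rewrite ?nnegrE ?powR_ge0.
Qed.

End cauchy_schwarz.

Section measurable_fields.
Context (R : realType) (N : nat).
Local Notation V := 'rV[R]_N.
Implicit Types (D : set V) (f g : V -> V).

Lemma measurable_dotv D f g : (forall i, measurable_fun D (fun x => f x ord0 i)) ->
  (forall i, measurable_fun D (fun x => g x ord0 i)) ->
  measurable_fun D (fun x => dotv (f x) (g x)).
Proof. by move=> mf mg; apply: measurable_sum => i; exact: measurable_funM. Qed.

Lemma measurable_enorm_powR D f (e : R) : (forall i, measurable_fun D (fun x => f x ord0 i)) ->
  measurable_fun D (fun x => enorm (f x) `^ e).
Proof.
move=> mf; apply: (@measurableT_comp _ _ _ _ _ _ (fun y : R => y `^ e)) => //.
apply: (@measurableT_comp _ _ _ _ _ _ (@Num.sqrt R)).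
  by apply: continuous_measurable_fun; exact: sqrt_continuous.
exact: measurable_dotv.
Qed.

End measurable_fields.

(** * Operations on weak gradients *)

Section weak_gradient_algebra.
Context (R : realType) (N : nat).
Local Notation V := 'rV[R]_N.
Local Notation leb := (@lebesgue_rV R N).
Local Notation B := (@B R N).
Implicit Types (u v : V -> R) (G H : V -> V).
Hypothesis N0 : (0 < N)%N.

Let mB : measurable B. Proof. exact: measurable_B. Qed.

Lemma integrable_mul_test u phi : test_function phi -> leb.-integrable B (EFin \o u) ->
  leb.-integrable B (EFin \o (fun x => u x * phi x)) /\
  forall i, leb.-integrable B (EFin \o (fun x => u x * partial i phi x)).
Proof.
move=> tp iu; have [C hC] := test_bounded tp.
have H f : continuous f -> (forall x, `|f x| <= C) ->
    leb.-integrable B (EFin \o (fun x => u x * f x)).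
  move=> cf fC; under [X in EFin \o X]eq_fun do rewrite mulrC.
  apply: (integrable_mul_bounded (M := C)) => //.
  by apply: measurable_funTS; exact: continuous_rV_measurable.
split=> [|i].
  by apply: H; [exact: test_continuous|move=> x; case: (hC x)].
by apply: H; [exact: test_partial_continuous|move=> x; case: (hC x)].
Qed.

(** Weak gradients only see functions up to null sets. *)
Lemma weak_gradient_ae u v G H : weak_gradient u G ->
  leb.-integrable B (EFin \o v) -> (forall i, leb.-integrable B (EFin \o (fun x => H x ord0 i))) ->
  {ae leb, forall x, B x -> u x = v x} -> {ae leb, forall x, B x -> G x = H x} ->
  weak_gradient v H.
Proof.
move=> wG iv iH uv GH; have [lu lG eG] := wG; split.
- exact: integrable_locally.
- by move=> i; exact: integrable_locally.
move=> phi tp i.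
have mp : measurable_fun B phi 
  by apply: measurable_funTS; apply: continuous_rV_measurable; exact: test_continuous.
have mpi : measurable_fun B (partial i phi).
  apply: measurable_funTS; apply: continuous_rV_measurable.
  exact: test_partial_continuous.
transitivity (\int[leb]_(x in B) (u x * partial i phi x)).
  apply: eq_Rintegral_ae => //.
  - by apply: measurable_funM => //; exact: integrable_measurable iv.
  - by apply: measurable_funM => //; exact: locally_integrable_measurable.
  - by apply: filterS uv => x h Bx; rewrite h.
rewrite eG//; congr (- _); apply: eq_Rintegral_ae => //.
- by apply: measurable_funM => //; exact: locally_integrable_measurable.
- by apply: measurable_funM => //; exact: integrable_measurable (iH i).
- by apply: filterS GH => x h Bx; rewrite h.
Qed.

Lemma weak_gradientB u v G H : weak_gradient u G -> weak_gradient v H ->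
  leb.-integrable B (EFin \o u) -> leb.-integrable B (EFin \o v) ->
  (forall i, leb.-integrable B (EFin \o (fun x => G x ord0 i))) ->
  (forall i, leb.-integrable B (EFin \o (fun x => H x ord0 i))) ->
  weak_gradient (fun x => u x - v x) (fun x => G x - H x).
Proof.
move=> [_ _ eu] [_ _ ev] iu iv iG iH.
have iB f g : leb.-integrable B (EFin \o f) -> leb.-integrable B (EFin \o g) ->
    leb.-integrable B (EFin \o (fun x => f x - g x)).
  by move=> h1 h2; have := integrableB mB h1 h2; apply: eq_integrable.
split.
- exact/integrable_locally/iB.
- move=> i; under eq_fun do rewrite !mxE.
  by apply/integrable_locally/iB.
move=> phi tp i.
have [_ /(_ i) h1] := integrable_mul_test tp iu.
have [_ /(_ i) h2] := integrable_mul_test tp iv.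
have [h3 _] := integrable_mul_test tp (iG i).
have [h4 _] := integrable_mul_test tp (iH i).
under eq_Rintegral => x _ do rewrite mulrBl.
rewrite RintegralB// eu// ev//.
under [in RHS]eq_Rintegral => x _ do rewrite !mxE mulrBl.
by rewrite RintegralB// opprB opprK addrC.
Qed.

Lemma integrable_enorm_powR m G : 1 < m ->
  (forall i, LB m (fun x => G x ord0 i)) ->
  leb.-integrable B (EFin \o (fun x => enorm (G x) `^ m)).
Proof.
move=> m1 LG; have m0 : 0 < m by rewrite (lt_trans ltr01).
have mG i : measurable_fun B (fun x => G x ord0 i) by case/(LBP _ m0) : (LG i).
apply: (integrable_le mB _ (g := fun x => N%:R `^ (m / 2) * \sum_i `|G x ord0 i| `^ m)).
- exact: measurable_enorm_powR.
- by move=> x _; rewrite ger0_norm ?powR_ge0// enorm_powR_le.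
- have h : leb.-integrable B (EFin \o (fun x => \sum_i `|G x ord0 i| `^ m)).
    by apply: integrable_real_sum => // i; case/(LBP _ m0) : (LG i).
  by have := integrableZl mB (N%:R `^ (m / 2)) h; apply: eq_integrable.
Qed.

End weak_gradient_algebra.

(** * The weak equation of a radial function *)

Section radial_equation.
Context (R : realType) (N : nat).
Local Notation V := 'rV[R]_N.
Local Notation leb := (@lebesgue_rV R N).
Local Notation B := (@B R N).
Hypothesis N0 : (0 < N)%N.
Variables (m q M : R) (U : R -> R).
Hypotheses (m1 : 1 < m) (mq : m < q) (hU : {homo U : s t / s <= t})
  (UM : forall t, 0 <= U t <= M).

Let m10 : 0 < m - 1. Proof. by rewrite subr_gt0. Qed.
Let q10 : 0 < q - 1. Proof. by rewrite subr_gt0 (lt_trans m1). Qed.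
Let k := source m q U.
Let K := primitive k.
Let h := slope N m K.

(** The source is a difference of two bounded monotone functions. *)
Lemma defect_source phi (G : V -> V) : weak_gradient phi G ->
  leb.-integrable B (EFin \o phi) ->
  (forall i, leb.-integrable B (EFin \o (fun x => G x ord0 i))) ->
  defect phi G k = 0.
Proof.
move=> wG iphi iG.
have -> : k = fun t => U t `^ (m - 1) + (-1) * U t `^ (q - 1).
  by apply/funext => t; rewrite mulN1r.
have b1 e t : 0 < e -> `|U t `^ e| <= M `^ e.
  by move=> e0; rewrite ger0_norm ?powR_ge0//; case/andP: (powR_bound UM t e0).
have b2 t : `|-1 * U t `^ (q - 1)| <= M `^ (q - 1) by rewrite mulN1r normrN b1.
rewrite (defectD iphi iG (measurable_powRU hU UM m10) _ (fun t => b1 _ t m10) b2); last first.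
  by apply: measurable_funM; [exact: measurable_cst|exact: (measurable_powRU hU UM q10)].
rewrite (defectZ iphi iG _ (measurable_powRU hU UM q10) (fun t => b1 _ t q10)).
rewrite (gauss_monotone N0 wG iphi iG (powR_homo hU UM m10) (fun t => powR_bound UM t m10)).
by rewrite (gauss_monotone N0 wG iphi iG (powR_homo hU UM q10) (fun t => powR_bound UM t q10)) mulr0 addr0.
Qed.

(** The divergence theorem for the constant function 1 computes the mean of the source. *)
Lemma flux1_eq0 : \int[leb]_(x in B) k (tau x) = 0 -> K 1 = 0.
Proof.
move=> k0; have mB := @measurable_B R N.
have i1 := @integrable_cstB R N 1; have w1 := @weak_gradient_cst R N 1.
have i0 (i : 'I_N) : leb.-integrable B (EFin \o (fun x : V => (0 : V) ord0 i)).
  by under [X in EFin \o X]eq_fun do rewrite mxE; exact: integrable_cstB.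
have := defect_source w1 i1 i0; rewrite /defect.
have mk := measurable_source m1 mq hU UM; have bk := source_bound m1 mq UM.
have ik : leb.-integrable B (EFin \o (fun x : V => k (tau x))).
  apply: (integrable_bounded (M := M `^ (m - 1) + M `^ (q - 1)) mB (@lebesgue_B_lty R N)).
    by apply: measurable_funTS; apply: (measurableT_comp mk); exact: measurable_tau.
  by move=> x _; exact: bk.
under eq_Rintegral => x _ do rewrite /defect_density dotv0r mulr0 add0r mulr1.
have ik1 : leb.-integrable B (EFin \o (fun x : V => k (tau x) - K 1)).
  by have := integrableB mB ik (@integrable_cstB R N (K 1)); apply: eq_integrable.
rewrite RintegralZl// => /eqP; rewrite mulf_eq0 pnatr_eq0 gtn_eqF//=.
rewrite RintegralB//; last exact: integrable_cstB.
rewrite k0 sub0r oppr_eq0 Rintegral_cst// mulf_eq0 => /orP[/eqP//|].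
by rewrite gt_eqF// omega_gt0.
Qed.

Hypothesis K1 : K 1 = 0.

Lemma slope_powR r : 0 < r <= 1 -> h r `^ (m - 1) = K (r ^+ N) / (N%:R * r ^+ N.-1).
Proof.
move=> /andP[r0 r1]; have rr : 0 <= r <= 1 by rewrite ltW.
rewrite /h /slope clamp01_id// -powRrM mulVf ?gt_eqF// powRr1//.
by case/andP: (flux_ratio_bound N0 m1 mq hU UM K1 rr).
Qed.

(** The flux of the radial function is the radial field of the source, up to the factor N. *)
Lemma radial_densityE x (y : V) (f : R) : B x ->
  enorm (radial_grad h x) `^ (m - 2) * dotv (radial_grad h x) y + k (tau x) * f =
  N%:R^-1 * ((K (tau x) - K 1 * tau x) / tau x * dotv x y +
             N%:R * ((k (tau x) - K 1) * f)).
Proof.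
move=> Bx; have NR : N%:R != 0 :> R by rewrite pnatr_eq0 gtn_eqF.
rewrite K1 mul0r !subr0.
have [->|x0] := eqVneq x 0.
  by rewrite /radial_grad scaler0 !dotv0l !mulr0 !add0r mulKf.
have e0 : 0 < enorm x by rewrite enorm_gt0.
have h0 : 0 <= h (enorm x) by exact: slope_ge0.
rewrite enorm_radial_grad// ger0_norm// /radial_grad dotvZl tauE//.
rewrite [X in X + _ = _](_ : _ = h (enorm x) `^ (m - 1) / enorm x * dotv x y); last first.
  by rewrite -powR_mulr_self//; ring.
rewrite slope_powR ?e0 ?(ltW Bx)//.
have : enorm x ^+ N = enorm x * enorm x ^+ N.-1 by rewrite -exprS prednK.
have : enorm x ^+ N.-1 != 0 by rewrite expf_neq0// gt_eqF.
move: (k _) (K _) => k1 k2; have := lt0r_neq0 e0.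
move: (_ ^+ N.-1) (_ ^+ N) => a b en an ->.
by field; rewrite NR an en.
Qed.

(** The radial function with the slope of the flux solves the weak equation with the
    source as right-hand side, for every test function with integrable gradient. *)
Lemma radial_equation phi (G : V -> V) : weak_gradient phi G ->
  leb.-integrable B (EFin \o phi) ->
  (forall i, leb.-integrable B (EFin \o (fun x => G x ord0 i))) ->
  leb.-integrable B (EFin \o (fun x =>
    enorm (radial_grad h x) `^ (m - 2) * dotv (radial_grad h x) (G x) + k (tau x) * phi x)) /\
  \int[leb]_(x in B) (enorm (radial_grad h x) `^ (m - 2) * dotv (radial_grad h x) (G x) +
    k (tau x) * phi x) = 0.
Proof.
move=> wG iphi iG; have mB := @measurable_B R N.
have mk := measurable_source m1 mq hU UM; have bk := source_bound m1 mq UM.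
have id := integrable_defect iphi iG mk bk.
split.
  have := integrableZl mB (N%:R^-1) id; apply: eq_integrable => //.
  by move=> x /set_mem Bx; rewrite /= radial_densityE.
transitivity (\int[leb]_(x in B) (N%:R^-1 * defect_density phi G k x)).
  by apply: eq_Rintegral => x /set_mem Bx; rewrite radial_densityE.
by rewrite RintegralZl// -/(defect phi G k) (defect_source wG iphi iG) mulr0.
Qed.

End radial_equation.

(** * Profiles and the solutions that they define *)

Section profiles.
Context (R : realType).
Local Notation leb N := (@lebesgue_rV R N).
Implicit Types (m q c r t : R) (h : R -> R).

(** The function c + int_0^|x| h in the volume variable t = |x|^N. *)
Definition volume_profile N c h t : R := c + primitive h (clamp01 t `^ N%:R^-1).

(** Radial solutions reduced to the equation for their slope, together with the bounds
    that solutions turn out to satisfy.  The pair (c, h) stands for the function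
    c + int_0^|x| h. *)
Definition profile N m q c h :=
  let K := primitive (source m q (volume_profile N c h)) in
  [/\ continuous h, h 0 = 0, forall r, 0 <= h r <= 4,
      1 / 4 <= c /\ c + primitive h 1 <= 4 &
      K 1 = 0 /\ forall r, h r = slope N m K r].

Lemma primitive_homo h M : continuous h -> (forall r, 0 <= h r <= M) ->
  {homo primitive h : s t / s <= t}.
Proof.
move=> ch h4 s t st.
have mh : measurable_fun setT h by exact: continuous_measurable_fun.
have hn r : `|h r| <= M by have /andP[a b] := h4 r; rewrite ger0_norm.
have [s0|s0] := leP s 0.
  rewrite (primitive_le0 h s0); apply: Rintegral_ge0 => r _.
  by case/andP: (h4 r).
rewrite -subr_ge0 (primitiveB mh hn (ltW s0) st); apply: Rintegral_ge0 => r _.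
by case/andP: (h4 r).
Qed.

Lemma volume_profile_homo N c h M : continuous h -> (forall r, 0 <= h r <= M) ->
  {homo volume_profile N c h : s t / s <= t}.
Proof.
move=> ch hM s t st; rewrite lerD2l; apply: (primitive_homo ch hM).
apply: ge0_ler_powR; rewrite ?nnegrE ?invr_ge0 ?clamp01_homo//.
  by case/andP: (clamp01_itv s).
by case/andP: (clamp01_itv t).
Qed.

Lemma root_le1 N t : 0 <= t <= 1 -> 0 <= t `^ N%:R^-1 <= 1.
Proof.
move=> /andP[t0 t1]; rewrite powR_ge0/=.
have p1 : (1 : R) `^ N%:R^-1 = 1 by rewrite powR1.
rewrite -[leRHS]p1.
by apply: ge0_ler_powR; rewrite ?nnegrE ?invr_ge0.
Qed.

Variables (N : nat) (m q c : R) (h : R -> R).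
Hypotheses (N0 : (0 < N)%N) (ph : profile N m q c h).

Let ch : continuous h. Proof. by case: ph. Qed.
Let h4 r : 0 <= h r <= 4. Proof. by case: ph. Qed.
Let mh : measurable_fun setT h. Proof. exact: continuous_measurable_fun. Qed.
Let hn r : `|h r| <= 4. Proof. by have /andP[a b] := h4 r; rewrite ger0_norm. Qed.

Lemma profile_bounds r : r <= 1 -> 1 / 4 <= c + primitive h r <= 4.
Proof.
move=> r1; case: ph => _ _ _ [c4 c1] _; have hH := primitive_homo ch h4.
apply/andP; split; last by rewrite (le_trans _ c1)// lerD2l; exact: hH.
rewrite (le_trans c4)// lerDl; apply: Rintegral_ge0 => s _; by case/andP: (h4 s).
Qed.

Lemma volume_profile_bounds t : 1 / 4 <= volume_profile N c h t <= 4.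
Proof. by apply: profile_bounds; case/andP: (root_le1 N (clamp01_itv t)). Qed.

Lemma volume_profile_tau (x : 'rV[R]_N) : B x ->
  volume_profile N c h (tau x) = c + primitive h (enorm x).
Proof.
move=> Bx; rewrite /volume_profile clamp01_id; last by rewrite tau_ge0 (ltW (tau_lt1 N0 Bx)).
rewrite tauE// -powR_mulrn ?enorm_ge0// powR_invK ?enorm_ge0//.
by rewrite pnatr_eq0 gtn_eqF.
Qed.

Definition profile_fun c h (x : 'rV[R]_N) : R := c + primitive h (enorm x).

Lemma weak_gradient_profile : weak_gradient (profile_fun c h) (radial_grad h).
Proof. by apply: weak_gradient_radial ch hn _; case: ph. Qed.

Lemma profile_W1 (e : R) : 0 < e -> W1 e (profile_fun c h).
Proof.
move=> e0; apply: (W1_bounded (M := 4) N0 e0 weak_gradient_profile).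
  move=> x /ltW Bx; have /andP[a b] := profile_bounds Bx; rewrite ger0_norm//.
  by rewrite (le_trans _ a)// divr_ge0.
by move=> x i Bx; rewrite (le_trans (radial_grad_coord_le _ _ _)).
Qed.

Hypotheses (m1 : 1 < m) (mq : m < q).

(** By definition of a profile the weak equation of its radial function has the source of
    that same function on the right. *)
Lemma profile_solution : solution m q (profile_fun c h).
Proof.
have m0 : 0 < m by exact: lt_trans m1.
have mB := @measurable_B R N.
have pos r : r <= 1 -> 0 < c + primitive h r.
  by move=> /profile_bounds/andP[a _]; rewrite (lt_le_trans _ a)// divr_gt0.
have UM t : 0 <= volume_profile N c h t <= 4.
  by have /andP[a ->] := volume_profile_bounds t; rewrite andbT (le_trans _ a)// divr_ge0.
split.
- split.
  + split; first exact: profile_W1.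
    by move=> x y _ xy; rewrite /profile_fun xy.
  + by move=> x /pos/ltW.
  + by move=> x y _ xy _; rewrite lerD2l; exact: primitive_homo ch h4 _ _ xy.
- by move=> x /ltW/pos.
move=> phi W1phi; have [wphi iphi iG] := W1_integrable (ltW m1) W1phi.
case: (ph) => _ _ _ _ [K1 hE].
have [i1 e1] := radial_equation N0 m1 mq (volume_profile_homo N c ch h4) UM K1 wphi iphi iG.
have rE : radial_grad (N := N) h = radial_grad (slope N m (primitive (source m q (volume_profile N c h)))).
  by congr radial_grad; apply/funext => r; rewrite hE.
rewrite -rE in i1 e1.
have mcp : measurable_fun B (profile_fun c h).
  by case: weak_gradient_profile => lu _ _; exact: locally_integrable_measurable.
have ip e : 0 < e -> (leb N).-integrable B (EFin \o (fun x => profile_fun c h x `^ e * phi x)).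
  move=> e0; apply: (integrable_mul_bounded (M := 4 `^ e)) => //.
    exact: (@measurableT_comp _ _ _ _ _ _ (fun y : R => y `^ e)).
  move=> x /ltW Bx; have /andP[a b] := profile_bounds Bx; rewrite ger0_norm ?powR_ge0//.
  apply: ge0_ler_powR; rewrite ?nnegrE ?(ltW e0)//.
  by rewrite (le_trans _ a)// divr_ge0.
have m10 : 0 < m - 1 by rewrite subr_gt0.
have q10 : 0 < q - 1 by rewrite subr_gt0 (lt_trans m1).
have i2 := ip _ m10; have i3 := ip _ q10.
pose F x := enorm (radial_grad h x) `^ (m - 2) * dotv (radial_grad h x) (wgrad phi x) +
  profile_fun c h x `^ (m - 1) * phi x.
have FE x : B x -> F x = (enorm (radial_grad h x) `^ (m - 2) * dotv (radial_grad h x) (wgrad phi x) +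
    source m q (volume_profile N c h) (tau x) * phi x) + profile_fun c h x `^ (q - 1) * phi x.
  by move=> Bx; rewrite /F /source volume_profile_tau// -/(profile_fun c h x); ring.
have iF : (leb N).-integrable B (EFin \o F).
  have := integrableD mB i1 i3; apply: eq_integrable => // x /set_mem Bx.
  by rewrite [in RHS]/= FE.
transitivity (\int[leb N]_(x in B) F x).
  have mw (f : 'rV[R]_N -> R) G (i : 'I_N) : weak_gradient f G -> measurable_fun B (fun x => wgrad f x ord0 i).
    by move=> w; exact: measurable_wgrad w.
  apply: eq_Rintegral_ae => //.
  - apply: measurable_funD; last exact: integrable_measurable i2.
    apply: measurable_funM.
      by apply: measurable_enorm_powR => i; exact: mw weak_gradient_profile.
    by apply: measurable_dotv => i; [exact: mw weak_gradient_profile|exact: mw wphi].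
  - exact: integrable_measurable iF.
  - by apply: filterS (wgrad_ae N0 weak_gradient_profile) => x xE Bx; rewrite xE.
transitivity (\int[leb N]_(x in B) ((enorm (radial_grad h x) `^ (m - 2) * dotv (radial_grad h x) (wgrad phi x) +
    source m q (volume_profile N c h) (tau x) * phi x) + profile_fun c h x `^ (q - 1) * phi x)).
  by apply: eq_Rintegral => x /set_mem /FE.
by rewrite RintegralD// e1 add0r.
Qed.

End profiles.

(** * Solutions are radial functions with the slope of their flux *)

Section solution_gradient.
Context (R : realType) (N : nat).
Local Notation V := 'rV[R]_N.
Local Notation leb := (@lebesgue_rV R N).
Local Notation B := (@B R N).
Hypothesis N0 : (0 < N)%N.
Variables (m q : R) (u : V -> R).
Hypotheses (m1 : 1 < m) (mq : m < q) (su : solution m q u).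

Let m10 : 0 < m - 1. Proof. by rewrite subr_gt0. Qed.
Let q10 : 0 < q - 1. Proof. by rewrite subr_gt0 (lt_trans m1). Qed.
Let m0 : 0 < m. Proof. exact: lt_trans m1. Qed.
Let mB : measurable B. Proof. exact: measurable_B. Qed.

Definition ray (r : R) : V := r *: delta_mx ord0 (Ordinal N0).

Lemma enorm_ray r : 0 <= r -> enorm (ray r) = r.
Proof. by move=> r0; rewrite enormZ enorm_delta mulr1 ger0_norm. Qed.

(** The solution in the volume variable, extended monotonically to the line as required
    by the divergence theorem. *)
Definition ray_profile (t : R) : R :=
  if t <= 0 then 0 else u (ray (Num.min t 1 `^ N%:R^-1)).

Local Notation U := ray_profile.
Local Notation M := (u (ray 1)).

Let root (t : R) := Num.min t 1 `^ N%:R^-1.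
Let root_itv t : 0 < t -> 0 < root t <= 1.
Proof.
move=> t0; have h : 0 < Num.min t 1 by rewrite lt_min t0 ltr01.
have h1 : 0 <= Num.min t 1 <= 1 by rewrite (ltW h) ge_min lexx orbT.
by rewrite powR_gt0//=; case/andP: (root_le1 N h1).
Qed.

Lemma ray_profile_homo : {homo U : s t / s <= t}.
Proof.
move=> s t st; rewrite /U; have [[_ u0 uh] _ _] := su.
have [s0|s0] := leP s 0; have [t0|t0] := leP t 0 => //.
- apply: u0; have /andP[a b] := root_itv t0.
  by rewrite /cB /= enorm_ray// ltW.
- by move: s0; rewrite ltNge (le_trans st).
- have /andP[a1 b1] := root_itv s0; have /andP[a2 b2] := root_itv t0.
  apply: uh; rewrite !enorm_ray ?(ltW a1) ?(ltW a2)//.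
  apply: ge0_ler_powR; rewrite ?nnegrE ?invr_ge0//.
  + by rewrite le_min (ltW s0) ler01.
  + by rewrite le_min (ltW t0) ler01.
  + by rewrite le_min !ge_min st lexx orbT.
Qed.

Lemma ray_profile_bounds t : 0 <= U t <= M.
Proof.
have U1 s : 1 <= s -> U s = M.
  move=> s1; rewrite /U leNgt (lt_le_trans ltr01 s1)/= min_r//.
  by rewrite powR1.
have U0 s : s <= 0 -> U s = 0 by move=> s0; rewrite /U s0.
apply/andP; split.
  have h : Num.min t 0 <= 0 by rewrite ge_min lexx orbT.
  by rewrite -(U0 _ h); apply: ray_profile_homo; rewrite ge_min lexx.
have h : 1 <= Num.max t 1 by rewrite le_max lexx orbT.
by rewrite -(U1 _ h); apply: ray_profile_homo; rewrite le_max lexx.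
Qed.

Lemma ray_profile_tau x : B x -> x != 0 -> U (tau x) = u x.
Proof.
move=> Bx x0; have t1 := tau_lt1 N0 Bx; rewrite /U leNgt tau_gt0// x0/= min_l ?(ltW t1)//.
have -> : tau x `^ N%:R^-1 = enorm x.
  by rewrite tauE// -powR_mulrn ?enorm_ge0// powR_invK ?enorm_ge0// pnatr_eq0 gtn_eqF.
have [[[_ ru] _ _] _ _] := su; apply: ru; last by rewrite enorm_ray// enorm_ge0.
by rewrite /cB /= enorm_ray ?enorm_ge0// ltW.
Qed.

Lemma ray_profile_gt0 t : 0 < t < 1 -> 0 < U t.
Proof.
move=> /andP[t0 t1]; rewrite /U leNgt t0/= min_l ?(ltW t1)//.
have [_ up _] := su; apply: up; rewrite /B /= enorm_ray ?powR_ge0//.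
have p1 : (1 : R) `^ N%:R^-1 = 1 by rewrite powR1.
rewrite -[ltRHS]p1; apply: gt0_ltr_powR; rewrite ?nnegrE ?invr_gt0 ?ltr0n ?(ltW t0)//.
Qed.

Let k := source m q U.
Let hU := ray_profile_homo.
Let UM := ray_profile_bounds.
Let mk : measurable_fun setT k. Proof. exact: measurable_source m1 mq hU UM. Qed.
Let C := M `^ (m - 1) + M `^ (q - 1).
Let kC t : `|k t| <= C. Proof. exact: source_bound m1 mq UM t. Qed.

Let G := wgrad u.
Let uW1 : W1 m u. Proof. by case: su => -[[]]. Qed.
Let wG : weak_gradient u G. Proof. by case: (W1_integrable (ltW m1) uW1). Qed.
Let iu : leb.-integrable B (EFin \o u). Proof. by case: (W1_integrable (ltW m1) uW1). Qed.
Let iG i : leb.-integrable B (EFin \o (fun x => G x ord0 i)).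
Proof. by case: (W1_integrable (ltW m1) uW1). Qed.
Let mG i : measurable_fun B (fun x => G x ord0 i). Proof. exact: integrable_measurable (iG i). Qed.

Lemma integrable_source_mul phi : leb.-integrable B (EFin \o phi) ->
  leb.-integrable B (EFin \o (fun x => k (tau x) * phi x)).
Proof.
move=> iphi; have mkt : measurable_fun B (fun x : V => k (tau x)).
  by apply: measurable_funTS; apply: (measurableT_comp mk); exact: measurable_tau.
exact: (integrable_mul_bounded mB mkt (fun x _ => kC (tau x)) iphi).
Qed.

(** The solution may be replaced by its values along a ray, and the chosen weak gradient by
    any other one. *)
Lemma weak_equation phi (Gphi : V -> V) : W1 m phi ->
  {ae leb, forall x, B x -> wgrad phi x = Gphi x} ->
  leb.-integrable B (EFin \o (fun x => enorm (G x) `^ (m - 2) * dotv (G x) (Gphi x))) ->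
  leb.-integrable B (EFin \o (fun x =>
    enorm (G x) `^ (m - 2) * dotv (G x) (Gphi x) + k (tau x) * phi x)) /\
  \int[leb]_(x in B) (enorm (G x) `^ (m - 2) * dotv (G x) (Gphi x) + k (tau x) * phi x) = 0.
Proof.
move=> W1phi gphi iF; have [wphi iphi iGp] := W1_integrable (ltW m1) W1phi.
set F := (fun x => enorm (G x) `^ (m - 2) * dotv (G x) (Gphi x)) in iF *.
have ik := integrable_source_mul iphi.
have iD (f g : V -> R) : leb.-integrable B (EFin \o f) -> leb.-integrable B (EFin \o g) ->
    leb.-integrable B (EFin \o (fun x => f x + g x)).
  by move=> h1 h2; have := integrableD mB h1 h2; apply: eq_integrable.
split; first exact: iD.
have ip e : 0 < e -> leb.-integrable B (EFin \o (fun x => U (tau x) `^ e * phi x)).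
  move=> e0; have mUe : measurable_fun B (fun x : V => U (tau x) `^ e).
    apply: measurable_funTS; apply: (measurableT_comp (measurable_powRU hU UM e0)).
    exact: measurable_tau.
  have bUe (x : V) : B x -> `|U (tau x) `^ e| <= M `^ e.
    by move=> _; rewrite ger0_norm ?powR_ge0//; case/andP: (powR_bound UM (tau x) e0).
  exact: (integrable_mul_bounded mB mUe bUe iphi).
have ae0 := @ae_neq0 R N N0.
have mu' : measurable_fun B u by exact: integrable_measurable iu.
have mphi : measurable_fun B phi by exact: integrable_measurable iphi.
have mgp i : measurable_fun B (fun x => wgrad phi x ord0 i) by exact: integrable_measurable (iGp i).
have mup e : measurable_fun B (fun x => u x `^ e * phi x).
  apply: measurable_funM => //.
  exact: (@measurableT_comp _ _ _ _ _ _ (fun y : R => y `^ e)).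
have [_ _ /(_ phi W1phi) eqn] := su.
have iF1 := iD _ _ iF (ip _ m10).
have e1 : \int[leb]_(x in B) (F x + U (tau x) `^ (m - 1) * phi x) =
    \int[leb]_(x in B) (u x `^ (q - 1) * phi x).
  rewrite -eqn; apply: eq_Rintegral_ae => //.
  - exact: integrable_measurable iF1.
  - apply: measurable_funD => //; apply: measurable_funM; last exact: measurable_dotv.
    exact: measurable_enorm_powR.
  - apply: filterS2 gphi ae0 => x gx /eqP x0 Bx.
    by rewrite ray_profile_tau// /F gx.
have e2 : \int[leb]_(x in B) (U (tau x) `^ (q - 1) * phi x) =
    \int[leb]_(x in B) (u x `^ (q - 1) * phi x).
  apply: eq_Rintegral_ae => //; first exact: integrable_measurable (ip _ q10).
  by apply: filterS ae0 => x /eqP x0 Bx; rewrite ray_profile_tau.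
transitivity (\int[leb]_(x in B) ((F x + U (tau x) `^ (m - 1) * phi x) -
    U (tau x) `^ (q - 1) * phi x)).
  by apply: eq_Rintegral => x _; rewrite /k /source mulrBl addrA.
by rewrite (RintegralB mB iF1 (ip _ q10)) e1 e2 subrr.
Qed.

Let K := primitive k.

(** Test the equation with the constant 1: this is the Neumann condition. *)
Lemma solution_flux1 : K 1 = 0.
Proof.
apply: (flux1_eq0 N0 m1 mq hU UM).
have wc := @weak_gradient_cst R N 1.
have W1c : W1 m (fun _ : V => 1 : R).
  apply: (W1_bounded (M := 1) N0 m0 wc) => x; first by rewrite normr1.
  by move=> i _; rewrite mxE normr0.
have i0 : leb.-integrable B (EFin \o (fun x => enorm (G x) `^ (m - 2) * dotv (G x) (0 : V))).
  by under [X in EFin \o X]eq_fun do rewrite dotv0r mulr0; exact: integrable_cstB.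
have [_] := weak_equation W1c (wgrad_ae N0 wc) i0.
by under eq_Rintegral => x _ do rewrite dotv0r mulr0 add0r mulr1.
Qed.

Let K1 := solution_flux1.
Let h := slope N m K.
Let ch : continuous h. Proof. exact: (slope_continuous N0 m1 mq hU UM K1). Qed.
Let hM r : `|h r| <= M. Proof. exact: (slope_bound N0 m1 mq hU UM K1 r). Qed.
Let h0 : h 0 = 0. Proof. exact: slope0. Qed.
Let mh : measurable_fun setT h. Proof. exact: continuous_measurable_fun. Qed.
Let M0 : 0 <= M. Proof. exact: le_trans (hM 0). Qed.

Let Ut (x : V) := 0 + primitive h (enorm x).
Let H := radial_grad (N := N) h.
Let wH : weak_gradient Ut H. Proof. exact: weak_gradient_radial ch hM h0. Qed.
Let Hb x i : B x -> `|H x ord0 i| <= M.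
Proof. by move=> _; rewrite (le_trans (radial_grad_coord_le _ _ _)). Qed.
Let Utb x : B x -> `|Ut x| <= M.
Proof.
move=> Bx; rewrite /Ut add0r (le_trans (primitive_norm mh hM (enorm_ge0 x)))//.
by rewrite ler_piMr// ltW.
Qed.
Let W1Ut : W1 m Ut. Proof. exact: (W1_bounded N0 m0 wH Utb Hb). Qed.
Let mH i : measurable_fun B (fun x => H x ord0 i).
Proof. by case: wH => _ lH _; apply: locally_integrable_measurable; exact: lH. Qed.
Let iUt : leb.-integrable B (EFin \o Ut). Proof. by case: (W1_integrable (ltW m1) W1Ut). Qed.
Let iH i : leb.-integrable B (EFin \o (fun x => H x ord0 i)).
Proof. exact: (integrable_bounded mB (@lebesgue_B_lty R N) (mH i) (fun x => Hb i (x := x))). Qed.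

(** The four integrals obtained by testing the equation of u and that of the radial
    function with slope h, each with both functions, combine into the integral of a
    nonnegative function; the source terms cancel. *)
Lemma solution_gradient_ae : {ae leb, forall x, B x -> G x = H x}.
Proof.
have iGm := integrable_enorm_powR m1 (G := G) (let: And3 _ _ h := uW1 in h).
have i1 : leb.-integrable B (EFin \o (fun x => enorm (G x) `^ (m - 2) * dotv (G x) (G x))).
  apply: eq_integrable iGm => // x _; rewrite /= -enorm_sqr expr2 mulrA powR_mulr_self ?enorm_ge0//.
  congr EFin; have := enorm_ge0 (G x); rewrite le_eqVlt => /predU1P[<-|e0].
    by rewrite mulr0 powR0 ?gt_eqF.
  rewrite -{3}(powRr1 (ltW e0)) -powRD; last by rewrite (gt_eqF e0) implybT.
  by congr (_ `^ _); lra.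
have i2 : leb.-integrable B (EFin \o (fun x => enorm (G x) `^ (m - 2) * dotv (G x) (H x))).
  have iM : leb.-integrable B (EFin \o (fun x => M * (1 + enorm (G x) `^ m))).
    have h1 := integrableD mB (@integrable_cstB R N 1) iGm.
    by have := integrableZl mB M h1; apply: eq_integrable.
  apply: (integrable_le mB _ _ iM).
    apply: measurable_funM; last exact: measurable_dotv.
    exact: measurable_enorm_powR.
  move=> x Bx; rewrite normrM ger0_norm ?powR_ge0//.
  have eH : enorm (H x) <= M.
    have [->|x0] := eqVneq x 0; first by rewrite /H /radial_grad scaler0 enorm0.
    by rewrite enorm_radial_grad.
  apply: (@le_trans _ _ (enorm (G x) `^ (m - 2) * (enorm (G x) * M))).
    rewrite ler_wpM2l ?powR_ge0// (le_trans (normr_dotv_le _ _))//.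
    by rewrite ler_wpM2l ?enorm_ge0.
  rewrite mulrA powR_mulr_self ?enorm_ge0// mulrC ler_wpM2l//.
  have [e1|e1] := leP (enorm (G x)) 1.
    rewrite (@le_trans _ _ 1) ?lerDl ?powR_ge0//.
    have p1 : (1 : R) `^ (m - 1) = 1 by rewrite powR1.
    rewrite -[leRHS]p1; apply: ge0_ler_powR; rewrite ?nnegrE ?enorm_ge0 ?(ltW m10)//.
  rewrite (@le_trans _ _ (enorm (G x) `^ m)) ?lerDr//.
  by apply: ler_powR; [exact: ltW|rewrite gerBl].
have [I1 E1] := weak_equation uW1 (wgrad_ae N0 wG) i1.
have [I2 E2] := weak_equation W1Ut (wgrad_ae N0 wH) i2.
have [I3 E3] := radial_equation N0 m1 mq hU UM K1 wG iu iG.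
have [I4 E4] := radial_equation N0 m1 mq hU UM K1 wH iUt iH.
rewrite -/k -/K -/h -/H in I3 E3 I4 E4.
have iB (f g : V -> R) : leb.-integrable B (EFin \o f) -> leb.-integrable B (EFin \o g) ->
    leb.-integrable B (EFin \o (fun x => f x - g x)).
  by move=> h1 h2; have := integrableB mB h1 h2; apply: eq_integrable.
have I12 := iB _ _ I1 I2; have I34 := iB _ _ I3 I4; have I := iB _ _ I12 I34.
pose E x := enorm (G x) `^ (m - 2) * dotv (G x) (G x) - enorm (G x) `^ (m - 2) * dotv (G x) (H x)
    - enorm (H x) `^ (m - 2) * dotv (H x) (G x) + enorm (H x) `^ (m - 2) * dotv (H x) (H x).
(* a, b, c, d are the gradient terms and e, f the source terms of the two functions *)
have algE (a b c d e f : R) : ((a + e) - (b + f)) - ((c + e) - (d + f)) = a - b - c + d by ring.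
have IE : leb.-integrable B (EFin \o E).
  by apply: eq_integrable I => // x _; rewrite /= algE.
have E0 : \int[leb]_(x in B) E x = 0.
  under eq_Rintegral => x _ do rewrite /E -(algE _ _ _ _ (k (tau x) * u x) (k (tau x) * Ut x)).
  by rewrite (RintegralB mB I12 I34) (RintegralB mB I1 I2) (RintegralB mB I3 I4) E1 E2 E3 E4 !subrr.
have := Rintegral_ge0_eq0 mB IE (fun x _ => (powR_field_monotone (G x) (H x) m1).1) E0.
by apply: filterS => x e0 Bx; exact: (powR_field_monotone (G x) (H x) m1).2 (e0 Bx).
Qed.

Let v (x : V) : R := u x - Ut x.

Let wv : weak_gradient v (fun=> 0 : V).
Proof.
have iv : leb.-integrable B (EFin \o v).
  by have := integrableB mB iu iUt; apply: eq_integrable.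
apply: (weak_gradient_ae (weak_gradientB wG wH iu iUt iG iH) iv).
- by move=> i; under [X in EFin \o X]eq_fun do rewrite mxE; exact: integrable_cstB.
- exact: aeW.
- by apply: filterS solution_gradient_ae => x h' Bx; rewrite h'// subrr.
Qed.

Let iv : leb.-integrable B (EFin \o v).
Proof. by have := integrableB mB iu iUt; apply: eq_integrable. Qed.

(** The constant in u = c + int_0^|x| h, as the mean of the difference. *)
Definition mean_height : R := (\int[leb]_(x in B) v x) / omega R N.
Local Notation c := mean_height.

Let layer (a b x : R) : R := (a < x)%R%:R - (b < x)%R%:R.

Let layer_int (f : V -> R) a b : leb.-integrable B (EFin \o f) ->
  leb.-integrable B (EFin \o (fun x => layer a b (tau x) * f x)) /\
  \int[leb]_(x in B) (layer a b (tau x) * f x) =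
  \int[leb]_(x in B) ((a < tau x)%R%:R * f x) - \int[leb]_(x in B) ((b < tau x)%R%:R * f x).
Proof.
move=> fi; have ia := integrable_gt_tau a fi; have ib := integrable_gt_tau b fi.
split.
  by have := integrableB mB ia ib; apply: eq_integrable => // x _; rewrite /= mulrBl.
under eq_Rintegral => x _ do rewrite mulrBl.
by rewrite (RintegralB mB ia ib).
Qed.

Let layer_v a b : 0 <= a <= b -> b <= 1 ->
  \int[leb]_(x in B) (layer a b (tau x) * v x) = (b - a) * (c * omega R N).
Proof.
move=> /andP[a0 ab] b1; rewrite (layer_int a b iv).2.
rewrite (gauss_no_gradient N0 _ wv iv) ?a0 ?(le_trans ab)//.
rewrite (gauss_no_gradient N0 _ wv iv) ?b1 ?(le_trans a0)//.
by rewrite /c divfK ?gt_eqF ?omega_gt0//; ring.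
Qed.

Let layer_cst a b (d : R) : 0 <= a <= b -> b <= 1 ->
  \int[leb]_(x in B) (layer a b (tau x) * d) = (b - a) * (d * omega R N).
Proof.
move=> /andP[a0 ab] b1; have i1 := @integrable_cstB R N 1.
have [ia ea] := layer_int a b i1.
have E : \int[leb]_(x in B) (layer a b (tau x) * 1) = (b - a) * omega R N.
  have wc := @weak_gradient_cst R N 1.
  rewrite ea (gauss_no_gradient N0 _ wc i1) ?a0 ?(le_trans ab)//.
  rewrite (gauss_no_gradient N0 _ wc i1) ?b1 ?(le_trans a0)//.
  rewrite Rintegral_cst// -/(omega R N); ring.
under eq_Rintegral => x _ do rewrite -[layer a b (tau x)]mulr1 mulrC.
by rewrite (RintegralZl d mB ia) E; ring.
Qed.

Let Hp := primitive h.

Let Hhomo : {homo Hp : s t / s <= t}.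
Proof.
apply: (primitive_homo (M := M) ch) => r; rewrite slope_ge0/=.
by rewrite (le_trans (ler_norm _)).
Qed.

(** The mean over a thin annulus equals the mean over the ball, and on the annulus the
    difference of two nondecreasing functions lies between its extreme values. *)
Lemma mean_height_itv (r s : R) : 0 <= r -> r < s -> s <= 1 ->
  U (r ^+ N) - Hp s <= c <= U (s ^+ N) - Hp r.
Proof.
move=> r0 rs s1; have s0 : 0 <= s by exact: le_trans (ltW rs).
have rsN : r ^+ N < s ^+ N by rewrite ltrXn2r ?gtn_eqF.
have ab : 0 <= r ^+ N <= s ^+ N by rewrite exprn_ge0// ltW.
have b1 : s ^+ N <= 1 by rewrite exprn_ile1.
have D0 : 0 < (s ^+ N - r ^+ N) * omega R N by rewrite mulr_gt0 ?subr_gt0 ?omega_gt0.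
have inlayer x : B x -> x != 0 ->
    layer (r ^+ N) (s ^+ N) (tau x) = 0 \/
    layer (r ^+ N) (s ^+ N) (tau x) = 1 /\ U (r ^+ N) - Hp s <= v x <= U (s ^+ N) - Hp r.
  move=> Bx x0; rewrite /layer; have [rt|tr] := ltP (r ^+ N) (tau x); last first.
    by left; rewrite ltNge (le_trans tr (ltW rsN)) subrr.
  have [st|ts] := ltP (s ^+ N) (tau x); first by left; rewrite subrr.
  right; split; first by rewrite subr0.
  have re : r <= enorm x.
    rewrite leNgt; apply/negP => h'; move: rt; rewrite tauE// ltNge => /negP; apply.
    by apply: lerXn2r; rewrite ?nnegrE ?enorm_ge0 ?(ltW h').
  have es : enorm x <= s.
    rewrite leNgt; apply/negP => h'; move: ts; rewrite tauE// leNgt => /negP; apply.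
    by rewrite ltrXn2r ?gtn_eqF.
  rewrite /v /Ut add0r -ray_profile_tau//; apply/andP; split.
    by apply: lerB; [exact: hU (ltW rt)|exact: Hhomo].
  by apply: lerB; [exact: hU|exact: Hhomo].
have mono (f g : V -> R) : leb.-integrable B (EFin \o f) -> leb.-integrable B (EFin \o g) ->
   (forall x, B x -> x != 0 -> f x <= g x) -> \int[leb]_(x in B) f x <= \int[leb]_(x in B) g x.
  move=> fi gi fg; rewrite -subr_ge0 -(RintegralB mB gi fi).
  have fgi : leb.-integrable B (EFin \o (fun x => g x - f x)).
    by have := integrableB mB gi fi; apply: eq_integrable.
  (* the inequality may fail at the origin, where truncation makes it true *)
  rewrite (@eq_Rintegral_ae _ _ _ leb B _ (fun x => Num.max (g x - f x) 0)) //.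
  - by apply: Rintegral_ge0 => x _; rewrite le_max lexx orbT.
  - exact: integrable_measurable fgi.
  - apply: measurable_maxr => //; exact: integrable_measurable fgi.
  - apply: filterS (@ae_neq0 R N N0) => x /eqP x0 Bx.
    by rewrite max_l// subr_ge0 fg.
have ilv := (layer_int (r ^+ N) (s ^+ N) iv).1.
have ilc (d : R) := (layer_int (r ^+ N) (s ^+ N) (@integrable_cstB R N d)).1.
apply/andP; split; rewrite -(ler_pM2l D0) -!mulrA ![omega R N * _]mulrC.
  rewrite -(layer_v ab b1) -(layer_cst _ ab b1); apply: mono => // x Bx x0.
  by have [->|[-> /andP[h1 _]]] := inlayer x Bx x0; rewrite ?mul0r// !mul1r.
rewrite -(layer_v ab b1) -(layer_cst _ ab b1); apply: mono => // x Bx x0.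
by have [->|[-> /andP[_ h1]]] := inlayer x Bx x0; rewrite ?mul0r// !mul1r.
Qed.

(** Let the annulus shrink to a sphere; the radial function is continuous. *)
Lemma ray_profileE r : 0 < r < 1 -> U (r ^+ N) = c + Hp r.
Proof.
move=> /andP[r0 r1]; have M1 : 0 < M + 1 by rewrite ltr_wpDl.
have lip s t : `|Hp t - Hp s| <= (M + 1) * `|s - t|.
  rewrite (le_trans (primitive_lipschitz s t mh hM))//.
  by rewrite (distrC t) ler_wpM2r// lerDl.
apply/eqP; rewrite eq_le; apply/andP; split; apply/ler_addgt0Pr => e e0.
  (* so close to r that the Lipschitz function changes by at most e; M + 1 > 0 *)
  pose s := Num.min 1 (r + e / (M + 1)).
  have rs : r < s by rewrite lt_min r1 ltrDl divr_gt0.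
  have s1 : s <= 1 by rewrite ge_min lexx.
  have sr : s - r <= e / (M + 1) by rewrite lerBlDl ge_min lexx orbT.
  have /andP[h1 _] := mean_height_itv (ltW r0) rs s1.
  have := le_trans (ler_norm _) (lip r s); rewrite distrC ger0_norm ?subr_ge0 ?(ltW rs)//.
  move=> h2; have : (M + 1) * (s - r) <= e by rewrite mulrC -ler_pdivlMr.
  by lra.
pose s := Num.max 0 (r - e / (M + 1)).
have sr : s < r by rewrite gt_max r0 ltrBlDr ltrDl divr_gt0.
have s0 : 0 <= s by rewrite le_max lexx.
have rs : r - s <= e / (M + 1) by rewrite lerBlDr addrC -lerBlDr le_max lexx orbT.
have /andP[_ h1] := mean_height_itv s0 sr (ltW r1).
have := le_trans (ler_norm _) (lip s r); rewrite distrC ger0_norm ?subr_ge0 ?(ltW sr)//.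
move=> h2; have : (M + 1) * (r - s) <= e by rewrite mulrC -ler_pdivlMr.
by lra.
Qed.

End solution_gradient.

(** * Bounds independent of the exponent *)

Section source_sign.
Context (R : realType).
Local Notation mu := (@lebesgue_measure R).
Implicit Types (m q s t : R) (k U : R -> R).

Lemma source_eq0 m q U t : m < q -> 0 < U t -> source m q U t = 0 -> U t = 1.
Proof.
move=> mq U0 /eqP; rewrite subr_eq0 => /eqP e.
have qm : q - m != 0 by rewrite subr_eq0 gt_eqF.
have e1 : U t `^ (q - m) = 1.
  apply: (@mulfI _ (U t `^ (m - 1))); first by rewrite gt_eqF ?powR_gt0.
  rewrite mulr1 -powRD; last by rewrite (gt_eqF U0) implybT.
  by rewrite [in RHS]e; congr (_ `^ _); ring.
by rewrite -(powR_invK (ltW U0) qm) e1 powR1.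
Qed.

(** A nonnegative function of integral 0 vanishes almost everywhere. *)
Lemma primitive_eq0_root k C : measurable_fun setT k -> (forall t, `|k t| <= C) ->
  (forall t, 0 <= k t) -> primitive k 1 = 0 -> exists2 t, 0 < t < 1 & k t = 0.
Proof.
move=> mk kC k0 K1; apply: contrapT => H.
have := Rintegral_ge0_eq0 _ (@integrable_bounded_itv R k C 0 1 true false mk kC) (fun t _ => k0 t) K1.
move=> /(_ (measurable_itv _)) [A [mA A0 sA]].
have : (mu `]0%R, 1%R[%classic <= 0)%E.
  rewrite -A0; apply: le_measure; rewrite ?inE//.
  move=> t; rewrite /= in_itv/= => /andP[t0 t1]; apply: sA => /= h; apply: H.
  by exists t; rewrite ?t0 ?t1// h// in_itv/= (ltW t0) (ltW t1).
by rewrite lebesgue_measure_itv/= lte_fin ltr01 oppr0 addr0 lee_fin ler10.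
Qed.

(** Below the level 1 the source is positive and above it is negative, so that it could not
    have mean zero if U stayed on one side. *)
Lemma flux1_eq0_crossing m q U a b : 1 < m -> m < q -> {homo U : s t / s <= t} ->
  0 < a -> (forall t, a <= U t <= b) -> primitive (source m q U) 1 = 0 -> a <= 1 <= b.
Proof.
move=> m1 mq hU a0 Uab K1.
have UM t : 0 <= U t <= b.
  by have /andP[h ->] := Uab t; rewrite andbT (le_trans (ltW a0)).
have mk := measurable_source m1 mq hU UM; have kC := source_bound m1 mq UM.
have cross t : source m q U t = 0 -> a <= 1 <= b.
  move=> kt; have /andP[h1 h2] := Uab t.
  by rewrite -(source_eq0 mq (lt_le_trans a0 h1) kt) h1.
have [a1|a1] := leP a 1; last first.
  have k0 t : 0 <= -1 * source m q U t.
    rewrite mulN1r oppr_ge0; apply: source_le0 => //.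
    by case/andP: (Uab t) => h _; rewrite (le_trans (ltW a1)).
  have mk' : measurable_fun setT (fun t => -1 * source m q U t) by exact: measurable_funM.
  have kC' t : `|-1 * source m q U t| <= b `^ (m - 1) + b `^ (q - 1) by rewrite mulN1r normrN.
  have K1' : primitive (fun t => -1 * source m q U t) 1 = 0 by rewrite (primitiveZ _ _ mk kC) K1 mulr0.
  have [t _ /eqP] := primitive_eq0_root mk' kC' k0 K1'.
  by rewrite mulN1r oppr_eq0 => /eqP/cross; rewrite leNgt a1.
have [b1|b1] := leP 1 b; first by [].
have k0 t : 0 <= source m q U t.
  apply: (source_ge0 m1 mq UM).
  by case/andP: (Uab t) => _ h; rewrite (le_trans h)// ltW.
have [t _ /cross/andP[_]] := primitive_eq0_root mk kC k0 K1.
by rewrite leNgt b1.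
Qed.

End source_sign.

Section solution_profile.
Context (R : realType) (N : nat).
Local Notation V := 'rV[R]_N.
Local Notation leb := (@lebesgue_rV R N).
Local Notation mu := (@lebesgue_measure R).
Local Notation B := (@B R N).
Hypothesis N0 : (0 < N)%N.
Variables (m q : R) (u : V -> R).
Hypotheses (m1 : 1 < m) (mq : m < q) (su : solution m q u).

Let U := ray_profile N0 u.
Let M := u (ray N0 (1 : R)).
Let hU : {homo U : s t / s <= t}. Proof. exact: (ray_profile_homo N0 su). Qed.
Let UM t : 0 <= U t <= M. Proof. exact: (ray_profile_bounds N0 su t). Qed.
Let K := primitive (source m q U).
Let K1 : K 1 = 0. Proof. exact: (solution_flux1 N0 m1 mq su). Qed.
Let h := slope N m K.
Let c := mean_height N0 m q u.
Let W := volume_profile N c h.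

Let ch : continuous h. Proof. exact: (slope_continuous N0 m1 mq hU UM K1). Qed.
Let hM r : 0 <= h r <= M.
Proof.
rewrite slope_ge0/=; apply: le_trans (ler_norm _) _.
exact: (slope_bound N0 m1 mq hU UM K1 r).
Qed.
Let mh : measurable_fun setT h. Proof. exact: continuous_measurable_fun. Qed.
Let hMn r : `|h r| <= M. Proof. by have /andP[a b] := hM r; rewrite ger0_norm. Qed.
Let Hhomo : {homo primitive h : s t / s <= t}. Proof. exact: primitive_homo ch hM. Qed.
Let H_ge0 r : 0 <= primitive h r.
Proof. by apply: Rintegral_ge0 => s _; case/andP: (hM s). Qed.

Let UE r : 0 < r < 1 -> U (r ^+ N) = c + primitive h r.
Proof. exact: (ray_profileE N0 m1 mq su). Qed.

Let WU t : 0 < t < 1 -> W t = U t.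
Proof.
move=> /andP[t0 t1]; have n0 : N%:R != 0 :> R by rewrite pnatr_eq0 gtn_eqF.
have t01 : 0 <= t <= 1 by rewrite (ltW t0) (ltW t1).
have e : (t `^ N%:R^-1) ^+ N = t by rewrite -powR_mulrn ?powR_ge0// -powRrM mulVf// powRr1// ltW.
rewrite /W /volume_profile clamp01_id// -[in RHS]e UE// powR_gt0//=.
have p1 : (1 : R) `^ N%:R^-1 = 1 by rewrite powR1.
by rewrite -[ltRHS]p1; apply: gt0_ltr_powR; rewrite ?nnegrE ?invr_gt0 ?ltr0n ?(ltW t0).
Qed.

Let slope_le_profile r : 0 < r < 1 -> h r <= c + primitive h r.
Proof.
move=> r01; rewrite -UE//; apply: (slope_le N0 m1 mq hU UM K1).
by case/andP: r01 => -> /ltW.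
Qed.

Let H_le (s t X : R) : 0 <= s -> s <= t -> (forall r, s < r -> r <= t -> h r <= X) ->
  primitive h t - primitive h s <= X * (t - s).
Proof.
move=> s0 st hX; rewrite (primitiveB mh hMn s0 st) -Rintegral_itv_oc_cst//.
apply: le_Rintegral => //.
- exact: (integrable_bounded_itv s t false false mh hMn).
- exact: (@integrable_bounded_itv R (fun=> _) `|X|).
- by move=> r; rewrite /= in_itv/= => /andP[sr rt]; exact: hX.
Qed.

Let half01 : 0 < (1 / 2 : R) < 1. Proof. by lra. Qed.

Let H_half : primitive h (1 / 2) <= c.
Proof.
have := @H_le 0 (1 / 2) (c + primitive h (1 / 2)) (lexx 0) (ltW (andP half01).1).
rewrite (primitive_le0 h (lexx 0)) !subr0 => H1.
have : primitive h (1 / 2) <= (c + primitive h (1 / 2)) * (1 / 2).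
  apply: H1 => r r0 rh; apply: (le_trans (slope_le_profile _)).
    by rewrite r0 (le_lt_trans rh)//; case/andP: half01.
  by rewrite lerD2l Hhomo.
by move: (primitive h (1 / 2)) => y; lra.
Qed.

Let c_gt0 : 0 < c.
Proof.
have U0 : 0 < U ((1 / 2) ^+ N).
  apply: (ray_profile_gt0 N0 su); case/andP: half01 => a b.
  by rewrite exprn_gt0//= exprn_ilt1 ?gtn_eqF// ltW.
by rewrite UE// in U0; have := H_half; lra.
Qed.

Let H_one : c + primitive h 1 <= 4 * c.
Proof.
have half1 : (1 / 2 : R) <= 1 by lra.
have H1 : primitive h 1 - primitive h (1 / 2) <= (c + primitive h 1) * (1 - 1 / 2).
  apply: H_le => //.
  (* the slope vanishes on the boundary, where the bound by u is not available *)
  move=> r r0; rewrite le_eqVlt => /predU1P[->|r1].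
    by rewrite /h (slope1 _ m1)// addr_ge0 ?(ltW c_gt0).
  apply: (le_trans (slope_le_profile _)); first by rewrite r1 andbT; lra.
  by rewrite lerD2l Hhomo// ltW.
by move: H1 H_half; move: (primitive h 1) (primitive h (1 / 2)) => a b; lra.
Qed.

Let W_bounds t : c <= W t <= c + primitive h 1.
Proof.
rewrite /W lerDl H_ge0/= lerD2l Hhomo//.
by case/andP: (root_le1 N (clamp01_itv t)).
Qed.

Let hW : {homo W : s t / s <= t}. Proof. exact: (volume_profile_homo N c ch hM). Qed.
Let WM t : 0 <= W t <= c + primitive h 1.
Proof. by have /andP[a ->] := W_bounds t; rewrite andbT (le_trans (ltW c_gt0)). Qed.

Let KW t : 0 <= t <= 1 -> primitive (source m q W) t = K t.
Proof.
move=> /andP[t0 t1]; apply: eq_Rintegral_ae => //.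
- by apply: measurable_funTS; exact: (measurable_source m1 mq hW WM).
- by apply: measurable_funTS; exact: (measurable_source m1 mq hU UM).
(* U and W may differ at the end points *)
exists [set 0; 1]; split.
- by apply: measurableU; exact: measurable_set1.
- exact/countable_lebesgue_measure0/finite_set_countable/finite_set2.
move=> s /= H; apply: contrapT => /not_orP[/eqP s0 /eqP s1]; apply: H.
rewrite in_itv/= => /andP[h1 h2].
rewrite /source WU//; rewrite lt_neqAle eq_sym s0 h1/= lt_neqAle s1.
exact: le_trans t1.
Qed.

Let KW1 : primitive (source m q W) 1 = 0. Proof. by rewrite KW ?lexx ?ler01. Qed.

Lemma solution_profile : profile N m q c h.
Proof.
have /andP[c1 c1'] := flux1_eq0_crossing m1 mq hW c_gt0 W_bounds KW1.
have C4 : c + primitive h 1 <= 4.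
  by rewrite (le_trans H_one)//; lra.
have hE r : h r = slope N m (primitive (source m q W)) r.
  rewrite /h /slope KW//; have /andP[a b] := clamp01_itv r.
  by rewrite exprn_ge0//= exprn_ile1.
split=> //.
- exact: slope0.
- move=> r; rewrite slope_ge0/=.
  have -> : h r = h (clamp01 r) by rewrite /h /slope (clamp01_id (clamp01_itv r)).
  have /andP[] := clamp01_itv r; rewrite le_eqVlt => /predU1P[<- _|r0].
    by rewrite [h 0](slope0 N0 q U m1).
  rewrite le_eqVlt => /predU1P[->|r1]; first by rewrite [h 1](slope1 N m1 K1).
  rewrite (le_trans (slope_le_profile _)) ?r0//.
  by rewrite (le_trans _ C4)// lerD2l Hhomo// ltW.
- by split=> //; have := H_one; lra.
Qed.

Lemma solution_profile_fun x : B x -> x != 0 -> u x = profile_fun c h x.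
Proof.
move=> Bx x0; rewrite -(ray_profile_tau N0 su Bx x0) tauE// -/U UE//.
by rewrite enorm_gt0 x0.
Qed.

End solution_profile.

(** * Compactness of profiles *)

Section ascoli.
Context (R : realType).
Implicit Types (r s : R).

(** Ultrafilters converge in compact sets. *)
Lemma ultra_compact_cvg (T : Type) (F : set_system T) (f : T -> R) (a b : R) :
  UltraFilter F -> (forall t, a <= f t <= b) -> exists y : R, f @ F --> y.
Proof.
move=> UF fab; have FF : ProperFilter F by exact: ultra_proper.
have iF : (f @ F) `[a, b]%classic.
  by apply: (@filterE _ F) => t; rewrite /= in_itv/=; exact: fab.
have [y [_ cy]] := @segment_compact R a b _ (fmap_proper_filter f FF) iF.
exists y => A nA; have [//|nF] := in_ultra_setVsetC (f @^-1` A) UF.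
by have [z []] := cy (~` A) A nF nA.
Qed.

(** Along an ultrafilter all pointwise limits exist at once, and the convergence is uniform
    by the Lipschitz bound on a finite grid.  The subsequence is then chosen among the
    indices with small distance to the limit, which form sets of the ultrafilter. *)
Lemma lipschitz_subsequence (f_ : nat -> R -> R) (a b L : R) :
  (forall n r, 0 <= r <= 1 -> a <= f_ n r <= b) ->
  (forall n r s, `|f_ n r - f_ n s| <= L * `|r - s|) ->
  exists k : nat -> nat, {homo k : i j / (i < j)%N} /\
  exists f : R -> R, forall n r, 0 <= r <= 1 -> `|f_ (k n) r - f r| <= n.+1%:R^-1.
Proof.
(* finer than the filter at infinity, so its sets are infinite *)
move=> fab fL; have [F [UF ooF]] := ultraFilterLemma (F := \oo) _.
have FF : ProperFilter F by exact: ultra_proper.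
have L0 : 0 <= L by have := fL 0%N 1 0; rewrite subr0 normr1 mulr1; exact: le_trans.
have Hf r : exists y : R, 0 <= r <= 1 -> f_ ^~ r @ F --> y.
  have [r01|nr] := pselect (0 <= r <= 1); last by exists 0.
  by have [y hy] := ultra_compact_cvg UF (fun n => fab n r r01); exists y.
have [f hf] := choice Hf.
have lipf r s : 0 <= r <= 1 -> 0 <= s <= 1 -> `|f r - f s| <= L * `|r - s|.
  move=> r01 s01; apply: (ler_cvg_to (a := F) (f := fun n => `|f_ n r - f_ n s|)
     (g := fun=> L * `|r - s|)).
  - by apply: cvg_norm; apply: cvgB; exact: hf.
  - exact: cvg_cst.
  - by apply: nearW => n; exact: fL.
have unif e : 0 < e -> F [set n | forall r, 0 <= r <= 1 -> `|f_ n r - f r| <= e].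
  (* mesh of the grid with L times the mesh at most e/3 *)
  move=> e0; pose m := Num.bound (3 * L / e).
  have hm : L / m.+1%:R <= e / 3.
    rewrite ler_pdivrMr// mulrC -ler_pdivrMr ?divr_gt0//.
    have := archi_boundP (divr_ge0 (mulr_ge0 (ler0n R 3) L0) (ltW e0)); rewrite -/m => h.
    rewrite (_ : L / (e / 3) = 3 * L / e); last by field; exact: lt0r_neq0.
    by rewrite (le_trans (ltW h))// ler_nat.
  pose x (i : 'I_m.+2) : R := i%:R / m.+1%:R.
  have x01 i : 0 <= x i <= 1.
    by rewrite divr_ge0//= ler_pdivrMr// mul1r ler_nat -ltnS.
  have grid : \forall n \near F, forall i, `|f_ n (x i) - f (x i)| < e / 3.
    apply: filter_forall => i; have := hf _ (x01 i).
    by move/cvgrPdist_lt => /(_ _ (divr_gt0 e0 (ltr0n R 3))); apply: filterS => n; rewrite distrC.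
  apply: filterS grid => n hn r /[dup] r01 /andP[r0 r1].
  have rm : 0 <= r * m.+1%:R by rewrite mulr_ge0.
  have /andP[h1 h2] := truncn_itv rm.
  have im : (Num.truncn (r * m.+1%:R) < m.+2)%N.
    by rewrite ltnS -(ler_nat R) (le_trans h1)// ler_piMl.
  pose i := Ordinal im.
  have rx : `|r - x i| <= m.+1%:R^-1.
    rewrite ger0_norm; last by rewrite subr_ge0 ler_pdivrMr.
    rewrite lerBlDl -[X in _ + X]mul1r -mulrDl ler_pdivlMr//.
    by rewrite natr1 ltW.
  have Lrx : L * `|r - x i| <= e / 3.
    by apply: le_trans hm; rewrite ler_wpM2l.
  have t1 := le_trans (fL n r (x i)) Lrx.
  have t2 := le_trans (lipf (x i) r (x01 i) r01) (le_trans _ Lrx).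
  have {}t2 : `|f (x i) - f r| <= e / 3 by apply: t2; rewrite distrC.
  have t3 := ltW (hn i).
  have -> : f_ n r - f r = (f_ n r - f_ n (x i)) + (f_ n (x i) - f (x i)) + (f (x i) - f r) by ring.
  rewrite (le_trans (ler_normD _ _))// (le_trans (lerD (ler_normD _ _) (lexx _)))//.
  rewrite (le_trans (lerD (lerD t1 t3) t2))//; lra.
have pick j m : exists n, (m < n)%N /\ forall r, 0 <= r <= 1 -> `|f_ n r - f r| <= j.+1%:R^-1.
  have h1 : F [set n | (m < n)%N] by apply: ooF; exact: nbhs_infty_gt.
  have h2 : F [set n | forall r, 0 <= r <= 1 -> `|f_ n r - f r| <= j.+1%:R^-1].
    by apply: unif; rewrite invr_gt0.
  by have [n [? ?]] := filter_ex (filterI h1 h2); exists n.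
have [g hg] := choice (fun jm : nat * nat => pick jm.1 jm.2).
pose k := fix k n := if n is j.+1 then g (j.+1, k j) else g (0%N, 0%N).
have kE n r : 0 <= r <= 1 -> `|f_ (k n) r - f r| <= n.+1%:R^-1.
  by case: n => [|n] r01; exact: (hg _).2.
exists k; split.
  by apply: homo_ltn; [exact: ltn_trans|move=> i; exact: (hg (i.+1, k i)).1].
by exists f.
Qed.

End ascoli.

Section profile_limit.
Context (R : realType) (N : nat).
Local Notation mu := (@lebesgue_measure R).
Hypothesis N0 : (0 < N)%N.
Variables (p_ : nat -> R) (p q : R) (c_ : nat -> R) (h_ : nat -> R -> R) (f : R -> R).
Hypotheses (p1_ : forall n, 1 < p_ n) (p1 : 1 < p) (pq : p < q) (pq_ : forall n, p_ n < q).
Hypotheses (pc : p_ @ \oo --> p) (ph : forall n, profile N (p_ n) q (c_ n) (h_ n)).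
Hypothesis fc : forall r, 0 <= r <= 1 -> c_ n + primitive (h_ n) r @[n --> \oo] --> f r.

Let W_ n := volume_profile N (c_ n) (h_ n).
Let W (t : R) := f (clamp01 t `^ N%:R^-1).
Let k_ n := source (p_ n) q (W_ n).
Let k := source p q W.
Let K := primitive k.
Let h := slope N p K.

Let Wc t : W_ n t @[n --> \oo] --> W t.
Proof. by apply: fc; exact: root_le1 (clamp01_itv t). Qed.

Let W_bounds_ n t : 1 / 4 <= W_ n t <= 4. Proof. exact: volume_profile_bounds (ph n) t. Qed.
Let WM_ n t : 0 <= W_ n t <= 4.
Proof. by have /andP[a ->] := W_bounds_ n t; rewrite andbT (le_trans _ a)// divr_ge0. Qed.
Let h4_ n r : 0 <= h_ n r <= 4. Proof. by case: (ph n). Qed.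
Let hW_ n : {homo W_ n : s t / s <= t}.
Proof. by case: (ph n) => ch _ h4 _ _; exact: (volume_profile_homo N (c_ n) ch h4). Qed.

Let W_bounds t : 0 <= W t <= 4.
Proof.
apply/andP; split.
  by apply: (ler_cvg_to (cvg_cst 0) (@Wc t)); apply: nearW => n; case/andP: (WM_ n t).
by apply: (ler_cvg_to (@Wc t) (cvg_cst (4 : R))); apply: nearW => n; case/andP: (WM_ n t).
Qed.

Let hW : {homo W : s t / s <= t}.
Proof.
by move=> s t st; apply: (ler_cvg_to (@Wc s) (@Wc t)); apply: nearW => n; exact: hW_.
Qed.

Let kc t : k_ n t @[n --> \oo] --> k t.
Proof.
have W0 n : 0 <= W_ n t by case/andP: (WM_ n t).
apply: cvgB; apply: (powR_cvg _ W0 _ (@Wc t)).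
- by rewrite subr_gt0.
- by apply: cvgB => //; exact: cvg_cst.
- by rewrite subr_gt0 (lt_trans p1).
- exact: cvg_cst.
Qed.

Let mk_ n : measurable_fun setT (k_ n).
Proof. exact: (measurable_source (p1_ n) (pq_ n) (@hW_ n) (@WM_ n)). Qed.

Let D : R := 4 `^ (q - 1) + 4 `^ (q - 1).
Let kD n t : `|k_ n t| <= D.
Proof.
apply: le_trans (source_bound (p1_ n) (pq_ n) (@WM_ n) t) _.
by rewrite lerD2r ler_powR ?ler1n// lerD2r ltW.
Qed.

Let Kc t : primitive (k_ n) t @[n --> \oo] --> K t.
Proof.
apply: (proj2 (Rintegral_dominated_cvg (mu := mu) (g := fun=> D) _ _ _ _ _)) => //.
- by move=> n; apply: measurable_funTS; exact: mk_.
- by apply: (@integrable_bounded_itv R (fun=> D) `|D|).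
Qed.

Let K1_ n : primitive (k_ n) 1 = 0. Proof. by case: (ph n) => _ _ _ _ []. Qed.

Let K1 : K 1 = 0.
Proof.
have H : (fun=> 0 : R) @ \oo --> K 1.
  by have := @Kc 1; under eq_fun do rewrite K1_.
exact: (cvg_unique _ H (cvg_cst (0 : R))).
Qed.

(** The flux converges by dominated convergence, and the slope is a continuous function of
    the flux and of the exponent. *)
Lemma slope_cvg r : h_ n r @[n --> \oo] --> h r.
Proof.
have hE n : h_ n r = slope N (p_ n) (primitive (k_ n)) r by case: (ph n) => _ _ _ _ [].
under eq_fun do rewrite hE.
apply: (powR_cvg (F := \oo) (f := fun n => primitive (k_ n) (clamp01 r ^+ N) / (N%:R * clamp01 r ^+ N.-1))).
- move=> n; case/andP: (flux_ratio_bound N0 (p1_ n) (pq_ n) (@hW_ n) (@WM_ n) (K1_ n) (clamp01_itv r)) => //.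
- by rewrite invr_gt0 subr_gt0.
- by apply: cvgM; [exact: Kc|exact: cvg_cst].
- apply: cvgV; first by rewrite gt_eqF// subr_gt0.
  by apply: cvgB => //; exact: cvg_cst.
Qed.

Lemma limit_profileE r : 0 <= r <= 1 -> f r = f 0 + primitive h r.
Proof.
move=> r01; have z01 : 0 <= (0 : R) <= 1 by rewrite lexx ler01.
have cc : c_ n @[n --> \oo] --> f 0.
  by have := fc z01; under eq_fun do rewrite (primitive_le0 _ (lexx 0)) addr0.
have hc : primitive (h_ n) r @[n --> \oo] --> primitive h r.
  apply: (proj2 (Rintegral_dominated_cvg (mu := mu) (g := fun=> 4) _ _ _ _ _)) => //.
  - move=> n; apply: measurable_funTS; case: (ph n) => ch _ _ _ _.
    exact: continuous_measurable_fun.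
  - by move=> t _; exact: slope_cvg.
  - by apply: (@integrable_bounded_itv R (fun=> 4) 4) => // t; rewrite ger0_norm.
  - by move=> n t _; case/andP: (h4_ n t) => a b; rewrite ger0_norm.
exact: (cvg_unique _ (fc r01) (cvgD cc hc)).
Qed.

Lemma limit_profile : profile N p q (f 0) h.
Proof.
have WE : volume_profile N (f 0) h = W.
  by apply/funext => t; rewrite /volume_profile -limit_profileE//; exact: root_le1 (clamp01_itv t).
split; rewrite ?WE.
- exact: (slope_continuous N0 p1 pq hW W_bounds K1).
- exact: (slope0 N0 q W p1).
- move=> r; rewrite slope_ge0/=.
  by apply: (ler_cvg_to (@slope_cvg r) (cvg_cst (4 : R))); apply: nearW => n; case/andP: (h4_ n r).
- rewrite -limit_profileE ?lexx ?ler01//; split.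
    apply: (ler_cvg_to (cvg_cst _) (fc _)); first by rewrite lexx ler01.
    apply: nearW => n; case/andP: (profile_bounds (ph n) ler01) => //.
  apply: (ler_cvg_to (fc _) (cvg_cst (4 : R))); first by rewrite lexx ler01.
  by apply: nearW => n; case/andP: (profile_bounds (ph n) (lexx 1)).
- by [].
Qed.

End profile_limit.

(** * Convergence in Lebesgue and Hoelder norms *)

Section norm_convergence.
Context (R : realType) (N : nat).
Local Notation V := 'rV[R]_N.
Local Notation leb := (@lebesgue_rV R N).
Local Notation B := (@B R N).
Local Notation cB := (@cB R N).
Implicit Types (f w : V -> R).

Lemma cvg_EFin_real (r_ : nat -> R) (a : R) : r_ @ \oo --> a ->
  (r_ n)%:E @[n --> \oo] --> a%:E.
Proof. by move=> ra; apply: cvg_EFin; [exact: nearW|exact: ra]. Qed.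

(** Dominated convergence, applied to representatives g that converge everywhere. *)
Lemma LB_norm_cvg0 (p M : R) (f_ g_ : nat -> V -> R) : 0 < p ->
  (forall n, measurable_fun B (f_ n)) -> (forall n, measurable_fun B (g_ n)) ->
  (forall n, {ae leb, forall x, B x -> f_ n x = g_ n x}) ->
  (forall n x, B x -> `|g_ n x| <= M) ->
  (forall x, B x -> g_ n x @[n --> \oo] --> (0 : R)) ->
  LB_norm p (f_ n) @[n --> \oo] --> 0%E.
Proof.
move=> p0 mf mg fg gM g0; have mB := @measurable_B R N.
have mp f : measurable_fun B f -> measurable_fun B (fun x => `|f x| `^ p).
  exact: measurable_norm_powR.
have bp n x : B x -> `| `|g_ n x| `^ p | <= M `^ p.
  move=> Bx; rewrite ger0_norm ?powR_ge0//; have h := gM n x Bx.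
  by apply: ge0_ler_powR; rewrite ?nnegrE ?(ltW p0)// (le_trans _ h).
pose I n := \int[leb]_(x in B) (`|g_ n x| `^ p).
have IE n : LB_norm p (f_ n) = (I n `^ p^-1)%:E.
  rewrite LB_norm_powR ?gt_eqF// -poweR_EFin; congr (_ `^ _)%E.
  have ig := integrable_bounded mB (@lebesgue_B_lty R N) (mp _ (mg n)) (bp n).
  rewrite /I fineK; last exact: integrable_fin_num.
  apply: ae_eq_integral => //.
  - by apply/measurable_EFinP; exact: mp.
  - by apply/measurable_EFinP; exact: mp.
  - by apply: filterS (fg n) => x h Bx; rewrite /= h.
under eq_fun do rewrite IE.
have I0 : I n @[n --> \oo] --> (0 : R).
  have pc x : B x -> `|g_ n x| `^ p @[n --> \oo] --> (0 : R).
    move=> Bx; have E : (0 : R) `^ p = 0 by rewrite powR0// gt_eqF.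
    rewrite -[X in _ --> X]E.
    apply: (powR_cvg (F := \oo) (f := fun n => `|g_ n x|) (g := fun=> p)) => //.
      by rewrite -(normr0 R); apply: cvg_norm; exact: g0.
    exact: cvg_cst.
  have [_ H] := Rintegral_dominated_cvg (mu := leb) (f := fun=> 0) mB (fun n => mp _ (mg n))
     pc (@integrable_cstB R N (M `^ p)) bp.
  by rewrite (@Rintegral_eq0 _ _ _ leb B (fun=> 0)) in H.
apply: cvg_EFin_real.
have <- : (0 : R) `^ p^-1 = 0 by rewrite powR0// invr_eq0 gt_eqF.
apply: powR_cvg => //; last exact: cvg_cst.
- by move=> n; apply: Rintegral_ge0 => x _; exact: powR_ge0.
- by rewrite invr_gt0.
Qed.

(** Interpolation: d = d^beta d^(1-beta), with d <= L |x - y| in the first factor and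
    d <= 2 S in the second. *)
Lemma holder_norm_le (beta S L : R) w : 0 < beta -> beta < 1 ->
  (forall x, cB x -> `|w x| <= S) ->
  (forall x y, cB x -> cB y -> `|w x - w y| <= L * enorm (x - y)) -> 0 <= L ->
  (holder_norm beta w <= (S + L `^ beta * (2 * S) `^ (1 - beta))%:E)%E.
Proof.
move=> b0 b1 wS wL L0; rewrite EFinD; apply: leeD; apply: ge_ereal_sup.
  by move=> _ [x cx <-]; rewrite lee_fin wS.
move=> _ [[x y] /= [cx cy xy] <-]; rewrite lee_fin.
have e0 : 0 < enorm (x - y) by rewrite enorm_gt0 subr_eq0.
have S0 : 0 <= S by rewrite (le_trans _ (wS x cx)).
rewrite ler_pdivrMr ?powR_gt0//.
have d2 : `|w x - w y| <= 2 * S.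
  by rewrite (le_trans (ler_normB _ _))// mulr_natl mulr2n lerD// wS.
have dE : `|w x - w y| = `|w x - w y| `^ beta * `|w x - w y| `^ (1 - beta).
  have [->|d0] := eqVneq (w x - w y) 0.
    by rewrite normr0 powR0 ?gt_eqF// mul0r.
  by rewrite -powRD ?subrKC ?powRr1// normr_eq0 (negbTE d0) implybT.
rewrite dE mulrAC -powRM ?(ltW e0)//; apply: ler_pM; rewrite ?powR_ge0//.
  by apply: ge0_ler_powR; rewrite ?nnegrE ?(ltW b0) ?mulr_ge0 ?(ltW e0)// wL.
by apply: ge0_ler_powR; rewrite ?nnegrE ?subr_ge0 ?(ltW b1) ?mulr_ge0.
Qed.

Lemma holder_norm_ge0 (beta : R) w : (0 < N)%N -> (0 <= holder_norm beta w)%E.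
Proof.
move=> N0; pose e : V := delta_mx ord0 (Ordinal N0).
have c0 : cB 0 by rewrite /cB /= enorm0.
have ce : cB e by rewrite /cB /= enorm_delta.
apply: adde_ge0.
  apply: (@le_trans _ _ (`|w 0|%:E)); first by rewrite lee_fin.
  by apply: ereal_sup_ubound; exists 0.
apply: (@le_trans _ _ ((`|w e - w 0| / enorm (e - 0) `^ beta)%:E)).
  by rewrite lee_fin divr_ge0// powR_ge0.
apply: ereal_sup_ubound; exists (e, 0) => //=; split => //.
by rewrite -enorm_gt0 enorm_delta.
Qed.

End norm_convergence.

Section profile_estimates.
Context (R : realType) (N : nat).
Local Notation V := 'rV[R]_N.
Local Notation leb := (@lebesgue_rV R N).
Local Notation B := (@B R N).
Local Notation cB := (@cB R N).
Hypothesis N0 : (0 < N)%N.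

Lemma profile_fun_lipschitz m q c h (x y : V) : profile N m q c h ->
  `|profile_fun c h x - profile_fun c h y| <= 4 * enorm (x - y).
Proof.
move=> [ch _ h4 _ _]; have mh : measurable_fun setT h by exact: continuous_measurable_fun.
have hn r : `|h r| <= 4 by have /andP[a b] := h4 r; rewrite ger0_norm.
rewrite /profile_fun opprD addrACA subrr add0r.
apply: le_trans (primitive_lipschitz _ _ mh hn) _.
by rewrite ler_wpM2l// enorm_lipschitz.
Qed.

Lemma radial_grad_integrable m q c h i : profile N m q c h ->
  leb.-integrable B (EFin \o (fun x => radial_grad h x ord0 i)).
Proof.
move=> ph; have [_ lG _] := weak_gradient_profile ph; case: ph => _ _ h4 _ _.
apply: (integrable_bounded (M := 4) (@measurable_B R N) (@lebesgue_B_lty R N)).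
  by apply: locally_integrable_measurable; exact: lG.
move=> x _; rewrite (le_trans (radial_grad_coord_le _ _ _))//.
by have /andP[a b] := h4 (enorm x); rewrite ger0_norm.
Qed.

Lemma weak_gradient_solution m q u c h : 1 < m -> solution m q u -> profile N m q c h ->
  (forall x, B x -> x != 0 -> u x = profile_fun c h x) -> weak_gradient u (radial_grad h).
Proof.
move=> m1 [[[W1u _] _ _] _ _] ph uE; have [_ iu _] := W1_integrable (ltW m1) W1u.
apply: (weak_gradient_ae (weak_gradient_profile ph) iu).
- by move=> i; exact: radial_grad_integrable ph.
- by apply: filterS (@ae_neq0 R N N0) => x /eqP x0 Bx; rewrite uE.
- exact: aeW.
Qed.

End profile_estimates.

(** * Convergence of the solutions *)

Theorem theorem1p1 (R : realType) (N : nat) (hN : (0 < N)%N)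
  (p_ : nat -> R) (p q : R)
  (hp_ : forall n, 1 < p_ n) (hp : 1 < p) (hcvg : p_ @ \oo --> p)
  (hq : p < q) (hq_ : forall n, p_ n < q)
  (u_ : nat -> 'rV[R]_N -> R) (hu_ : forall n, solution (p_ n) q (u_ n)) :
  exists k : nat -> nat, {homo k : i j / (i < j)%N} /\
  exists u : 'rV[R]_N -> R,
    [/\ solution p q u,
        W1_cvg p (fun n => u_ (k n)) u &
        forall beta : R, 0 < beta -> beta < 1 ->
          holder_cvg beta (fun n => u_ (k n)) u].
Proof.
pose leb := @lebesgue_rV R N; have mB := @measurable_B R N.
have p0 : 0 < p by exact: lt_trans hp.
have /choice[ch hch] : forall n, exists ch : R * (R -> R),
    profile N (p_ n) q ch.1 ch.2 /\
    forall x, B x -> x != 0 -> u_ n x = profile_fun ch.1 ch.2 x.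
  move=> n; have ph := solution_profile hN (hp_ n) (hq_ n) (hu_ n).
  eexists (_, _); split; first exact: ph.
  move=> x Bx x0; exact: (solution_profile_fun hN (hp_ n) (hq_ n) (hu_ n) Bx x0).
have [k [hk [f kf]]] : exists k : nat -> nat, {homo k : i j / (i < j)%N} /\
    exists f : R -> R, forall n r, 0 <= r <= 1 ->
    `|(ch (k n)).1 + primitive (ch (k n)).2 r - f r| <= n.+1%:R^-1.
  apply: (lipschitz_subsequence (f_ := fun n r => (ch n).1 + primitive (ch n).2 r)
    (a := 1 / 4) (b := 4) (L := 4)).
    by move=> n r /andP[_ r1]; exact: (profile_bounds (hch n).1 r1).
  move=> n r s; have [[cn _ h4 _ _] _] := hch n.
  have mh : measurable_fun setT (ch n).2 by exact: continuous_measurable_fun.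
  have hn t : `|(ch n).2 t| <= 4 by have /andP[a b] := h4 t; rewrite ger0_norm.
  by rewrite opprD addrACA subrr add0r distrC (distrC r) primitive_lipschitz.
exists k; split=> //.
pose c_ n := (ch (k n)).1; pose h_ n := (ch (k n)).2.
have ph n : profile N (p_ (k n)) q (c_ n) (h_ n) by exact: (hch (k n)).1.
have uE n x : B x -> x != 0 -> u_ (k n) x = profile_fun (c_ n) (h_ n) x by exact: (hch (k n)).2.
have kn n : (n <= k n)%N.
  by elim: n => [//|n IH]; apply: leq_ltn_trans IH _; exact: hk.
have pk : (fun n => p_ (k n)) @ \oo --> p.
  apply: (cvg_comp k p_ _ hcvg) => A [m _ hm]; exists m => // n /= mn; apply: hm.
  exact: leq_trans mn (kn n).
have harm : n.+1%:R^-1 @[n --> \oo] --> (0 : R) by exact: cvg_harmonic.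
have fc r : 0 <= r <= 1 -> c_ n + primitive (h_ n) r @[n --> \oo] --> f r.
  move=> r01; apply/cvgrPdist_lt => e e0.
  have := harm; move/cvgr0Pnorm_lt => /(_ e e0); apply: filterS => n.
  by rewrite ger0_norm// => h; rewrite distrC; exact: le_lt_trans (kf n r r01) h.
have pl := limit_profile hN (fun n => hp_ (k n)) hp hq (fun n => hq_ (k n)) pk ph fc.
have fE := limit_profileE hN (fun n => hp_ (k n)) hp hq (fun n => hq_ (k n)) pk ph fc.
have hc := slope_cvg hN (fun n => hp_ (k n)) hp hq (fun n => hq_ (k n)) pk ph fc.
set h := slope _ _ _ in pl fE hc; set c := f 0 in pl fE.
pose u := profile_fun (N := N) c h.
have unif n (x : 'rV[R]_N) : cB x -> `|profile_fun (c_ n) (h_ n) x - u x| <= n.+1%:R^-1.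
  move=> cx; have x01 : 0 <= enorm x <= 1 by rewrite enorm_ge0.
  by have := kf n _ x01; rewrite fE.
exists u; split; first exact: (profile_solution hN pl hp hq).
- have wu : weak_gradient u (radial_grad h) by exact: (weak_gradient_profile pl).
  have wun n : weak_gradient (u_ (k n)) (radial_grad (h_ n)).
    exact: (weak_gradient_solution hN (hp_ (k n)) (hu_ (k n)) (ph n) (uE n)).
  have h4_ n r : `|h_ n r| <= 4.
    by case: (ph n) => _ _ /(_ r)/andP[a b] _ _; rewrite ger0_norm.
  have h4 r : `|h r| <= 4 by case: pl => _ _ /(_ r)/andP[a b] _ _; rewrite ger0_norm.
  have W1u : W1 p u by exact: (profile_W1 hN pl p0).
  have W1un n : W1 p (u_ (k n)).
    (* the value at the origin is not controlled by the profile *)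
    have M4 : 4 <= 4 + `|u_ (k n) 0| by rewrite lerDl.
    apply: (W1_bounded (M := 4 + `|u_ (k n) 0|) hN p0 (wun n)) => x; last first.
      move=> i _; apply: le_trans (radial_grad_coord_le _ _ _) _.
      exact: le_trans (h4_ n _) M4.
    move=> Bx; have [->|x0] := eqVneq x 0; first by rewrite lerDr.
    have /andP[a b] := profile_bounds (ph n) (ltW Bx).
    by rewrite uE// (le_trans _ M4)// ger0_norm// (le_trans _ a)// divr_ge0.
  have [_ iu _] := W1_integrable (ltW hp) W1u.
  have iun n := let: And3 _ i _ := W1_integrable (ltW hp) (W1un n) in i.
  have wd n : weak_gradient (u_ (k n) - u) (fun x => radial_grad (h_ n) x - radial_grad h x).
    apply: (weak_gradientB (wun n) wu (iun n) iu) => i.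
      exact: (radial_grad_integrable _ (ph n)).
    exact: (radial_grad_integrable _ pl).
  split=> //.
  rewrite -[X in _ --> X]adde0; apply: cvgeD => //.
    apply: (LB_norm_cvg0 (M := 1) (g_ := fun n x => profile_fun (c_ n) (h_ n) x - u x)) => //.
    + move=> n; apply: measurable_funB; first exact: integrable_measurable (iun n).
      exact: integrable_measurable iu.
    + move=> n; apply: measurable_funB; last exact: integrable_measurable iu.
      have [lu _ _] := weak_gradient_profile (ph n); exact: locally_integrable_measurable.
    + by move=> n; apply: filterS (@ae_neq0 R N hN) => x /eqP x0 Bx; rewrite -uE.
    + by move=> n x /ltW Bx; rewrite (le_trans (unif n x Bx))// invf_le1// ler1n.
    + move=> x /ltW Bx; apply/cvgr0Pnorm_lt => e e0.
      have := harm; move/cvgr0Pnorm_lt => /(_ e e0); apply: filterS => n.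
      by rewrite ger0_norm// => e1; exact: le_lt_trans (unif n x Bx) e1.
  apply: (LB_norm_cvg0 (M := 8) (g_ := fun n x => `|h_ n (enorm x) - h (enorm x)|)) => //.
  + move=> n; apply: (@measurableT_comp _ _ _ _ _ _ (@Num.sqrt R)).
      by apply: continuous_measurable_fun; exact: sqrt_continuous.
    by apply: measurable_dotv => i; exact: (measurable_wgrad i (wd n)).
  + move=> n; apply: measurable_funTS; apply: measurableT_comp => //.
    have me := @measurable_enorm R N.
    apply: measurable_funB; apply: measurableT_comp => //; apply: continuous_measurable_fun.
      by case: (ph n).
    by case: pl.
  + move=> n; apply: filterS2 (@ae_neq0 R N hN) (wgrad_ae hN (wd n)) => x /eqP x0 wx Bx.
    rewrite wx//= /radial_grad -scalerBl -mulrBl.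
    by rewrite (enorm_radial_grad (fun r => h_ n r - h r) x0).
  + move=> n x _; rewrite normr_id (le_trans (ler_normB _ _))//.
    by rewrite (le_trans (lerD (h4_ n _) (h4 _)))// -natrD.
  + move=> x _; rewrite -(normr0 R); apply: cvg_norm.
    rewrite -(subrr (h (enorm x))); apply: cvgB; [exact: hc|exact: cvg_cst].
move=> beta b0 b1; exists (fun n => profile_fun (c_ n) (h_ n)).
have hold m d g : profile N m q d g -> holder beta (profile_fun (N := N) d g).
  move=> pd; rewrite /holder; apply: le_lt_trans (ltry _).
  apply: (holder_norm_le (S := 4) b0 b1).
    move=> x cx; have /andP[a b] := profile_bounds pd cx.
    by rewrite ger0_norm// (le_trans _ a)// divr_ge0.
  - by move=> x y _ _; exact: (profile_fun_lipschitz x y pd).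
  - by [].
split.
- by move=> n; apply: filterS (@ae_neq0 R N hN) => x /eqP x0 Bx; rewrite uE.
- by move=> n; exact: hold (ph n).
- exact: hold pl.
(* 4 + 4 is a Lipschitz constant of the difference *)
pose b n : R := n.+1%:R^-1 + 8 `^ beta * (2 * n.+1%:R^-1) `^ (1 - beta).
apply: (@squeeze_cvge _ _ _ _ (fun=> 0%E) _ (fun n => (b n)%:E)).
- apply: nearW => n; rewrite holder_norm_ge0//=; apply: holder_norm_le => //.
    by move=> x cx; exact: unif.
  move=> x y cx cy; rewrite [X in `|X|](_ : _ =
      (profile_fun (c_ n) (h_ n) x - profile_fun (c_ n) (h_ n) y) - (u x - u y)); last first.
    by rewrite /= !fctE /=; ring.
  rewrite (le_trans (ler_normB _ _))//.
  have l1 := profile_fun_lipschitz x y (ph n); have l2 := profile_fun_lipschitz x y pl.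
  by rewrite (le_trans (lerD l1 l2))// -mulrDl -natrD.
- exact: cvg_cst.
- apply: cvg_EFin_real.
  have E : 0 + 8 `^ beta * (2 * 0) `^ (1 - beta) = 0 :> R.
    by rewrite mulr0 powR0 ?subr_eq0 ?gt_eqF// mulr0 addr0.
  rewrite -[X in _ --> X]E; apply: cvgD => //; apply: cvgM; first exact: cvg_cst.
  apply: powR_cvg; rewrite ?subr_gt0//.
  + by apply: cvgM => //; exact: cvg_cst.
  + exact: cvg_cst.
Qed.
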